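(* Let $\epsilon,\delta$ be nonnegative real constants with $\epsilon<\frac{1}{12}$ and $\delta<\frac{(1-12\epsilon)^2}{10409}$. Then every $\epsilon$-dense partial Latin square $P$ of order $n$ containing no more than $\delta n^2$ filled cells in total is completable. Furthermore, there is a deterministic algorithm which, given such a $P$ of order $n$ (together with the constants $\epsilon,\delta$), constructs a Latin square $L$ of order $n$ that is a completion of $P$ using no more than $O(n^3)$ steps.
   Context: A Latin square of order $n$ is an $n\times n$ array filled with symbols from $\{1,\dots,n\}$ such that no symbol is repeated in any row or column. A partial Latin square of order $n$ is an $n\times n$ array in which each cell is either blank or contains one symbol from $\{1,\dots,n\}$, such that no symbol is repeated in any row or column. A completion of $P$ is a Latin square obtained by filling the blank cells of $P$; $P$ is completable if it has a completion. A partial Latin square of order $n$ is $\epsilon$-dense if each row contains at most $\epsilon n$ filled (nonblank) cells, each column contains at most $\epsilon n$ filled cells, and each symbol occurs in at most $\epsilon n$ cells. The input $P$ is given as a list of triples (row, column, symbol). A step is an elementary task that a computer can complete in a bounded amount of time (such as reading or writing an array entry, or comparing or adding two numbers of size polynomial in $n$); the paper says that it formally has a deterministic model of computation (a deterministic Turing machine) in mind, without tracking such model-dependent details. *)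

(* Defs.v *)
From mathcomp Require Import all_boot all_order all_algebra reals.

Set Implicit Arguments.
Unset Strict Implicit.
Unset Printing Implicit Defensive.

Import Order.TTheory GRing.Theory Num.Theory.

(** * Latin squares

    Rows, columns and symbols of an order-n square are all indexed by ['I_n]
    (so the symbol set is {0,...,n-1} rather than {1,...,n}); a blank cell of a
    partial square holds [None]. *)

Definition latin_square n (L : 'M['I_n]_n) : Prop :=
  (forall i, injective (L i)) /\ (forall j, injective (L^~ j)).

Definition partial_latin_square n (P : 'M[option 'I_n]_n) : Prop :=
  (forall i j j' k, P i j = Some k -> P i j' = Some k -> j = j') /\
  (forall i i' j k, P i j = Some k -> P i' j = Some k -> i = i').

Definition completion n (P : 'M[option 'I_n]_n) (L : 'M['I_n]_n) : Prop :=
  latin_square L /\ forall i j k, P i j = Some k -> L i j = k.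

Definition completable n (P : 'M[option 'I_n]_n) : Prop :=
  exists L : 'M['I_n]_n, completion P L.

Definition dense (R : realType) (eps : R) n (P : 'M[option 'I_n]_n) : Prop :=
  [/\ forall i, (#|[set j | isSome (P i j)]|%:R <= eps * n%:R)%R,
      forall j, (#|[set i | isSome (P i j)]|%:R <= eps * n%:R)%R
    & forall k, (#|[set c : 'I_n * 'I_n | P c.1 c.2 == Some k]|%:R
                   <= eps * n%:R)%R].

Definition filled n (P : 'M[option 'I_n]_n) : nat :=
  #|[set c : 'I_n * 'I_n | isSome (P c.1 c.2)]|.

Definition constants_ok (R : realType) (eps delta : R) : Prop :=
  [/\ (0 <= eps)%R, (0 <= delta)%R, (eps < 1 / 12)%R
    & (delta < (1 - 12 * eps) ^+ 2 / 10409)%R].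

Definition eligible (R : realType) (eps delta : R) n
    (P : 'M[option 'I_n]_n) : Prop :=
  [/\ partial_latin_square P, dense eps P
    & ((filled P)%:R <= delta * n%:R ^+ 2)%R].

(** * Model of computation

    A deterministic word RAM, presented as a while-language.  The memory holds
    natural numbers only, in finitely many scalar variables and arrays (those
    occurring in the program text).  No number larger than the word size [W]
    may ever be produced, otherwise the run is stuck; [W] will be required to
    be polynomial in n, so every operation below is an elementary task.

    The real constants eps and delta cannot be stored in memory; the machine
    receives them as Dedekind cuts, through the two tests [LeEps] and [LeDelta]
    [a <= eps * b] and [a <= delta * b] on machine numbers a, b. *)

Inductive op := Add | Sub | Mul | Div | Eq | Le | LeEps | LeDelta.

Inductive expr :=
  | Num of nat
  | Var of nat
  | Get of nat & expr            (* [Get a e] : entry number [e] of array [a] *)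
  | Bin of op & expr & expr.

Inductive prog :=
  | Skip
  | Assign of nat & expr
  | Put of nat & expr & expr     (* [Put a e1 e2] : array a [e1] := e2 *)
  | Seq of prog & prog
  | If of expr & prog & prog     (* a condition holds iff it is nonzero *)
  | While of expr & prog.

Record state := State { vars : nat -> nat; arrs : nat -> nat -> nat }.

Definition upd T (f : nat -> T) (x : nat) (v : T) : nat -> T :=
  fun y => if y == x then v else f y.

Definition set_var st x v := State (upd (vars st) x v) (arrs st).

Definition set_arr st a i v :=
  State (vars st) (upd (arrs st) a (upd (arrs st a) i v)).

Section Semantics.

Variables (R : realType) (eps delta : R) (W : nat).

(* [Sub] is truncated, [Div] is floor division with a / 0 = 0, and truth values
   are 0 and 1. *)
Definition apply_op (o : op) (a b : nat) : nat :=
  match o with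
  | Add => a + b
  | Sub => a - b
  | Mul => a * b
  | Div => a %/ b
  | Eq => a == b
  | Le => a <= b
  | LeEps => (a%:R <= eps * b%:R)%R
  | LeDelta => (a%:R <= delta * b%:R)%R
  end.

Fixpoint eval (st : state) (e : expr) : nat :=
  match e with
  | Num k => k
  | Var x => vars st x
  | Get a e1 => arrs st a (eval st e1)
  | Bin o e1 e2 => apply_op o (eval st e1) (eval st e2)
  end.

(* Every value occurring in the evaluation of [e] is at most [W]. *)
Fixpoint fits (st : state) (e : expr) : bool :=
  (eval st e <= W) &&
  match e with
  | Num _ | Var _ => true
  | Get _ e1 => fits st e1
  | Bin _ e1 e2 => fits st e1 && fits st e2
  end.

Fixpoint cost (e : expr) : nat :=
  match e with
  | Num _ | Var _ => 1
  | Get _ e1 => (cost e1).+1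
  | Bin _ e1 e2 => (cost e1 + cost e2).+1
  end.

(* [exec p st st' t] : started in [st], the program [p] halts in [st'] after
   exactly [t] steps. *)
Inductive exec : prog -> state -> state -> nat -> Prop :=
  | ExecSkip st : exec Skip st st 1
  | ExecAssign x e st :
      fits st e -> exec (Assign x e) st (set_var st x (eval st e)) (cost e).+1
  | ExecPut a e1 e2 st :
      fits st e1 -> fits st e2 ->
      exec (Put a e1 e2) st (set_arr st a (eval st e1) (eval st e2))
        (cost e1 + cost e2).+1
  | ExecSeq p q st st1 st2 t1 t2 :
      exec p st st1 t1 -> exec q st1 st2 t2 -> exec (Seq p q) st st2 (t1 + t2)
  | ExecIfT e p q st st' t :
      fits st e -> eval st e != 0 -> exec p st st' t ->
      exec (If e p q) st st' ((cost e).+1 + t)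
  | ExecIfF e p q st st' t :
      fits st e -> eval st e == 0 -> exec q st st' t ->
      exec (If e p q) st st' ((cost e).+1 + t)
  | ExecWhileT e p st st1 st2 t1 t2 :
      fits st e -> eval st e != 0 ->
      exec p st st1 t1 -> exec (While e p) st1 st2 t2 ->
      exec (While e p) st st2 ((cost e).+1 + t1 + t2)
  | ExecWhileF e p st :
      fits st e -> eval st e == 0 -> exec (While e p) st st (cost e).+1.

Lemma exec_det p st st1 st2 t1 t2 :
  exec p st st1 t1 -> exec p st st2 t2 -> st1 = st2 /\ t1 = t2.
Proof.
move=> H; elim: H st2 t2 => {p st st1 t1}.
- by move=> st st2 t2 H; inversion H.
- by move=> x e st _ st2 t2 H; inversion H.
- by move=> a e1 e2 st _ _ st2 t2 H; inversion H.
- move=> p q st st1 st2 t1 t2 _ IHp _ IHq st3 t3 H.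
  inversion H as [| | |p' q' s s1 s2 u1 u2 Hp Hq| | | |]; subst.
  by have [? ?] := IHp _ _ Hp; subst; have [? ?] := IHq _ _ Hq; subst.
- move=> e p q st st' t _ n0 _ IH st2 t2 H.
  inversion H as [| | | |? ? ? ? ? ? _ _ Hp|? ? ? ? ? ? _ z _| |]; subst.
    by have [-> ->] := IH _ _ Hp.
  by rewrite z in n0.
- move=> e p q st st' t _ z0 _ IH st2 t2 H.
  inversion H as [| | | |? ? ? ? ? ? _ n _|? ? ? ? ? ? _ _ Hq| |]; subst.
    by rewrite z0 in n.
  by have [-> ->] := IH _ _ Hq.
- move=> e p st st1 st2 t1 t2 _ n0 _ IHp _ IHw st3 t3 H.
  inversion H as [| | | | | |? ? ? ? ? ? ? _ _ Hp Hw|? ? ? _ z]; subst.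
    by have [? ?] := IHp _ _ Hp; subst; have [? ?] := IHw _ _ Hw; subst.
  by rewrite z in n0.
- move=> e p st _ z0 st3 t3 H.
  inversion H as [| | | | | |? ? ? ? ? ? ? _ n _ _|]; subst => //.
  by rewrite z0 in n.
Qed.

End Semantics.

(** * Input and output *)

Definition lists_cells n (P : 'M[option 'I_n]_n)
    (s : seq ('I_n * 'I_n * 'I_n)) : Prop :=
  uniq s /\ forall i j k, ((i, j, k) \in s) = (P i j == Some k).

(* Variables 0 and 1 hold n and the length of the list; arrays 0, 1 and 2 hold
   the rows, columns and symbols of the listed triples; everything else is 0. *)
Definition input_state n (s : seq ('I_n * 'I_n * 'I_n)) : state :=
  State (nth 0 [:: n; size s])
        (fun a => match a with
                  | 0 => nth 0 [seq val c.1.1 | c <- s]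
                  | 1 => nth 0 [seq val c.1.2 | c <- s]
                  | 2 => nth 0 [seq val c.2 | c <- s]
                  | _ => fun _ => 0
                  end).

(* The output is read off array 3, which holds the square in row-major order. *)
Definition outputs n (L : 'M['I_n]_n) (st : state) : Prop :=
  forall i j : 'I_n, arrs st 3 (i * n + j) = L i j.

(* "O(n^3) steps": the constant [C] and the polynomial bound [D * n ^ d] on the
   numbers manipulated may depend on eps and delta, but not on n or P. *)
Definition completes_in_cubic_time (R : realType) (p : prog)
    (eps delta : R) : Prop :=
  exists C D d : nat,
    forall (n : nat) (P : 'M[option 'I_n]_n) (s : seq ('I_n * 'I_n * 'I_n)),
      0 < n -> eligible eps delta P -> lists_cells P s ->
      exists (L : 'M['I_n]_n) (st : state) (t : nat),
        [/\ exec eps delta (D * n ^ d) p (input_state s) st t,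
            t <= C * n ^ 3, completion P L & outputs L st].

(* Main.v *)
(* Let n = 2k or 2k+1.  In the table of the dihedral group of order 2k, two lines of
   opposite parities meet in intercalates (2x2 Latin subsquares), so that every cell
   lies in k of them.  Starting from this table (prolonged along a transversal when n
   is odd), the listed triples are installed one after the other by trades, each
   changing at most 61 cells and none of the listed cells already right: a short chain
   of exchanges is opened, and it is closed by switching intercalates which make the
   symbols that have to agree agree.  The rows, columns and symbols of a trade are
   found by linear searches, among the cells which still carry their original symbol
   and away from the lines and symbols already changed too often.  If F cells are
   filled, fewer than 61 F cells have been changed at any time; with
   S = (1 - 12 eps) n and 10409 F < S^2, Markov's inequality and the density bound
   eps n leave candidates for each search.  A trade takes O(n) steps, and there are at
   most n^2 of them. *)

From mathcomp Require Import all_boot all_order all_algebra reals.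
From mathcomp Require Import perm.
From mathcomp Require Import zify ring lra.
From Stdlib Require Import FunctionalExtensionality.
Require Import Defs.

Set Implicit Arguments.
Unset Strict Implicit.
Unset Printing Implicit Defensive.

Import Order.TTheory GRing.Theory Num.Theory.

(** * Programs with clipped assignments *)

(** The constant 12 comes from the hardest search: two cells whose symbols have the same parity must
    receive a common second symbol; there are k, about n/2, candidates, and prescribed entries spoil
    at most 3 eps n of them for each cell. The constant 61 is 10 + 9 + 3 * 14: the cells reserved
    for the trade itself, those reserved to close its open ends, and for each of three ends two more
    cells and at most four switched intercalates with three further cells each. No lower bound on n
    is assumed, so the additive constants of the counts have to be absorbed as well. As a
    relabelling of the symbols satisfies the first triple for free, at most 61 F - 118 cells have
    changed before any trade; the inequalities to be shown then become quadratics in S with negative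
    discriminant. Intercalates abound in a dihedral table because a rotation and a reflection differ
    by a reflection, which is an involution. A machine run that exceeds the word size is stuck.
    Programs are therefore written in a language that clips stored values, where the word bound is
    automatic; the correctness proofs only have to show that no value gets clipped. *)

Inductive cprog :=
  | CSkip
  | CAssign of nat & expr
  | CPut of nat & expr & expr
  | CSeq of cprog & cprog
  | CIf of expr & cprog & cprog
  | CWhile of expr & cprog.

Definition cap : expr := Bin Mul (Num 100) (Bin Mul (Var 0) (Var 0)).

(* Every stored value is replaced by 0 if it exceeds 100 n^2: the word size
   condition then holds by construction, whatever the program does. *)
Definition clip (e : expr) : expr := Bin Mul e (Bin Le e cap).

Fixpoint comp (p : cprog) : prog :=
  match p with
  | CSkip => Skip
  | CAssign x e => Assign x (clip e)
  | CPut a e1 e2 => Put a e1 (clip e2)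
  | CSeq p q => Seq (comp p) (comp q)
  | CIf e p q => If e (comp p) (comp q)
  | CWhile e p => While e (comp p)
  end.

(** An exponent: if the memory is bounded by B, then the value of [e] is at most [B ^ esize e].
    Sizes are added at every operator because multiplication is the worst case. *)
Fixpoint esize (e : expr) : nat :=
  match e with
  | Num _ | Var _ => 1
  | Get _ e1 => (esize e1).+1
  | Bin _ e1 e2 => esize e1 + esize e2
  end.

Fixpoint eok (e : expr) : bool :=
  match e with
  | Num c => c <= 100
  | Var _ => true
  | Get _ e1 => eok e1
  | Bin _ e1 e2 => eok e1 && eok e2
  end.

(* Admissible for word-size exponent [s]; variable 0, which holds n, is never
   assigned. *)
Fixpoint pok (s : nat) (p : cprog) : bool :=
  match p with
  | CSkip => true
  | CAssign x e => [&& x != 0, eok e & esize (clip e) <= s]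
  | CPut _ e1 e2 => [&& eok e1, eok e2, esize e1 <= s & esize (clip e2) <= s]
  | CSeq p q => pok s p && pok s q
  | CIf e p q => [&& eok e, esize e <= s, pok s p & pok s q]
  | CWhile e p => [&& eok e, esize e <= s & pok s p]
  end.

(** A purely syntactic time bound: each loop is charged [N.+1] rounds, the last one paying for the
    final test, and a conditional is charged for both branches. That loops do stop within N rounds
    is checked in [wp_while]. *)
Fixpoint tbound (N : nat) (p : cprog) : nat :=
  match p with
  | CSkip => 1
  | CAssign x e => (cost (clip e)).+1
  | CPut a e1 e2 => (cost e1 + cost (clip e2)).+1
  | CSeq p q => tbound N p + tbound N q
  | CIf e p q => (cost e).+1 + (tbound N p + tbound N q)
  | CWhile e p => N.+1 * ((cost e).+1 + tbound N p)
  end.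

Fixpoint depth (p : cprog) : nat :=
  match p with
  | CSeq p q | CIf _ p q => maxn (depth p) (depth q)
  | CWhile _ p => (depth p).+1
  | _ => 0
  end.

Lemma tbound_poly N p : tbound N p <= tbound 0 p * N.+1 ^ depth p.
Proof.
have mono d d' : d <= d' -> N.+1 ^ d <= N.+1 ^ d' by move=> h; rewrite leq_pexp2l.
elim: p => [|x e|a e1 e2|p IHp q IHq|e p IHp q IHq|e p IHp] /=; rewrite ?muln1 //.
- rewrite mulnDl leq_add //.
  + by apply: leq_trans IHp _; rewrite leq_mul2l mono ?orbT ?leq_maxl.
  + by apply: leq_trans IHq _; rewrite leq_mul2l mono ?orbT ?leq_maxr.
- rewrite mulnDl leq_add //; first by rewrite leq_pmulr ?expn_gt0.
  rewrite mulnDl leq_add //.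
  + by apply: leq_trans IHp _; rewrite leq_mul2l mono ?orbT ?leq_maxl.
  + by apply: leq_trans IHq _; rewrite leq_mul2l mono ?orbT ?leq_maxr.
- rewrite mul1n expnS mulnCA leq_mul2l /= mulnDl leq_add //.
  by rewrite leq_pmulr // expn_gt0.
Qed.

Section Run.

Variables (R : realType) (eps delta : R).
Local Notation eval := (eval eps delta).

(** This semantics has no word-size test, so that correctness can be proved without mentioning W;
    [run_exec] recovers the test afterwards. *)
Inductive run : cprog -> state -> state -> nat -> Prop :=
  | RunSkip st : run CSkip st st 1
  | RunAssign x e st :
      run (CAssign x e) st (set_var st x (eval st (clip e))) (cost (clip e)).+1
  | RunPut a e1 e2 st :
      run (CPut a e1 e2) st (set_arr st a (eval st e1) (eval st (clip e2)))
        (cost e1 + cost (clip e2)).+1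
  | RunSeq p q st st1 st2 t1 t2 :
      run p st st1 t1 -> run q st1 st2 t2 -> run (CSeq p q) st st2 (t1 + t2)
  | RunIfT e p q st st' t :
      eval st e != 0 -> run p st st' t -> run (CIf e p q) st st' ((cost e).+1 + t)
  | RunIfF e p q st st' t :
      eval st e == 0 -> run q st st' t -> run (CIf e p q) st st' ((cost e).+1 + t)
  | RunWhileT e p st st1 st2 t1 t2 :
      eval st e != 0 -> run p st st1 t1 -> run (CWhile e p) st1 st2 t2 ->
      run (CWhile e p) st st2 ((cost e).+1 + t1 + t2)
  | RunWhileF e p st :
      eval st e == 0 -> run (CWhile e p) st st (cost e).+1.

Definition bounded (B : nat) (st : state) : Prop :=
  (forall x, vars st x <= B) /\ (forall a i, arrs st a i <= B).

(** Only stored values are clipped, so intermediate values may exceed B; they remain polynomial in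
    it. Both factors being at least 2, the sum in the [Add] case is below the product. *)
Lemma eval_bound B st e : 100 <= B -> bounded B st -> eok e ->
  eval st e <= B ^ esize e.
Proof.
move=> B100 [bv ba]; have B0 : 0 < B by apply: leq_trans B100.
elim: e => [c|x|a e IH|o e1 IH1 e2 IH2]; rewrite /= ?expn1 //.
- by move=> /leq_trans; apply.
- move=> _; apply: (leq_trans (ba _ _)); rewrite expnS leq_pmulr //.
  by rewrite expn_gt0 B0.
case/andP=> /IH1 h1 /IH2 h2.
have p1 e : 0 < B ^ esize e by rewrite expn_gt0 B0.
have g1 e : 1 < B ^ esize e.
  have : 0 < esize e by elim: (e) => //= *; lia.
  by move=> ?; rewrite -{1}(expn0 B) ltn_exp2l //; lia.
have hs : B ^ esize e1 + B ^ esize e2 <= B ^ (esize e1 + esize e2).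
  by rewrite expnD; have := g1 e1; have := g1 e2; nia.
have h1' : B ^ esize e1 <= B ^ (esize e1 + esize e2).
  by rewrite leq_exp2l ?leq_addr //; lia.
have b1 (b : bool) : b <= B ^ (esize e1 + esize e2).
  by case: b => //; rewrite expn_gt0 B0.
case: o => //=.
- exact: leq_trans (leq_add h1 h2) hs.
- by apply: leq_trans (leq_subr _ _) (leq_trans h1 h1').
- by rewrite expnD leq_mul.
- by apply: leq_trans (leq_div _ _) (leq_trans h1 h1').
Qed.

Lemma fits_bound B s W st e : 100 <= B -> bounded B st -> eok e ->
  esize e <= s -> B ^ s <= W -> fits eps delta W st e.
Proof.
move=> B100 bst ok es hW.
have key e' : eok e' -> esize e' <= s -> eval st e' <= W.
  move=> ok' es'; apply: leq_trans (eval_bound B100 bst ok') (leq_trans _ hW).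
  by rewrite leq_exp2l //; lia.
elim: e ok es => [c|x|a e IH|o e1 IH1 e2 IH2] ok es; have /= -> := key _ ok es => //=.
  by apply: IH => //; apply: ltnW.
move: ok es => /= /andP[ok1 ok2] es.
rewrite IH1 ?IH2 //.
  by apply: leq_trans es; rewrite leq_addl.
by apply: leq_trans es; rewrite leq_addr.
Qed.

Definition capv (n : nat) := 100 * (n * n).

Lemma eval_clipE st e :
  eval st (clip e) = eval st e * (eval st e <= capv (vars st 0)).
Proof. by []. Qed.

Lemma eval_clip_le st e : eval st (clip e) <= capv (vars st 0).
Proof. by rewrite eval_clipE; case E: (eval st e <= _); rewrite ?muln1 ?muln0. Qed.

Lemma run_exec n s W p st st' t : 0 < n -> capv n ^ s <= W ->
  pok s p -> vars st 0 = n -> bounded (capv n) st ->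
  run p st st' t ->
  [/\ exec eps delta W (comp p) st st' t, vars st' 0 = n & bounded (capv n) st'].
Proof.
move=> n0 hW ok v0 bst H.
have B100 : 100 <= capv n by rewrite /capv; nia.
have fb := fun st e => @fits_bound (capv n) s W st e B100.
elim: H ok v0 bst => {p st st' t}.
- by move=> st _ v0 bst; split=> //; constructor.
- move=> x e st /= /and3P[x0 oke es] v0 bst; split.
  + apply: ExecAssign; apply: fb => //=.
    by rewrite oke.
  + by rewrite /= /upd eq_sym (negbTE x0).
  + case: bst => bv ba; split=> // y /=; rewrite /upd; case: eqP => // _.
    by rewrite -v0; exact: eval_clip_le.
- move=> a e1 e2 st /= /and4P[ok1 ok2 es1 es2] v0 bst; split=> //.
  + apply: ExecPut; apply: fb => //=.
    by rewrite ok2.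
  + case: bst => bv ba; split=> // b i /=; rewrite /upd; case: eqP => // _.
    case: eqP => // _.
    by rewrite -v0; exact: eval_clip_le.
- move=> p q st st1 st2 t1 t2 _ IHp _ IHq /= /andP[okp okq] v0 bst.
  have [e1 v1 b1] := IHp okp v0 bst; have [e2 v2 b2] := IHq okq v1 b1.
  by split=> //; apply: ExecSeq e1 e2.
- move=> e p q st st' t h _ IH /= /and4P[oke es okp okq] v0 bst.
  have [e1 v1 b1] := IH okp v0 bst.
  by split=> //; apply: ExecIfT => //; apply: fb.
- move=> e p q st st' t h _ IH /= /and4P[oke es okp okq] v0 bst.
  have [e1 v1 b1] := IH okq v0 bst.
  by split=> //; apply: ExecIfF => //; apply: fb.
- move=> e p st st1 st2 t1 t2 h _ IHp _ IHw /= ok v0 bst.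
  have /and3P[oke es okp] := ok.
  have [e1 v1 b1] := IHp okp v0 bst; have [e2 v2 b2] := IHw ok v1 b1.
  by split=> //; apply: ExecWhileT e1 e2 => //; apply: fb.
- move=> e p st h /= /and3P[oke es okp] v0 bst.
  by split=> //; apply: ExecWhileF => //; apply: fb.
Qed.

(** * Weakest preconditions *)

Variable N : nat.

(** Total correctness together with running time: the bound [tbound N p] is part of the predicate,
    and so is carried along by every rule. *)
Definition wp (p : cprog) (Q : state -> Prop) (st : state) : Prop :=
  exists st' t, [/\ run p st st' t, t <= tbound N p & Q st'].

Lemma wp_mono p (Q Q' : state -> Prop) st :
  wp p Q st -> (forall st', Q st' -> Q' st') -> wp p Q' st.
Proof. by case=> st' [t [r ht q]] h; exists st', t; split=> //; apply: h. Qed.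

Lemma wp_skip (Q : state -> Prop) st : Q st -> wp CSkip Q st.
Proof. by move=> q; exists st, 1; split=> //; constructor. Qed.

Lemma wp_seq p q Q st : wp p (wp q Q) st -> wp (CSeq p q) Q st.
Proof.
case=> st1 [t1 [r1 h1 [st2 [t2 [r2 h2 hq]]]]].
by exists st2, (t1 + t2); split=> //; [apply: RunSeq r1 r2|rewrite leq_add].
Qed.

Lemma wp_assign x e v (Q : state -> Prop) st :
  eval st e = v -> v <= capv (vars st 0) -> Q (set_var st x v) ->
  wp (CAssign x e) Q st.
Proof.
move=> ev le q; eexists _, _; split; [exact: RunAssign|by []|].
by rewrite eval_clipE ev le muln1.
Qed.

Lemma wp_put a e1 e2 i v (Q : state -> Prop) st :
  eval st e1 = i -> eval st e2 = v -> v <= capv (vars st 0) ->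
  Q (set_arr st a i v) -> wp (CPut a e1 e2) Q st.
Proof.
move=> ei ev le q; eexists _, _; split; [exact: RunPut|by []|].
by rewrite eval_clipE ei ev le muln1.
Qed.

Lemma wp_if e (b : bool) p q Q st : (eval st e != 0) = b ->
  (b -> wp p Q st) -> (~~ b -> wp q Q st) -> wp (CIf e p q) Q st.
Proof.
case: b => eb hp hq.
- have [st' [t [r ht qq]]] := hp isT; exists st', ((cost e).+1 + t).
  by split=> //=; [apply: RunIfT|rewrite leq_add2l (leq_trans ht) ?leq_addr].
- have [st' [t [r ht qq]]] := hq isT; exists st', ((cost e).+1 + t).
  split=> //=; [apply: RunIfF => //|rewrite leq_add2l (leq_trans ht) ?leq_addl //].
  by rewrite -[_ == 0]negbK eb.
Qed.

Lemma wp_while e p (I : nat -> state -> Prop) (Q : state -> Prop) m st :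
  m <= N -> I 0 st ->
  (forall l s, l < m -> I l s -> eval s e != 0 /\ wp p (I l.+1) s) ->
  (forall s, I m s -> eval s e == 0 /\ Q s) ->
  wp (CWhile e p) Q st.
Proof.
move=> mN I0 step last.
(* Induction on the number d of rounds still to be run, which is what the time bound counts. *)
suff: forall d l s, l + d = m -> I l s ->
    exists s' t, [/\ run (CWhile e p) s s' t,
      t <= d.+1 * ((cost e).+1 + tbound N p) & Q s'].
  move/(_ m 0 st erefl I0) => [s' [t [r ht q]]]; exists s', t; split=> //=.
  by apply: leq_trans ht _; rewrite leq_mul2r ltnS mN orbT.
elim=> [|d IH] l s lm Is.
  move: lm Is; rewrite addn0 => -> /last[e0 q].
  exists s, (cost e).+1; split=> //; first exact: RunWhileF.
  by rewrite mul1n leq_addr.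
have [|en [s1 [t1 [r1 h1 I1]]]] := step l s _ Is; first by lia.
have [|s2 [t2 [r2 h2 q]]] := IH l.+1 s1 _ I1; first by lia.
exists s2, ((cost e).+1 + t1 + t2); split=> //; first exact: RunWhileT r1 r2.
by rewrite mulSn -addnA -addnA leq_add2l leq_add.
Qed.

Lemma set_varK st x u v : set_var (set_var st x u) x v = set_var st x v.
Proof.
rewrite /set_var /=; congr State; apply: functional_extensionality => y.
by rewrite /upd; case: eqP.
Qed.

Definition eNot e := Bin Eq e (Num 0).
Definition eLt e1 e2 := Bin Le (Bin Add e1 (Num 1)) e2.

Definition search x c :=
  CSeq (CAssign x (Num 0))
       (CWhile (eNot c) (CAssign x (Bin Add (Var x) (Num 1)))).

Lemma wp_search x c (Q : state -> Prop) st n :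
  x != 0 -> vars st 0 = n -> n <= N ->
  (exists2 j, j < n & eval (set_var st x j) c != 0) ->
  (forall j, j < n -> eval (set_var st x j) c != 0 -> Q (set_var st x j)) ->
  wp (search x c) Q st.
Proof.
move=> x0 v0 nN ex hq.
have ex' : exists j, (j < n) && (eval (set_var st x j) c != 0).
  by case: ex => j jn cj; exists j; rewrite jn.
case: (ex_minnP ex') => j /andP[jn cj] min {ex ex'}.
have v0' i : vars (set_var st x i) 0 = n by rewrite /= /upd eq_sym (negbTE x0).
have j2 i : i <= n -> i <= capv n.
  by rewrite /capv; case: n {v0 nN jn min hq v0'} => [|n]; nia.
apply: wp_seq; apply: (wp_assign (v := 0)) => //.
apply: (@wp_while _ _ (fun l s => s = set_var st x l) _ j).
- by apply: leq_trans (ltnW jn) nN.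
- by [].
- move=> l s lj ->; split.
    have := min l; rewrite (ltn_trans lj jn) /=; case: eqP => // _ /(_ isT).
    by rewrite leqNgt lj.
  apply: (wp_assign (v := l.+1)); rewrite ?v0'.
  + by rewrite /= /upd eqxx addn1.
  + by apply: j2; apply: leq_trans (ltnW jn).
  + exact: set_varK.
- by move=> s ->; split; [rewrite /= (negbTE cj)|apply: hq].
Qed.

(* The body must not change the value of [b]. *)
Definition for_ x b p :=
  CSeq (CAssign x (Num 0))
       (CWhile (eLt (Var x) b) (CSeq p (CAssign x (Bin Add (Var x) (Num 1))))).

Lemma wp_for x b p (I : nat -> state -> Prop) (Q : state -> Prop) m st :
  x != 0 -> m <= N -> m <= capv (vars st 0) ->
  I 0 (set_var st x 0) ->
  (forall l s, l <= m -> I l s ->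
     [/\ vars s x = l, eval s b = m & vars s 0 = vars st 0]) ->
  (forall l s, l < m -> I l s ->
     wp p (fun s' => vars s' x = l /\ vars s' 0 = vars st 0 /\
                     I l.+1 (set_var s' x l.+1)) s) ->
  (forall s, I m s -> Q s) ->
  wp (for_ x b p) Q st.
Proof.
move=> x0 mN mc I0 Iv step last.
apply: wp_seq; apply: (wp_assign (v := 0)) => //.
apply: (@wp_while _ _ I _ m) => //.
- move=> l s lm Is; have [vx vb v0] := Iv _ _ (ltnW lm) Is; split.
    by rewrite /= vx vb addn1 lm.
  apply: wp_seq; apply: wp_mono (step _ _ lm Is) _ => s' [vx' [v0' I']].
  apply: (wp_assign (v := l.+1)) => //; first by rewrite /= vx' addn1.
  by rewrite v0'; apply: leq_trans mc.
- move=> s Is; have [vx vb v0] := Iv _ _ (leqnn _) Is.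
  by split; [rewrite /= vx vb addn1 ltnn|exact: last].
Qed.

End Run.

Arguments wp_assign {R eps delta N x e} v {Q st}.
Arguments wp_put {R eps delta N a e1 e2} i v {Q st}.

(** * Latin squares with lookup tables *)

Section Latin.

Variable n : nat.
Notation I := 'I_n.

(* [sqL i j] is the symbol in cell (i,j), [sqC i s] the column of symbol s in
   row i and [sqR j s] its row in column j. *)
Record sq := Sq { sqL : I -> I -> I; sqC : I -> I -> I; sqR : I -> I -> I }.

Definition latin (A : sq) : Prop :=
  [/\ forall i s, sqL A i (sqC A i s) = s, forall i j, sqC A i (sqL A i j) = j,
      forall j s, sqL A (sqR A j s) j = s & forall i j, sqR A j (sqL A i j) = i].

Definition upd2 T (f : I -> I -> T) x y v : I -> I -> T :=
  fun i j => if (i == x) && (j == y) then v else f i j.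

Definition wr (A : sq) (w : I * I * I) : sq :=
  let: (i, j, s) := w in
  Sq (upd2 (sqL A) i j s) (upd2 (sqC A) i s j) (upd2 (sqR A) j s i).

(** An injective map of a finite set to itself is bijective, so a right inverse on each line is also
    a left inverse. *)
Lemma latin_intro A :
  (forall i s, sqL A i (sqC A i s) = s) -> (forall j s, sqL A (sqR A j s) j = s) ->
  latin A.
Proof.
move=> h1 h2; split=> // i.
- have inj : injective (sqC A i) by apply: can_inj (h1 i).
  have [g gK Kg] := injF_bij inj.
  by move=> j; rewrite -{1}(Kg j) h1 Kg.
- move=> j; have inj : injective (sqR A j) by apply: (can_inj (g := sqL A ^~ j)) (h2 j).
  have [g gK Kg] := injF_bij inj.
  by rewrite -{1}(Kg i) h2 Kg.
Qed.

Definition wcell (w : I * I * I) : I * I := (w.1.1, w.1.2).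

Lemma wr_out A W i j : (i, j) \notin map wcell W ->
  sqL (foldl wr A W) i j = sqL A i j.
Proof.
elim: W A => [|[[x y] s] W IH] A //=; rewrite inE negb_or => /andP[ne /IH ->].
by rewrite /= /upd2 -xpair_eqE (negbTE ne).
Qed.

Lemma wr_in A W w : uniq (map wcell W) -> w \in W ->
  sqL (foldl wr A W) w.1.1 w.1.2 = w.2.
Proof.
elim: W A => [|[[x y] s] W IH] A //= /andP[nin u]; rewrite inE => /orP[/eqP->|/IH->//].
by rewrite (wr_out _ nin) /= /upd2 !eqxx.
Qed.

Lemma wr_C A W i s :
  sqC (foldl wr A W) i s = sqC A i s /\ (forall w, w \in W -> (w.1.1, w.2) != (i, s))
  \/ exists2 w, w \in W & (w.1.1, w.2) = (i, s) /\ sqC (foldl wr A W) i s = w.1.2.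
Proof.
elim: W A => [|[[x y] v] W IH] A; first by left.
have [[e ne]|[w wW h]] := IH (wr A (x, y, v)); last first.
  by right; exists w => //; rewrite inE wW orbT.
have [exv|nxv] := eqVneq (x, v) (i, s).
  right; exists (x, y, v); first by rewrite mem_head.
  split=> //=; rewrite e /= /upd2; case: exv => -> ->.
  by rewrite !eqxx.
left; split=> [|w].
  by rewrite /= e /= /upd2 -xpair_eqE eq_sym (negbTE nxv).
by rewrite inE => /orP[/eqP->|/ne].
Qed.

Lemma wr_R A W j s :
  sqR (foldl wr A W) j s = sqR A j s /\ (forall w, w \in W -> (w.1.2, w.2) != (j, s))
  \/ exists2 w, w \in W & (w.1.2, w.2) = (j, s) /\ sqR (foldl wr A W) j s = w.1.1.
Proof.
elim: W A => [|[[x y] v] W IH] A; first by left.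
have [[e ne]|[w wW h]] := IH (wr A (x, y, v)); last first.
  by right; exists w => //; rewrite inE wW orbT.
have [exv|nxv] := eqVneq (y, v) (j, s).
  right; exists (x, y, v); first by rewrite mem_head.
  split=> //=; rewrite e /= /upd2; case: exv => -> ->.
  by rewrite !eqxx.
left; split=> [|w].
  by rewrite /= e /= /upd2 -xpair_eqE eq_sym (negbTE nxv).
by rewrite inE => /orP[/eqP->|/ne].
Qed.

(* Rewriting the cells of W keeps the square Latin as soon as every symbol lost
   by a row or by a column is given back to it. *)
Lemma latin_wr A W : latin A -> uniq (map wcell W) ->
  (forall w, w \in W -> (w.1.1, sqL A w.1.1 w.1.2) \in [seq (v.1.1, v.2) | v <- W]) ->
  (forall w, w \in W -> (w.1.2, sqL A w.1.1 w.1.2) \in [seq (v.1.2, v.2) | v <- W]) ->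
  latin (foldl wr A W).
Proof.
move=> [l1 l2 l3 l4] u hr hc; apply: latin_intro.
- move=> i s; have [[e ne]|[w wW [[<- <-] e]]] := wr_C A W i s; last first.
    by rewrite e wr_in.
  rewrite e wr_out ?l1 //; apply/mapP => -[w wW [ei ej]].
  have := hr w wW; rewrite -ei -ej l1 => /mapP[v vW ev].
  by have := ne v vW; rewrite -ev eqxx.
- move=> j s; have [[e ne]|[w wW [[<- <-] e]]] := wr_R A W j s; last first.
    by rewrite e wr_in.
  rewrite e wr_out ?l3 //; apply/mapP => -[w wW [ei ej]].
  have := hc w wW; rewrite -ei -ej l3 => /mapP[v vW ev].
  by have := ne v vW; rewrite -ev eqxx.
Qed.

Lemma latin_sq A (M : 'M[I]_n) : latin A -> (forall i j, M i j = sqL A i j) ->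
  latin_square M.
Proof.
case=> l1 l2 l3 l4 e; split=> [i x y|j x y] /=; rewrite !e => h.
  by rewrite -(l2 i x) h l2.
by rewrite -(l4 x j) h l4.
Qed.

Lemma lat_row A i j j' : latin A -> sqL A i j = sqL A i j' -> j = j'.
Proof. by case=> _ l _ _ h; rewrite -(l i j) h l. Qed.

Lemma lat_col A i i' j : latin A -> sqL A i j = sqL A i' j -> i = i'.
Proof. by case=> _ _ _ l h; rewrite -(l i j) h l. Qed.

End Latin.

(** * The initial square *)

(* Sums and differences modulo k, written without division. *)
Definition addk k x := if x < k then x else x - k.
Definition subk k x y := if y <= x then x - y else x + k - y.

(** For x < k, the number x stands for the rotation [r^x] and k + x for the reflection [r^x s],
    where [s r = r^-1 s]. Being at least k is thus the nontrivial homomorphism to a group of order 2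
    whose kernel is the rotations. *)
Definition Dn k i j :=
  if i < k then (if j < k then addk k (i + j) else k + addk k (i + (j - k)))
  else (if j < k then k + subk k (i - k) j else subk k (i - k) (j - k)).

(* The two rows and the two columns of the switched intercalate. *)
Definition sr1 (t : nat) := t.
Definition sr2 k := 2 * k - 3.
Definition sc1 (t : nat) := t.
Definition sc2 k := 2 * k - 2.

Definition swp (a b x : nat) := if x == a then b else if x == b then a else x.

(** Parity forbids a transversal when k is odd: along one, rows and columns together contain 2k
    reflections while the symbols contain k. The switched intercalate has one symbol of each parity,
    and the transversal built below uses exactly one of its four cells, which corrects the count. *)
Definition En k t (o : bool) i j :=
  if o && ((i == sr1 t) || (i == sr2 k)) then Dn k i (swp (sc1 t) (sc2 k) j) else Dn k i j.

(* Row i of [En] contributes the cell in column [Tn i] to a transversal.  When k is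
   odd the dihedral table has none, hence the switched intercalate. *)
Definition Tn_even k t i :=
  if i < t then i else if i < k then k + (i - t) else
  if i < k + t then k + (k - 1 - (i - k)) else k - 1 - (i - k - t).

Definition Tn_odd k t i :=
  if i <= t then i else if i < 2 * t - 1 then k + 2 + i - t else
  if i < 2 * t then k + t + 2 else if i < k then k + t + 3 else
  if i <= k + 1 then k + 1 - (i - k) else if i < k + t - 1 then k + (k + 1 - (i - k)) else
  if i < k + t then k + t + 1 else if i < k + 2 * t - 1 then 3 * t - (i - k) else
  if i < k + 2 * t then k + 2 else t + 1.

Definition Tn k t (o : bool) i := if o then Tn_odd k t i else Tn_even k t i.

Ltac casesk :=
  rewrite /Dn /addk /subk;
  repeat match goal with |- context[if (?a <= ?b)%N then _ else _] => case: (leqP a b) => ? end;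
  lia.

Section Table.

Variables (k t : nat) (o : bool).
Hypothesis t8 : 8 <= t.
Hypothesis kt : k = (if o then 2 * t + 1 else 2 * t).

Lemma Dn_lt i j : i < 2 * k -> j < 2 * k -> Dn k i j < 2 * k.
Proof. by clear kt; casesk. Qed.

Lemma Dn_par i j : i < 2 * k -> j < 2 * k -> (k <= Dn k i j) = (k <= i) (+) (k <= j).
Proof.
by clear kt; move=> hi hj; rewrite /Dn; case: (ltnP i k) => h1; case: (ltnP j k) => h2;
  rewrite /= /addk /subk; case: ifP => ?; lia.
Qed.

Lemma Dn_row i j j' : i < 2 * k -> j < 2 * k -> j' < 2 * k -> Dn k i j = Dn k i j' -> j = j'.
Proof. by clear kt; casesk. Qed.

Lemma Dn_col i i' j : i < 2 * k -> i' < 2 * k -> j < 2 * k -> Dn k i j = Dn k i' j -> i = i'.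
Proof. by clear kt; casesk. Qed.

(** In the group, [u = i'^-1 i] is a reflection, hence an involution: from [u j' = j] follows
    [u j = j']. *)
Lemma Dn_inter i i' j j' : i < 2 * k -> i' < 2 * k -> j < 2 * k -> j' < 2 * k ->
  (k <= i) != (k <= i') -> Dn k i j' = Dn k i' j -> Dn k i j = Dn k i' j'.
Proof.
clear kt; move=> hi hi' hj hj' ne e; have := congr1 (leq k) e.
rewrite !Dn_par //; move: ne e; rewrite /Dn.
case: (ltnP i k) => h1; case: (ltnP i' k) => h2 //= _;
  case: (ltnP j k) => h3; case: (ltnP j' k) => h4 //= e _;
  move: e; casesk.
Qed.

Lemma swp_inj a b : injective (swp a b).
Proof. by move=> x y; rewrite /swp; do ![case: eqP => //] => *; lia. Qed.

Lemma swp_lt a b c x : a < c -> b < c -> x < c -> swp a b x < c.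
Proof. by rewrite /swp; do ![case: eqP => //] => *; lia. Qed.

Lemma En_row i j j' : i < 2 * k -> j < 2 * k -> j' < 2 * k ->
  En k t o i j = En k t o i j' -> j = j'.
Proof.
move=> hi hj hj'; rewrite /En; case: ifP => h; last exact: Dn_row.
have s1 : sc1 t < 2 * k by rewrite /sc1; move: kt t8; clear; case: o; lia.
have s2 : sc2 k < 2 * k by rewrite /sc2; move: kt t8; clear; case: o; lia.
by move/Dn_row => e; apply: (@swp_inj (sc1 t) (sc2 k)); apply: e; rewrite ?swp_lt.
Qed.

Lemma En_lt i j : i < 2 * k -> j < 2 * k -> En k t o i j < 2 * k.
Proof.
move=> hi hj; rewrite /En; case: ifP => h; apply: Dn_lt => //.
by apply: swp_lt => //; rewrite /sc1 /sc2; move: kt t8; clear; case: o; lia.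
Qed.

(** Switching an intercalate exchanges two entries in each of two rows or, equally well, in each of
    two columns. The definition serves for the injectivity of rows, this form for that of
    columns. *)
Lemma En_swap i j : i < 2 * k -> j < 2 * k -> En k t o i j =
  if o && ((j == sc1 t) || (j == sc2 k)) then Dn k (swp (sr1 t) (sr2 k) i) j else Dn k i j.
Proof.
move=> hi hj; rewrite /En; case ho : o => //=.
have e : k = 2 * t + 1 by rewrite kt ho.
rewrite /sr1 /sr2 /sc1 /sc2 /swp e; move: t8; clear => t8.
by do ![case: eqP => //=] => *; subst; first [lia | casesk].
Qed.

Lemma En_col i i' j : i < 2 * k -> i' < 2 * k -> j < 2 * k ->
  En k t o i j = En k t o i' j -> i = i'.
Proof.
move=> hi hi' hj; rewrite !En_swap //; case: ifP => h; last exact: Dn_col.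
have s1 : sr1 t < 2 * k by rewrite /sr1; move: kt t8; clear; case: o; lia.
have s2 : sr2 k < 2 * k by rewrite /sr2; move: kt t8; clear; case: o; lia.
by move/Dn_col => e; apply: (@swp_inj (sr1 t) (sr2 k)); apply: e; rewrite ?swp_lt.
Qed.

Lemma Tn_lt i : i < 2 * k -> Tn k t o i < 2 * k.
Proof.
move=> hi; rewrite /Tn; case ho : o; rewrite /Tn_odd /Tn_even.
  have e : k = 2 * t + 1 by rewrite kt ho.
  by move: hi t8; rewrite e; clear; casesk.
have e : k = 2 * t by rewrite kt ho.
by move: hi t8; rewrite e; clear; casesk.
Qed.

Lemma Tn_inj i i' : i < 2 * k -> i' < 2 * k -> Tn k t o i = Tn k t o i' -> i = i'.
Proof.
move=> hi hi'; rewrite /Tn; case ho : o; rewrite /Tn_odd /Tn_even.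
  have e : k = 2 * t + 1 by rewrite kt ho.
  by move: hi hi' t8; rewrite e; clear; casesk.
have e : k = 2 * t by rewrite kt ho.
by move: hi hi' t8; rewrite e; clear; casesk.
Qed.

Definition Sn i := En k t o i (Tn k t o i).

Lemma Sn_even i : o = false -> i < 2 * k ->
  Sn i = if i < t then 2 * i else if i < k then k + addk k (2 * i - t) else
  if i < k + t then 2 * (i - k) + 1 else k + addk k (2 * (i - k) + 1 - t).
Proof.
move=> ho; have e : k = 2 * t by rewrite kt ho.
rewrite /Sn /En /Tn ho /= /Tn_even e; move: t8; clear => t8 hi.
case: (ltnP i t) => h1; first by casesk.
case: (ltnP i (2 * t)) => h2; first by casesk.
case: (ltnP i (2 * t + t)) => h3; first by casesk.
by casesk.
Qed.

(** A closed form in which the table is evaluated once and for all, so that the injectivity of [Sn]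
    becomes linear arithmetic on the pieces. *)
Lemma Sn_odd i : o = true -> i < 2 * k ->
  Sn i = if i < t then 2 * i else if i <= t then k + t - 2 else
  if i < 2 * t - 1 then k + addk k (2 * i + 2 - t) else
  if i < 2 * t then k + t else if i < k then k + t + 2 else
  if i <= k then k - 1 else if i < k + t - 1 then 2 * (i - k) - 1 else
  if i < k + t then k - 2 else if i < k + 2 * t - 1 then k + addk k (2 * (i - k) + 1 - t) else
  if i < k + 2 * t then 2 * t - 3 else k + t - 1.
Proof.
move=> ho; have e : k = 2 * t + 1 by rewrite kt ho.
rewrite /Sn /En /Tn ho /= /Tn_odd e; move: t8; clear => t8 hi.
rewrite /swp /sr1 /sr2 /sc1 /sc2.
(* The only switched cell on the transversal is (t, t): its symbol 2t becomes k + t - 2, of the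
   other parity. In the other switched row the transversal uses column t + 2, which is not
   switched. *)
case: (eqVneq i t) => [->|nit].
  by rewrite leqnn eqxx ltnn /=; casesk.
have lt i' : (i' <= t) = (i' < t) || (i' == t) by rewrite leq_eqVlt orbC.
case: (eqVneq i (2 * (2 * t + 1) - 3)) => [e|ne].
  set T := (if i <= t then _ else _); have -> : T = t + 2 by rewrite /T; move/eqP: nit => nit; casesk.
  have n1 : (t + 2 == t) = false by apply/eqP; lia.
  have n2 : (t + 2 == 2 * (2 * t + 1) - 2) = false by apply/eqP; lia.
  by rewrite ?n1 n2 orbT {}/T e /=; casesk.
rewrite ?orbF /=; rewrite lt (negbTE nit) orbF; move/eqP: nit => nit; move/eqP: ne => ne.
case: (ltnP i t) => h1; first by casesk.
case: (ltnP i (2 * t - 1)) => h2; first by casesk.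
case: (ltnP i (2 * t)) => h3; first by casesk.
case: (ltnP i (2 * t + 1)) => h4; first by casesk.
case: (leqP i (2 * t + 1 + 1)) => h6; first by casesk.
case: (ltnP i (2 * t + 1 + t - 1)) => h7; first by casesk.
case: (ltnP i (2 * t + 1 + t)) => h8; first by casesk.
case: (ltnP i (2 * t + 1 + 2 * t - 1)) => h9; first by casesk.
case: (ltnP i (2 * t + 1 + 2 * t)) => h10; first by casesk.
by casesk.
Qed.

Lemma Sn_lt i : i < 2 * k -> Sn i < 2 * k.
Proof. by move=> hi; apply: En_lt => //; apply: Tn_lt. Qed.

Lemma Sn_inj i i' : i < 2 * k -> i' < 2 * k -> Sn i = Sn i' -> i = i'.
Proof.
move=> hi hi'; case: (boolP o) => ho.
  rewrite !Sn_odd //; have e : k = 2 * t + 1 by rewrite kt ho.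
  by move: hi hi' t8; rewrite e; clear; casesk.
rewrite !Sn_even ?(negbTE ho) //; have e : k = 2 * t by rewrite kt (negbTE ho).
by move: hi hi' t8; rewrite e; clear; casesk.
Qed.

End Table.

(** * Counting *)

Section Counting.

Variable T : finType.
Implicit Types (Z : pred T) (bs : seq (pred T * nat)).

Fixpoint bnds Z bs : Prop :=
  match bs with
  | [::] => True
  | (b, m) :: bs' => #|[predI Z & b]| <= m /\ bnds Z bs'
  end.

Fixpoint avoids bs (z : T) : bool :=
  match bs with
  | [::] => true
  | (b, _) :: bs' => ~~ b z && avoids bs' z
  end.

(** The union bound, with the list of forbidden sets and their bounds given explicitly so that each
    search below can be stated as such a list. *)
Lemma exists_avoids Z bs : bnds Z bs -> sumn (map snd bs) < #|Z| ->
  exists2 z, Z z & avoids bs z.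
Proof.
elim: bs Z => [|[b m] bs IH] Z /=; first by move=> _ /card_gt0P[z Zz]; exists z.
case=> hb hbs lt.
have [||z /= /andP[nb Zz] az] := IH [predI [predC b] & Z].
- elim: bs hbs {IH lt} => [|[b' m'] bs IH] //= [h1 h2]; split; last exact: IH.
  apply: leq_trans h1; apply: subset_leq_card; apply/subsetP => z.
  by rewrite !inE => /andP[/andP[_ ->] ->].
- have := cardID b Z.
  have -> : #|[predD Z & b]| = #|[predI [predC b] & Z]| by apply: eq_card => z; rewrite !inE.
  by move: hb lt; set x := #|_|; set y := #|[predI _ & Z]| => *; lia.
by exists z => //; rewrite az andbT; move: nb; rewrite inE.
Qed.

Lemma card_inj_le (U : finType) (p : pred T) (q : pred U) (f : T -> U) :
  (forall z, p z -> q (f z)) -> (forall z z', p z -> p z' -> f z = f z' -> z = z') ->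
  #|p| <= #|q|.
Proof.
move=> pq inj; rewrite -(card_in_imset (f := f) (D := p)); last first.
  by move=> z z' pz pz'; apply: inj.
by apply: subset_leq_card; apply/subsetP => y /imsetP[z pz ->]; apply: pq.
Qed.

Lemma card_has_le (U : Type) (K : U -> pred T) (s : seq U) :
  (forall u z z', K u z -> K u z' -> z = z') ->
  #|[pred z | has (K ^~ z) s]| <= size s.
Proof.
move=> inj; elim: s => [|u s IH] /=; first by rewrite eq_card0.
have -> : #|[pred z | K u z || has (K ^~ z) s]| = #|[predU K u & [pred z | has (K ^~ z) s]]|.
  by apply: eq_card => z; rewrite !inE.
apply: leq_trans (leq_addr #|[predI K u & [pred z | has (K ^~ z) s]]| _) _.
rewrite cardUI -add1n; apply: leq_add => //.
rewrite leqNgt; apply/negP => /card_gt1P[x [y [xK yK]]].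
by rewrite (inj u x y) ?eqxx.
Qed.

Lemma card_predU_le (p q : pred T) : #|[pred z | p z || q z]| <= #|p| + #|q|.
Proof.
have -> : #|[pred z | p z || q z]| = #|[predU p & q]| by apply: eq_card => z; rewrite !inE.
by rewrite -cardUI leq_addr.
Qed.

Lemma card_sub_le (p q : pred T) : (forall z, p z -> q z) -> #|p| <= #|q|.
Proof. by move=> h; apply: (@card_inj_le _ _ _ id). Qed.

(** Markov's inequality without division: a load f of total at most w M exceeds w q M / S at no more
    than S / q points. *)
Lemma markov (R : realFieldType) (f : T -> nat) (q w M : nat) (S : R) : (0 < S)%R ->
  (0 < q) -> \sum_z f z <= w * M ->
  (#|[pred z | (((w * q * M)%:R : R) < (f z)%:R * S)%R]|%:R * q%:R <= S)%R.
Proof.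
move=> S0 q0 sumf; set bad := [pred z | _].
have [b0|bpos] := posnP #|bad|; first by rewrite b0 mul0r ltW.
have hs : ((#|bad| * (w * q * M))%:R <= (\sum_z f z)%:R * S :> R)%R.
  rewrite (bigID bad) /= natrD mulrDl.
  apply: le_trans (_ : ((\sum_(z | bad z) f z)%:R * S <= _)%R); last first.
    by rewrite lerDl mulr_ge0 // ltW.
  rewrite natr_sum mulr_suml natrM -sum1_card natr_sum mulr_suml.
  by apply: ler_sum => z bz; rewrite mul1r ltW.
(* Needed to cancel w M. If it vanished, f would be zero everywhere and no point could be bad. *)
have wM0 : 0 < w * M.
  case: posnP => // wM; have /card_gt0P[z] := bpos.
  rewrite !inE -mulnA [q * M]mulnC mulnA wM mul0n.
  move: sumf; rewrite wM leqn0 sum_nat_eq0 => /forallP /(_ z) /implyP /(_ isT) /eqP ->.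
  by rewrite mul0r ltxx.
have : ((#|bad| * q)%:R * (w * M)%:R <= S * (w * M)%:R :> R)%R.
  have e : #|bad| * (w * q * M) = #|bad| * q * (w * M) by lia.
  rewrite -natrM -e; apply: le_trans hs _.
  by rewrite mulrC ler_pM2l // ler_nat.
by rewrite ler_pM2r ?ltr0n // natrM.
Qed.

Lemma sum_inj_le (f : T -> nat) (g : T -> T) : injective g ->
  \sum_z f (g z) = \sum_z f z.
Proof.
move=> inj; rewrite [RHS](reindex g) //=.
by apply: onW_bij; apply: injF_bij.
Qed.

End Counting.

(** * Searching for a trade *)

Definition core n k (i : 'I_n) : bool := i < 2 * k.
Definition par n k (i : 'I_n) : bool := k <= i.

(* [D] is, on the first 2k rows and columns, the table of the dihedral group of
   order 2k up to relabelling; [csym] are its symbols and [sp] their parities.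
   [dih_inter] says that two lines of opposite parities form intercalates. *)
Record dihedral n k (D : 'I_n -> 'I_n -> 'I_n) (csym sp : pred 'I_n) : Prop := {
  dih_n1 : 2 * k <= n;
  dih_n2 : n <= 2 * k + 1;
  dih_sym : forall i j, core k i -> core k j -> csym (D i j);
  dih_row : forall i j j', core k i -> core k j -> core k j' -> D i j = D i j' -> j = j';
  dih_col : forall i i' j, core k i -> core k i' -> core k j -> D i j = D i' j -> i = i';
  dih_par : forall i j, core k i -> core k j -> sp (D i j) = par k i (+) par k j;
  dih_inter : forall i i' j j', core k i -> core k i' -> core k j -> core k j' ->
    par k i != par k i' -> D i j' = D i' j -> D i j = D i' j';
  dih_cnt : forall t, #|[pred z | csym z && (sp z == t)]| = k
}.

(* [aB] marks the cells which no longer carry an original symbol, [aFR], [aFC]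
   the rows and columns reserved by the current trade and [aTR] the rows of the
   intercalates it switched; [aRL], [aCL], [aSL] count the cells changed by the
   previous trades on each row, column and symbol. *)
Record ast n := Ast {
  aS : sq n;
  aB : 'I_n -> 'I_n -> bool;
  aFR : 'I_n -> bool;
  aFC : 'I_n -> bool;
  aTR : 'I_n -> bool;
  aRL : 'I_n -> nat;
  aCL : 'I_n -> nat;
  aSL : 'I_n -> nat;
  aLog : seq ('I_n * 'I_n)
}.

Section Trade.

Variables (n k : nat).
Notation I := 'I_n.
Variables (D : I -> I -> I) (csym sp : pred I).
Hypothesis dih : dihedral k D csym sp.
Variables (P : I -> I -> option I) (p : nat).
Hypothesis P_row : forall i, #|[pred j | P i j != None]| <= p.
Hypothesis P_col : forall j, #|[pred i | P i j != None]| <= p.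
Hypothesis P_sym : forall s, #|[pred c : I * I | P c.1 c.2 == Some s]| <= p.

Local Notation core := (core k).
Local Notation par := (par k).
Implicit Type A : ast n.
Local Notation L A := (sqL (aS A)).
Local Notation C A := (sqC (aS A)).
Local Notation Rw A := (sqR (aS A)).

Definition unprot A i j : bool := P i j != Some (L A i j).
Definition pristine A i j : bool := ~~ aB A i j && unprot A i j.
Local Notation unp := unprot.
Local Notation good := pristine.

(** Cells (i, jz) and (iz, j) carry z by definition of the lookups, so the last test is what makes
    the four cells an intercalate. Only the three other cells have to be pristine: the base cell is
    one that the trade has reserved. *)
Definition switchable A i j z : bool :=
  let iz := Rw A j z in let jz := C A i z in
  [&& ~~ aFR A iz, ~~ aFC A jz, good A i jz, good A iz j, good A iz jz
    & L A iz jz == L A i j].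
Local Notation inter := switchable.

Definition newcell (c : I * I) (q : I * I * I * I) : bool :=
  let: (i0, j0, iz, jz) := q in [|| c == (i0, jz), c == (iz, j0) | c == (iz, jz)].

(** Loads on a symbol refer to the original symbol [D i j] of a cell. The [+ 1] stands for the
    transversal used when n is odd: its cells are blocked from the start, one per line and per
    symbol, without being counted as changes. *)
Record inv A (M : nat) : Prop := {
  inv_lat : latin (aS A);
  inv_nat : forall i j, ~~ aB A i j -> [/\ core i, core j & L A i j = D i j];
  inv_rl : forall i, core i -> #|[pred j | core j && aB A i j]| <= aRL A i + 1;
  inv_cl : forall j, core j -> #|[pred i | core i && aB A i j]| <= aCL A j + 1;
  inv_sl : forall x, #|[pred c : I * I |
      [&& core c.1, core c.2, D c.1 c.2 == x & aB A c.1 c.2]]| <= aSL A x + 1;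
  inv_rs : \sum_i aRL A i <= M;
  inv_cs : \sum_i aCL A i <= M;
  inv_ss : \sum_i aSL A i <= M;
  inv_FR : aFR A = fun=> false;
  inv_FC : aFC A = fun=> false;
  inv_TR : aTR A = fun=> false;
  inv_log : aLog A = [::]
}.

(* The situation during a trade started in [A0]; [pr] lists the intercalates
   (base cell, opposite cell) switched so far. *)
Record mid A0 A (pr : seq (I * I * I * I)) : Prop := {
  mid_lat : latin (aS A);
  mid_free : forall i j, ~~ aB A i j -> ~~ aB A0 i j /\ L A i j = L A0 i j;
  mid_blk : forall i j, aB A i j ->
    [|| aB A0 i j, aFR A i && aFC A j | has (newcell (i, j)) pr];
  mid_pr : forall i0 j0 iz jz, (i0, j0, iz, jz) \in pr ->
    [/\ aFR A i0, aFC A j0, ~~ aFR A iz, ~~ aFC A jz & aTR A iz];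
  mid_prot : forall i j, P i j = Some (L A0 i j) -> L A i j = L A0 i j;
  mid_TR : #|[pred i | aTR A i]| <= size pr;
  mid_rl : aRL A = aRL A0;
  mid_cl : aCL A = aCL A0;
  mid_sl : aSL A = aSL A0;
  mid_logB : forall i j, aB A i j -> aB A0 i j \/ (i, j) \in aLog A;
  mid_logBc : forall c, c \in aLog A -> aB A c.1 c.2;
  mid_B0 : forall i j, aB A0 i j -> aB A i j;
  mid_logR : forall i, aFR A i || aTR A i -> i \in map fst (aLog A);
  mid_logC : forall j, aFC A j -> j \in map snd (aLog A)
}.

Lemma prot_row A i : #|[pred j | ~~ unp A i j]| <= p.
Proof.
apply: leq_trans (P_row i); apply: card_sub_le => j /=.
by rewrite negbK => /eqP ->.
Qed.

Lemma prot_col A j : #|[pred i | ~~ unp A i j]| <= p.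
Proof.
apply: leq_trans (P_col j); apply: card_sub_le => i /=.
by rewrite negbK => /eqP ->.
Qed.

Lemma prot_sym A s : #|[pred c : I * I | (L A c.1 c.2 == s) && ~~ unp A c.1 c.2]| <= p.
Proof.
apply: leq_trans (P_sym s); apply: card_sub_le => c /=.
by rewrite negbK => /andP[/eqP <- /eqP ->].
Qed.

Lemma card_core : #|[pred j : I | core j]| = 2 * k.
Proof.
rewrite -sum1_card; have := big_ord_widen n (fun=> 1) (dih_n1 dih).
move=> /(_ 0 addn) <-.
by rewrite sum1_card card_ord.
Qed.

Lemma card_core_par t : #|[pred j : I | core j && (par j == t)]| = k.
Proof.
have kn : k <= n by have := dih_n1 dih; lia.
have card_lt : #|[pred j : I | j < k]| = k.
  rewrite -sum1_card; have := big_ord_widen n (fun=> 1) kn.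
  by move=> /(_ 0 addn) <-; rewrite sum1_card card_ord.
case: t; last first.
  rewrite -[RHS]card_lt; apply: eq_card => j; rewrite !inE /core /par.
  by case: leqP => h; rewrite ?andbF ?andbT //; lia.
have := cardID [pred j : I | j < k] [pred j | core j]; rewrite card_core.
have -> : #|[predI [pred j | core j] & [pred j : I | j < k]]| = k.
  by rewrite -[RHS]card_lt; apply: eq_card => j; rewrite !inE /core; lia.
set x := #|[predD _ & _]|; set y := #|[pred j | _]|; have -> : x = y; last by lia.
by apply: eq_card => j; rewrite !inE /core /par; case: leqP => h; rewrite ?andbF ?andbT //=.
Qed.

Lemma card_csym : #|[pred z | csym z]| = 2 * k.
Proof.
have h1 := dih_cnt dih true; have h2 := dih_cnt dih false.
have := cardID sp [pred z | csym z].
have -> : #|[predI [pred z | csym z] & sp]| = k.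
  by rewrite -[RHS]h1; apply: eq_card => z; rewrite !inE eqb_id.
have -> : #|[predD [pred z | csym z] & sp]| = k.
  by rewrite -[RHS]h2; apply: eq_card => z; rewrite !inE eqbF_neg andbC.
by move=> <-; rewrite mul2n addnn.
Qed.

(** Pigeonhole: the 2k distinct symbols of a row all lie among the 2k core symbols. *)
Lemma dih_cover i z : core i -> csym z -> exists2 j, core j & D i j = z.
Proof.
move=> ci cz; pose X := [set D i j | j in [pred j | core j]].
have/eqP XE : X == [set z | csym z].
  rewrite eqEcard; apply/andP; split.
    by apply/subsetP => y /imsetP[j cj ->]; rewrite inE (dih_sym dih).
  rewrite card_in_imset ?card_core; last by move=> j j' cj cj'; apply: (dih_row dih).
  by rewrite -card_csym; apply: eq_leq; apply: eq_card => x; rewrite !inE.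
have : z \in X by rewrite XE inE.
by case/imsetP => j cj ->; exists j.
Qed.

Lemma dih_cover_col j z : core j -> csym z -> exists2 i, core i & D i j = z.
Proof.
move=> cj cz; pose X := [set D i j | i in [pred i | core i]].
have/eqP XE : X == [set z | csym z].
  rewrite eqEcard; apply/andP; split.
    by apply/subsetP => y /imsetP[i ci ->]; rewrite inE (dih_sym dih).
  rewrite card_in_imset ?card_core; last by move=> i i' ci ci'; apply: (dih_col dih).
  by rewrite -card_csym; apply: eq_leq; apply: eq_card => x; rewrite !inE.
have : z \in X by rewrite XE inE.
by case/imsetP => i ci ->; exists i.
Qed.

Definition dcol i z : I := odflt i [pick j | core j && (D i j == z)].
Definition drow j z : I := odflt j [pick i | core i && (D i j == z)].

Lemma dcolP i z : core i -> csym z -> core (dcol i z) /\ D i (dcol i z) = z.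
Proof.
move=> ci cz; rewrite /dcol; case: pickP => [j /andP[cj /eqP]|no] //.
by have [j cj dj] := dih_cover ci cz; have := no j; rewrite cj dj eqxx.
Qed.

Lemma drowP j z : core j -> csym z -> core (drow j z) /\ D (drow j z) j = z.
Proof.
move=> cj cz; rewrite /drow; case: pickP => [i /andP[ci /eqP]|no] //.
by have [i ci di] := dih_cover_col cj cz; have := no i; rewrite ci di eqxx.
Qed.

(* The rows and columns met by an intercalate through a good base cell (i,j)
   are determined by its second symbol z; the failures are charged to the
   blocked cells of row i, of column j and of symbol [L i j], to the reserved
   lines, and to the previous intercalates, at most one each. *)
Lemma inter_bad A0 M A pr i j : inv A0 M -> mid A0 A pr ->
  core i -> core j -> L A i j = D i j -> aFR A i -> aFC A j ->
  (forall iz jz, (i, j, iz, jz) \notin pr) ->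
  #|[pred z | [&& csym z, sp z != sp (D i j) & ~~ inter A i j z]]|
  <= 3 * p + 3 + (aRL A0 i + aCL A0 j + aSL A0 (D i j))
     + #|[pred x | aFR A x]| + #|[pred x | aFC A x]| + size pr.
Proof.
move=> V m ci cj Lij Fi Fj npr; set x := D i j.
pose Z z := csym z && (sp z != sp x).
pose b1 z := Z z && aFR A (drow j z).
pose b2 z := Z z && aFC A (dcol i z).
pose b3 z := Z z && aB A0 i (dcol i z).
pose b4 z := Z z && aB A0 (drow j z) j.
pose b5 z := Z z && aB A0 (drow j z) (dcol i z).
pose b6 z := Z z && ~~ unp A i (dcol i z).
pose b7 z := Z z && ~~ unp A (drow j z) j.
pose b8 z := [&& Z z, L A (drow j z) (dcol i z) == x & ~~ unp A (drow j z) (dcol i z)].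
pose K q z := [&& Z z, ~~ aFR A (drow j z), ~~ aFC A (dcol i z), q \in pr &
   [|| newcell (i, dcol i z) q, newcell (drow j z, j) q | newcell (drow j z, dcol i z) q]].
(* Since z and x have opposite parities, so have the rows i and [drow j z], which is the hypothesis
   of [dih_inter]. *)
have Zd z : Z z -> [/\ core (dcol i z), core (drow j z), D i (dcol i z) = z,
    D (drow j z) j = z & x = D (drow j z) (dcol i z)].
  move=> /andP[cz nz]; have [cc dc] := dcolP ci cz; have [cr dr] := drowP cj cz.
  split=> //; apply: (dih_inter dih) => //; last by rewrite dc dr.
  by apply: contraNneq nz => e; rewrite -dr !(dih_par dih) // e.
have injc z z' : Z z -> Z z' -> dcol i z = dcol i z' -> z = z'.
  by move=> /Zd[_ _ e _ _] /Zd[_ _ e' _ _] h; rewrite -e -e' h.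
have injr z z' : Z z -> Z z' -> drow j z = drow j z' -> z = z'.
  by move=> /Zd[_ _ _ e _] /Zd[_ _ _ e' _] h; rewrite -e -e' h.
have c1 : #|b1| <= #|[pred y | aFR A y]|.
  apply: (card_inj_le (f := drow j)) => [z /andP[]//|z z' /andP[? _] /andP[? _]].
  exact: injr.
have c2 : #|b2| <= #|[pred y | aFC A y]|.
  apply: (card_inj_le (f := dcol i)) => [z /andP[]//|z z' /andP[? _] /andP[? _]].
  exact: injc.
have c3 : #|b3| <= aRL A0 i + 1.
  apply: leq_trans (inv_rl V ci); apply: (card_inj_le (f := dcol i)).
    by move=> z /andP[/Zd[cc _ _ _ _]] /=; rewrite cc.
  by move=> z z' /andP[? _] /andP[? _]; exact: injc.
have c4 : #|b4| <= aCL A0 j + 1.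
  apply: leq_trans (inv_cl V cj); apply: (card_inj_le (f := drow j)).
    by move=> z /andP[/Zd[_ cr _ _ _]] /=; rewrite cr.
  by move=> z z' /andP[? _] /andP[? _]; exact: injr.
have c5 : #|b5| <= aSL A0 x + 1.
  apply: leq_trans (inv_sl V x).
  apply: (card_inj_le (f := fun z => (drow j z, dcol i z))).
    by move=> z /andP[/Zd[cc cr _ _ ex]] /=; rewrite cc cr -ex eqxx.
  by move=> z z' /andP[zz _] /andP[zz' _] [e _]; exact: injr e.
have c6 : #|b6| <= p.
  apply: leq_trans (prot_row A i); apply: (card_inj_le (f := dcol i)).
    by move=> z /andP[].
  by move=> z z' /andP[? _] /andP[? _]; exact: injc.
have c7 : #|b7| <= p.
  apply: leq_trans (prot_col A j); apply: (card_inj_le (f := drow j)).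
    by move=> z /andP[].
  by move=> z z' /andP[? _] /andP[? _]; exact: injr.
have c8 : #|b8| <= p.
  apply: leq_trans (prot_sym A x).
  apply: (card_inj_le (f := fun z => (drow j z, dcol i z))).
    by move=> z /andP[_].
  by move=> z z' /andP[zz _] /andP[zz' _] [e _]; exact: injr e.
(* A collision with an earlier intercalate fixes its row or its column in the original table, hence
   z. A row collision for one z and a column collision for another would force the earlier base cell
   to be (i, j), which [npr] excludes. *)
have c9 : #|[pred z | has (K ^~ z) pr]| <= size pr.
  apply: card_has_le => -[[[i0 j0] iz] jz] z z' /and5P[zz nr nc qp h] /and5P[zz' nr' nc' _ h'].
  have [Fi0 Fj0 Niz Njz _] := mid_pr m qp.
  have ne : ~ (i = i0 /\ j = j0) by case=> ei ej; have := npr iz jz; rewrite ei ej qp.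
  have F u v : aFR A u -> ~~ aFR A v -> u = v -> False by move=> fu nv e; rewrite -e fu in nv.
  have G u v : aFC A u -> ~~ aFC A v -> u = v -> False by move=> fu nv e; rewrite -e fu in nv.
  have red y : ~~ aFR A (drow j y) -> ~~ aFC A (dcol i y) ->
     [|| newcell (i, dcol i y) (i0, j0, iz, jz), newcell (drow j y, j) (i0, j0, iz, jz)
       | newcell (drow j y, dcol i y) (i0, j0, iz, jz)] ->
     (i = i0 /\ dcol i y = jz) \/ (j = j0 /\ drow j y = iz) \/ (drow j y = iz /\ dcol i y = jz).
    move=> ny my; rewrite /newcell !xpair_eqE => /or3P[] /or3P[] /andP[/eqP e1 /eqP e2]; auto;
      exfalso; by [apply: (F _ _ Fi Niz e1)|apply: (G _ _ Fj Njz e2)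
                  |apply: (F _ _ Fi0 ny (esym e1))|apply: (G _ _ Fj0 my (esym e2))].
  case: (red z nr nc h) => [[a1 a2]|[[a1 a2]|[a1 a2]]];
    case: (red z' nr' nc' h') => [[d1 d2]|[[d1 d2]|[d1 d2]]];
    first [by apply: injc => //; congruence|by apply: injr => //; congruence|by case: ne].
pose u1 z := b1 z || [|| b2 z, b3 z, b4 z, b5 z, b6 z, b7 z, b8 z | has (K ^~ z) pr].
apply: leq_trans (_ : #|u1| <= _).
  apply: card_sub_le => z /and3P[cz nz bad].
  have zz : Z z by rewrite /Z cz.
  rewrite /u1 /b1 /b2 /b3 /b4 /b5 /b6 /b7 /b8 zz /=; apply: contraNT bad; rewrite !negb_or !negbK.
  case/and5P=> n1 n2 n3 n4 /and5P[n5 n6 n7 n8 n9].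
  have [cc cr ec er ex] := Zd z zz.
  have free u v : u \in [:: i; drow j z] -> v \in [:: j; dcol i z] -> (u, v) != (i, j) ->
      ~~ aB A0 u v -> ~~ aB A u v.
    move=> hu hv huv nB0; apply/negP => /(mid_blk m); rewrite (negbTE nB0) /=.
    case/orP => [/andP[fu fv]|].
      move: hu hv huv fu fv; rewrite !inE => /orP[]/eqP-> /orP[]/eqP->;
        by rewrite ?eqxx ?(negbTE n1) ?(negbTE n2).
    move=> /hasP[q qp hq]; case/negP: n9; apply/hasP; exists q => //.
    rewrite /K zz n1 n2 qp /=; move: hu hv huv hq.
    by rewrite !inE => /orP[]/eqP-> /orP[]/eqP->; rewrite ?eqxx // => _ ->; rewrite ?orbT.
  have nij : drow j z != i.
    by apply: contraNneq n1 => ->.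
  have njj : dcol i z != j.
    by apply: contraNneq n2 => ->.
  have f1 : ~~ aB A i (dcol i z) by apply: free; rewrite ?inE ?eqxx ?orbT // xpair_eqE eqxx.
  have f2 : ~~ aB A (drow j z) j by apply: free; rewrite ?inE ?eqxx ?orbT // xpair_eqE (negbTE nij).
  have f3 : ~~ aB A (drow j z) (dcol i z).
    by apply: free; rewrite ?inE ?eqxx ?orbT // xpair_eqE (negbTE nij).
  have nat_ u v : ~~ aB A u v -> L A u v = D u v.
    by move=> /(mid_free m)[nB ->]; have [] := inv_nat V nB.
  have [l1 l2 l3 l4] := mid_lat m.
  have eC : C A i z = dcol i z by rewrite -[in LHS]ec -(nat_ _ _ f1) l2.
  have eR : Rw A j z = drow j z by rewrite -[in LHS]er -(nat_ _ _ f2) l4.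
  have n8' : unp A (drow j z) (dcol i z).
    by move: n8; rewrite nat_ // -ex eqxx /unprot nat_ // -ex.
  by rewrite /switchable /= eC eR n1 n2 /pristine f1 f2 f3 n6 n7 n8' nat_ // -ex Lij eqxx.
apply: leq_trans (card_predU_le _ _) _.
have := leq_trans (card_predU_le b7 [pred z | b8 z || has (K ^~ z) pr]) (leq_add c7 (leq_trans (card_predU_le _ _) (leq_add c8 c9))).
move/(leq_add c6)/(leq_trans (card_predU_le b6 _)).
move/(leq_add c5)/(leq_trans (card_predU_le b5 _)).
move/(leq_add c4)/(leq_trans (card_predU_le b4 _)).
move/(leq_add c3)/(leq_trans (card_predU_le b3 _)).
move/(leq_add c2)/(leq_trans (card_predU_le b2 _)).
move/(leq_add c1) => h; apply: leq_trans h _.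
by lia.
Qed.

End Trade.

(** * Existence of the candidates looked for by each search *)

Section Existence.

Variables (n k : nat).
Notation I := 'I_n.
Variables (D : I -> I -> I) (csym sp : pred I).
Hypothesis dih : dihedral k D csym sp.
Variables (P : I -> I -> option I) (p : nat).
Hypothesis P_row : forall i, #|[pred j | P i j != None]| <= p.
Hypothesis P_col : forall j, #|[pred i | P i j != None]| <= p.
Hypothesis P_sym : forall s, #|[pred c : I * I | P c.1 c.2 == Some s]| <= p.
Variable thr : nat -> nat -> bool.

Local Notation core := (core k).
Local Notation par := (par k).
Implicit Type A : ast n.
Local Notation L A := (sqL (aS A)).
Local Notation C A := (sqC (aS A)).
Local Notation Rw A := (sqR (aS A)).
Local Notation unp := (unprot P).
Local Notation good := (pristine P).
Local Notation inter := (switchable P).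
Local Notation inv := (inv k D).
Local Notation mid := (mid P).

Variables (A0 A : ast n) (M : nat) (pr : seq (I * I * I * I)).
Hypotheses (V : inv A0 M) (m : mid A0 A pr).

Lemma good_nat i j : good A i j -> [/\ core i, core j & L A i j = D i j].
Proof.
by case/andP => /(mid_free m)[nB ->] _; apply: inv_nat V _ _ nB.
Qed.

(** Both base symbols have the same parity, so both cells choose among the same k symbols of the
    opposite parity; [inter_bad] is applied twice, whence 6 p. *)
Lemma exists_z i j i' j' :
  core i -> core j -> L A i j = D i j -> aFR A i -> aFC A j ->
  (forall iz jz, (i, j, iz, jz) \notin pr) ->
  core i' -> core j' -> L A i' j' = D i' j' -> aFR A i' -> aFC A j' ->
  (forall iz jz, (i', j', iz, jz) \notin pr) ->
  sp (D i j) = sp (D i' j') ->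
  6 * p + 6 + (aRL A0 i + aCL A0 j + aSL A0 (D i j) +
               aRL A0 i' + aCL A0 j' + aSL A0 (D i' j'))
    + 2 * (#|[pred x | aFR A x]| + #|[pred x | aFC A x]| + size pr) < k ->
  exists z, inter A i j z && inter A i' j' z.
Proof.
move=> ci cj Lij fi fj npr ci' cj' Lij' fi' fj' npr' ess hk.
have b1 := inter_bad dih P_row P_col P_sym V m ci cj Lij fi fj npr.
have b2 := inter_bad dih P_row P_col P_sym V m ci' cj' Lij' fi' fj' npr'.
set m1 := (X in _ <= X) in b1; set m2 := (X in _ <= X) in b2.
have key u v : sp (D u v) = sp (D i j) ->
    #|[predI [pred z | csym z && (sp z == ~~ sp (D i j))] & [pred z | ~~ inter A u v z]]|
    <= #|[pred z | [&& csym z, sp z != sp (D u v) & ~~ inter A u v z]]|.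
  move=> e; apply: card_sub_le => z /=; rewrite ?inE /= => /andP[/andP[-> /eqP ->] ->].
  by rewrite e; case: (sp _).
have [||z /= _ /and3P[z1 z2 _]] := @exists_avoids _
    [pred z | csym z && (sp z == ~~ sp (D i j))]
    [:: (fun z => ~~ inter A i j z, m1); (fun z => ~~ inter A i' j' z, m2)].
- by split; [apply: leq_trans (key i j erefl) b1|split=> //; apply: leq_trans (key i' j' (esym ess)) b2].
- by rewrite /= (dih_cnt dih) /m1 /m2; lia.
by exists z; move: z1 z2; rewrite !negbK => -> ->.
Qed.

Definition q_load (q u v : I) := aRL A q + aSL A (L A q u) + aSL A (L A q v).

(** With this parity of q, the symbols at (be, u) and (q, v) always have equal parities, so that a
    common second symbol can be found. The same holds for (al, v) and (q, u) if [al] and [be] have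
    equal parities; otherwise the symbol at (q, u) itself has the parity required of a second symbol
    at (al, v), and the last clause asks for that intercalate. *)
Definition condQ (al u v be q : I) : bool :=
  [&& core q, par q == par be (+) par u (+) par v, ~~ aFR A q, ~~ aTR A q,
      good A q u, good A q v, thr 24 (q_load q u v)
    & (par al == par be) || inter A al v (L A q u)].

(** The cells newly blocked by an intercalate lie in its base row, which is reserved, or in its
    other row, which is marked in [aTR]. In the remaining rows only previous trades can have blocked
    a cell. *)
Lemma good_line_col u : core u ->
  #|[predI [pred q | [&& core q, ~~ aFR A q & ~~ aTR A q]] & [pred q | ~~ good A q u]]|
   <= p + aCL A0 u + 1.
Proof.
move=> cu.
apply: (@leq_trans #|[pred q | ~~ unp A q u || (core q && aB A0 q u)]|); last first.
  apply: leq_trans (card_predU_le _ _) _; rewrite -addnA; apply: leq_add.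
    exact: prot_col.
  by apply: leq_trans (inv_cl V cu); apply: card_sub_le => q /andP[]; rewrite inE => -> ->.
apply: card_sub_le => q /=; rewrite ?inE /= => /andP[/and3P[cq nF nT]].
rewrite negb_and negbK => /orP[Bq|->] //; rewrite cq; apply/orP; right.
move/(mid_blk m): Bq => /or3P[//|/andP[fq _]|]; first by rewrite fq in nF.
case/hasP=> -[[[i0 j0] iz] jz] qp; have [f1 f2 f3 f4 f5] := mid_pr m qp.
by rewrite /newcell !xpair_eqE => /or3P[] /andP[/eqP eq _]; move: nF nT; rewrite eq ?f1 ?f5.
Qed.

Lemma exists_q al u v be mL :
  core al -> core be -> core u -> core v ->
  L A al v = D al v -> aFR A al -> aFC A v ->
  (forall iz jz, (al, v, iz, jz) \notin pr) ->
  #|[pred q | ~~ thr 24 (q_load q u v)]| <= mL ->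
  5 * p + 5 + (aCL A0 u + 2 * aCL A0 v + aRL A0 al + aSL A0 (D al v))
   + 2 * #|[pred x | aFR A x]| + #|[pred x | aFC A x]| + 2 * size pr + mL < k ->
  exists q, condQ al u v be q.
Proof.
move=> cal cbe cu cv Lav fal fv npr hL hk.
have b1 := inter_bad dih P_row P_col P_sym V m cal cv Lav fal fv npr.
have gc := good_line_col.
pose Z (q : I) := core q && (par q == par be (+) par u (+) par v).
have inj w : injective (L A ^~ w) by move=> x y; apply: lat_col; exact: mid_lat m.
have [||q /= /andP[cq pq]] := @exists_avoids _ Z
  [:: (aFR A, #|[pred x | aFR A x]|); (aTR A, size pr);
      (fun q => [&& core q, ~~ aFR A q & ~~ aTR A q] && ~~ good A q u, p + aCL A0 u + 1);
      (fun q => [&& core q, ~~ aFR A q & ~~ aTR A q] && ~~ good A q v, p + aCL A0 v + 1);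
      (fun q => ~~ thr 24 (q_load q u v), mL);
      (fun q => [&& good A q u, par al != par be & ~~ inter A al v (L A q u)],
        3 * p + 3 + (aRL A0 al + aCL A0 v + aSL A0 (D al v))
     + #|[pred x | aFR A x]| + #|[pred x | aFC A x]| + size pr)].
- split; first by apply: card_sub_le => q /=; rewrite ?inE /= => /andP[].
  split; first by apply: leq_trans (mid_TR m); apply: card_sub_le => q /=; rewrite ?inE /= => /andP[].
  split; first by apply: leq_trans (gc u cu); apply: card_sub_le => q /=; rewrite ?inE /= => /andP[_].
  split; first by apply: leq_trans (gc v cv); apply: card_sub_le => q /=; rewrite ?inE /= => /andP[_].
  split; first by apply: leq_trans hL; apply: card_sub_le => q /=; rewrite ?inE /= => /andP[].
  (* Sending q to its symbol in column u turns bad rows into bad second symbols for (al, v),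
     injectively. Together with p for each of the two cells of row q this gives 5 p. *)
  split=> //; apply: leq_trans b1; apply: (card_inj_le (f := L A ^~ u)) => [q|q q' _ _]; last exact: inj.
  rewrite /= ?inE /= => /andP[/andP[cq /eqP pq] /and3P[gq ne ni]].
  have [_ _ e] := good_nat gq; rewrite ni e (dih_sym dih) //= andbT.
  rewrite !(dih_par dih) // pq; move: ne.
  by case: (par al) (par be) (par u) (par v) => [] [] [] [].
- by rewrite /= /Z (card_core_par dih); lia.
case/and5P=> n1 n2 n3 n4 /and3P[n5 n6 _]; exists q.
move: n3 n4 n5 n6; rewrite /condQ cq pq n1 n2 /= !negbK => g1 g2 -> /=; rewrite g1 g2 /=.
by case: eqP => //= _; rewrite negbK.
Qed.

Lemma row_inj i : injective (L A i).
Proof. by move=> x y; apply: lat_row; exact: mid_lat m. Qed.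

Lemma col_inj j : injective (L A ^~ j).
Proof. by move=> x y; apply: lat_col; exact: mid_lat m. Qed.

Lemma C_inj i : injective (C A i).
Proof. by have [l1 _ _ _] := mid_lat m; apply: can_inj (l1 i). Qed.

Lemma R_inj j : injective (Rw A j).
Proof.
have [_ _ l3 _] := mid_lat m.
by apply: (can_inj (g := L A ^~ j)) => s; apply: l3.
Qed.

Lemma C_injs s : injective (C A ^~ s).
Proof.
have [l1 _ _ _] := mid_lat m; move=> i i' /= e.
by apply: (@col_inj (C A i s)); rewrite /= l1 e l1.
Qed.

Lemma R_injs s : injective (Rw A ^~ s).
Proof.
have [_ _ l3 _] := mid_lat m; move=> j j' /= e.
by apply: (@row_inj (Rw A j s)); rewrite l3 [in RHS]e l3.
Qed.

Lemma card_eq1 (f : I -> I) y : injective f -> #|[pred x | f x == y]| <= 1.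
Proof.
move=> inj; rewrite -(card1 y); apply: (card_inj_le (f := f)) => //.
by move=> z z' _ _; exact: inj.
Qed.

Lemma card_inj_pred (f : I -> I) (q : pred I) c : injective f -> #|q| <= c ->
  #|[pred x | q (f x)]| <= c.
Proof.
move=> inj; apply: leq_trans; apply: (card_inj_le (f := f)) => //.
by move=> z z' _ _; exact: inj.
Qed.

Lemma card_noncore (f : I -> I) : injective f -> #|[pred x | ~~ core (f x)]| <= 1.
Proof.
move=> inj; apply: (card_inj_pred (q := [pred x | ~~ core x])) => //.
have := cardC [pred x : I | core x]; rewrite (card_core dih) card_ord.
have -> : #|[predC [pred x : I | core x]]| = #|[pred x : I | ~~ core x]|.
  by apply: eq_card => x; rewrite !inE.
by have := dih_n2 dih; lia.
Qed.

Definition e_load (h r3 al c2 g al' : I) :=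
  aRL A h + aRL A r3 + aRL A al + aCL A c2 + aCL A g + 2 * aCL A al'.

Definition condE (a b r c c1 r1 e : I) : bool :=
  let c2 := C A r e in let h := Rw A c1 e in let g := C A h b in
  let f := L A r1 g in let r3 := Rw A c f in
  let al := Rw A c2 a in let al' := C A r3 a in
  [&& e != a, e != b, h != r1, f != a, al != r1, al' != c1,
      unp A r c2, unp A h c1, unp A h g, unp A r1 g, unp A r3 c, unp A al c2,
      unp A r3 al', core h, core r3, core al, core c2, core g, core al'
    & thr 14 (e_load h r3 al c2 g al')].

Definition thrE (a b r c c1 r1 e : I) : bool :=
  let c2 := C A r e in let h := Rw A c1 e in let g := C A h b in
  let f := L A r1 g in let r3 := Rw A c f in
  let al := Rw A c2 a in let al' := C A r3 a in
  thr 14 (e_load h r3 al c2 g al').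

(** Every line and symbol derived from e is an injective function of e, being a composition of
    lookups with one argument fixed; so each condition excludes no more values than it has
    exceptions on its line or symbol. There are seven protected cells, and 12 counts six forbidden
    coincidences and six lines that must lie in the core. *)
Lemma exists_e (a b r c c1 r1 : I) mL :
  #|[pred e | ~~ thrE a b r c c1 r1 e]| <= mL -> 7 * p + 12 + mL < n ->
  exists e, condE a b r c c1 r1 e.
Proof.
move=> hL hn.
have [l1 l2 l3 l4] := mid_lat m.
pose h e := Rw A c1 e; pose g e := C A (h e) b; pose f e := L A r1 (g e).
pose r3 e := Rw A c (f e); pose c2 e := C A r e.
pose al e := Rw A (c2 e) a; pose al' e := C A (r3 e) a.
have ih : injective h by exact: R_inj.
have ig : injective g by exact: (inj_comp (@C_injs b) ih).
have if_ : injective f by exact: (inj_comp (@row_inj r1) ig).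
have ir3 : injective r3 by exact: (inj_comp (@R_inj c) if_).
have ic2 : injective c2 by exact: C_inj.
have ial : injective al by exact: (inj_comp (@R_injs a) ic2).
have ial' : injective al' by exact: (inj_comp (@C_injs a) ir3).
have ps s (u v : I -> I) : injective u -> (forall e, L A (u e) (v e) = s) ->
    #|[pred e | ~~ unp A (u e) (v e)]| <= p.
  move=> iu hs; apply: leq_trans (prot_sym P_sym A s).
  apply: (@card_inj_le I (I * I)%type _ _ (fun e => (u e, v e))) => [e /= ->|e e' _ _ [/iu]] //.
  by rewrite hs eqxx.
have [||e /= _] := @exists_avoids _ (@predT I)
  [:: (fun e => e == a, 1); (fun e => e == b, 1); (fun e => h e == r1, 1);
      (fun e => f e == a, 1); (fun e => al e == r1, 1); (fun e => al' e == c1, 1);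
      (fun e => ~~ unp A r (c2 e), p); (fun e => ~~ unp A (h e) c1, p);
      (fun e => ~~ unp A (h e) (g e), p); (fun e => ~~ unp A r1 (g e), p);
      (fun e => ~~ unp A (r3 e) c, p); (fun e => ~~ unp A (al e) (c2 e), p);
      (fun e => ~~ unp A (r3 e) (al' e), p);
      (fun e => ~~ core (h e), 1); (fun e => ~~ core (r3 e), 1);
      (fun e => ~~ core (al e), 1); (fun e => ~~ core (c2 e), 1);
      (fun e => ~~ core (g e), 1); (fun e => ~~ core (al' e), 1);
      (fun e => ~~ thrE a b r c c1 r1 e, mL)].
- have w (q : pred I) x : #|q| <= x -> #|[predI (@predT I) & q]| <= x.
    by apply: leq_trans; apply: card_sub_le.
  do ![split=> //; first by apply: w; first
    [exact: (@card_eq1 id)|exact: card_eq1|exact: card_noncore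
    |exact: (card_inj_pred (q := fun x => ~~ unp A r x)) ic2 (prot_row P_row A r)
    |exact: (card_inj_pred (q := fun x => ~~ unp A x c1)) ih (prot_col P_col A c1)
    |exact: (card_inj_pred (q := fun x => ~~ unp A r1 x)) ig (prot_row P_row A r1)
    |exact: (card_inj_pred (q := fun x => ~~ unp A x c)) ir3 (prot_col P_col A c)
    |by apply: (ps b); [exact: ih|move=> e; rewrite l1]
    |by apply: (ps a); [exact: ial|move=> e; rewrite l3]
    |by apply: (ps a); [exact: ir3|move=> e; rewrite l1]|exact: hL]].
- by rewrite /= cardT size_enum_ord; lia.
move=> H; exists e; rewrite /condE /= -!/(thrE _ _ _ _ _ _ _).
by move: H; rewrite !negbK andbT.
Qed.

Definition d_load (e f kap h g al c2 al' r3 d : I) :=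
  let rho := Rw A d kap in let be := Rw A d e in let be' := C A rho f in
  2 * aCL A d + 2 * aRL A rho + aRL A be + aCL A be' +
  (aSL A (L A h d) + aSL A (L A rho g) + aSL A (L A al d) + aSL A (L A be c2)
   + aSL A (L A rho al') + aSL A (L A r3 be')).

Definition condD (act1 act2 : bool) (e f kap h g al c2 al' r3 d : I) : bool :=
  let rho := Rw A d kap in let be := Rw A d e in let be' := C A rho f in
  [&& ~~ aFC A d, ~~ aFR A rho, unp A rho d, good A h d, good A rho g,
      ~~ act1 || [&& ~~ aFR A be, unp A be d, good A al d & good A be c2],
      ~~ act2 || [&& ~~ aFC A be', unp A rho be', good A rho al' & good A r3 be']
    & thr 24 (d_load e f kap h g al c2 al' r3 d)].

(** Of the 2, one is the allowance of [inv_rl] and one the column outside the core when n is odd. *)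
Lemma good_row i : pr = [::] -> core i ->
  #|[pred j | ~~ aFC A j && ~~ good A i j]| <= p + aRL A0 i + 2.
Proof.
move=> pr0 ci; have -> : p + aRL A0 i + 2 = p + (aRL A0 i + 1 + 1) by lia.
apply: (@leq_trans #|[pred j | ~~ unp A i j || ((core j && aB A0 i j) || ~~ core j)]|).
  apply: card_sub_le => j /= /andP[nF]; rewrite negb_and negbK => /orP[Bj|->] //.
  case: (boolP (core j)) => cj; rewrite ?orbT //=; apply/orP; right; rewrite orbF.
  by move/(mid_blk m): Bj; rewrite pr0 (negbTE nF) andbF !orbF.
apply: leq_trans (card_predU_le _ _) _; apply: leq_add; first exact: prot_row.
apply: leq_trans (card_predU_le _ _) _; apply: leq_add.
  by apply: leq_trans (inv_rl V ci); apply: card_sub_le => j.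
exact: (@card_noncore id).
Qed.

Lemma good_col j : pr = [::] -> core j ->
  #|[pred i | ~~ aFR A i && ~~ good A i j]| <= p + aCL A0 j + 2.
Proof.
move=> pr0 cj; have -> : p + aCL A0 j + 2 = p + (aCL A0 j + 1 + 1) by lia.
apply: (@leq_trans #|[pred i | ~~ unp A i j || ((core i && aB A0 i j) || ~~ core i)]|).
  apply: card_sub_le => i /= /andP[nF]; rewrite negb_and negbK => /orP[Bi|->] //.
  case: (boolP (core i)) => ci; rewrite ?orbT //=; apply/orP; right; rewrite orbF.
  by move/(mid_blk m): Bi; rewrite pr0 (negbTE nF) !orbF.
apply: leq_trans (card_predU_le _ _) _; apply: leq_add; first exact: prot_col.
apply: leq_trans (card_predU_le _ _) _; apply: leq_add.
  by apply: leq_trans (inv_cl V cj); apply: card_sub_le => i.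
exact: (@card_noncore id).
Qed.

(** As for e, all lines are injective functions of d. Nine cells must be unprotected, and six of
    them must also be pristine on a given line, which costs 2 each. *)
Lemma exists_d act1 act2 (e f kap h g al c2 al' r3 : I) mL : pr = [::] ->
  core h -> core g -> core al -> core c2 -> core al' -> core r3 ->
  #|[pred d | ~~ thr 24 (d_load e f kap h g al c2 al' r3 d)]| <= mL ->
  9 * p + 12 + (aRL A0 h + aCL A0 g + aRL A0 al + aCL A0 c2 + aCL A0 al' + aRL A0 r3)
   + 2 * #|[pred x | aFR A x]| + 2 * #|[pred x | aFC A x]| + mL < n ->
  exists d, condD act1 act2 e f kap h g al c2 al' r3 d.
Proof.
move=> pr0 ch cg cal cc2 cal' cr3 hL hn.
have [l1 l2 l3 l4] := mid_lat m.
pose rho d := Rw A d kap; pose be d := Rw A d e; pose be' d := C A (rho d) f.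
have irho : injective rho by exact: R_injs.
have ibe : injective be by exact: R_injs.
have ibe' : injective be' by exact: (inj_comp (@C_injs f) irho).
have ps s (u v : I -> I) : injective u -> (forall e, L A (u e) (v e) = s) ->
    #|[pred e | ~~ unp A (u e) (v e)]| <= p.
  move=> iu hs; apply: leq_trans (prot_sym P_sym A s).
  apply: (@card_inj_le I (I * I)%type _ _ (fun e => (u e, v e))) => [z /= ->|z z' _ _ [/iu]] //.
  by rewrite hs eqxx.
have idI : injective (@id I) by [].
have [||d /= _] := @exists_avoids _ (@predT I)
  [:: (fun d => aFC A d, #|[pred x | aFC A x]|);
      (fun d => aFR A (rho d), #|[pred x | aFR A x]|);
      (fun d => ~~ unp A (rho d) d, p);
      (fun d => ~~ aFC A d && ~~ good A h d, p + aRL A0 h + 2);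
      (fun d => ~~ aFR A (rho d) && ~~ good A (rho d) g, p + aCL A0 g + 2);
      (fun d => aFR A (be d), #|[pred x | aFR A x]|);
      (fun d => ~~ unp A (be d) d, p);
      (fun d => ~~ aFC A d && ~~ good A al d, p + aRL A0 al + 2);
      (fun d => ~~ aFR A (be d) && ~~ good A (be d) c2, p + aCL A0 c2 + 2);
      (fun d => aFC A (be' d), #|[pred x | aFC A x]|);
      (fun d => ~~ unp A (rho d) (be' d), p);
      (fun d => ~~ aFR A (rho d) && ~~ good A (rho d) al', p + aCL A0 al' + 2);
      (fun d => ~~ aFC A (be' d) && ~~ good A r3 (be' d), p + aRL A0 r3 + 2);
      (fun d => ~~ thr 24 (d_load e f kap h g al c2 al' r3 d), mL)].
- have w (q : pred I) x : #|q| <= x -> #|[predI (@predT I) & q]| <= x.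
    by apply: leq_trans; apply: card_sub_le.
  have cF : #|[pred x | aFC A x]| <= #|[pred x | aFC A x]| by [].
  have rF : #|[pred x | aFR A x]| <= #|[pred x | aFR A x]| by [].
  split; first by apply: w; exact: (card_inj_pred (q := aFC A)) idI cF.
  split; first by apply: w; exact: (card_inj_pred (q := aFR A)) irho rF.
  split; first by apply: w; apply: (ps kap); [exact: irho|move=> z; rewrite l3].
  split; first by apply: w; exact: (good_row pr0 ch).
  split; first by apply: w; exact: (card_inj_pred (q := fun x => ~~ aFR A x && ~~ good A x g)) irho (good_col pr0 cg).
  split; first by apply: w; exact: (card_inj_pred (q := aFR A)) ibe rF.
  split; first by apply: w; apply: (ps e); [exact: ibe|move=> z; rewrite l3].
  split; first by apply: w; exact: (good_row pr0 cal).
  split; first by apply: w; exact: (card_inj_pred (q := fun x => ~~ aFR A x && ~~ good A x c2)) ibe (good_col pr0 cc2).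
  split; first by apply: w; exact: (card_inj_pred (q := aFC A)) ibe' cF.
  split; first by apply: w; apply: (ps f); [exact: irho|move=> z; rewrite l1].
  split; first by apply: w; exact: (card_inj_pred (q := fun x => ~~ aFR A x && ~~ good A x al')) irho (good_col pr0 cal').
  split; first by apply: w; exact: (card_inj_pred (q := fun x => ~~ aFC A x && ~~ good A r3 x)) ibe' (good_row pr0 cr3).
  by split=> //; apply: w.
- by rewrite /= cardT size_enum_ord; lia.
case/and5P=> n1 n2 n3 n4 /and5P[n5 n6 n7 n8 /and5P[n9 n10 n11 n12 /and3P[n13 n14 _]]].
exists d; move: n3 n4 n5 n7 n8 n9 n11 n12 n13 n14.
by rewrite n1 n2 n6 n10 /condD n1 n2 n6 n10 /= !negbK => -> -> -> -> -> -> -> -> -> ->; rewrite !orbT.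
Qed.

End Existence.

(** * Elementary changes: reserving a cell, switching an intercalate *)

Section Steps.

Variables (n k : nat).
Notation I := 'I_n.
Variables (D : I -> I -> I).
Variables (P : I -> I -> option I).

Implicit Type A : ast n.
Local Notation L A := (sqL (aS A)).
Local Notation C A := (sqC (aS A)).
Local Notation Rw A := (sqR (aS A)).
Local Notation unp := (unprot P).
Local Notation good := (pristine P).
Local Notation inter := (switchable P).
Local Notation inv := (inv k D).
Local Notation mid := (mid P).

Definition upd1 (f : I -> bool) x : I -> bool := fun i => (i == x) || f i.

Definition reserve A (i j : I) : ast n :=
  Ast (aS A) (upd2 (aB A) i j true) (upd1 (aFR A) i) (upd1 (aFC A) j) (aTR A)
      (aRL A) (aCL A) (aSL A) (rcons (aLog A) (i, j)).

Definition wrs A (W : seq (I * I * I)) : ast n :=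
  Ast (foldl (@wr n) (aS A) W) (aB A) (aFR A) (aFC A) (aTR A)
      (aRL A) (aCL A) (aSL A) (aLog A).

Definition touch A (i j : I) : ast n :=
  Ast (aS A) (upd2 (aB A) i j true) (aFR A) (aFC A) (upd1 (aTR A) i)
      (aRL A) (aCL A) (aSL A) (rcons (aLog A) (i, j)).

Definition touch' A (i j : I) : ast n :=
  Ast (aS A) (upd2 (aB A) i j true) (aFR A) (aFC A) (aTR A)
      (aRL A) (aCL A) (aSL A) (rcons (aLog A) (i, j)).

Definition switch A (i j z : I) : ast n :=
  let iz := Rw A j z in let jz := C A i z in let x := L A i j in
  touch (touch (touch' (wrs A [:: (i, j, z); (i, jz, x); (iz, j, x); (iz, jz, z)])
    i jz) iz j) iz jz.

Lemma start_mid A M : inv A M -> mid A A [::].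
Proof.
move=> V; split=> //; try by rewrite (inv_log V).
- exact: inv_lat V.
- by move=> i j ->.
- by rewrite (inv_TR V) eq_card0.
- by move=> i j; left.
- by rewrite (inv_FR V) (inv_TR V).
- by rewrite (inv_FC V).
Qed.

(** By [mid_pr], the opposite row and column of a switched intercalate must stay unreserved. Those
    rows are recorded in [aTR]; the columns are not, so a new column may be reserved only before the
    first switch. *)
Lemma mid_reserve A0 A pr i j : mid A0 A pr ->
  aFR A i || ~~ aTR A i -> aFC A j || (pr == [::]) -> mid A0 (reserve A i j) pr.
Proof.
move=> m hi hj; split; rewrite ?(mid_rl m) ?(mid_cl m) ?(mid_sl m) //=.
- exact: mid_lat m.
- by move=> x y; rewrite /= /upd2; case: andP => //= _ /(mid_free m).
- move=> x y; rewrite /upd2 /upd1; case: andP => [[-> ->]|_]; first by rewrite orbT.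
  by move/(mid_blk m) => /or3P[->|/andP[-> ->]|->]; rewrite ?orbT.
- move=> i0 j0 iz jz qp; have [f1 f2 f3 f4 f5] := mid_pr m qp; rewrite /upd1 f1 f2 f5 !orbT.
  split=> //; rewrite negb_or ?f3 ?f4 andbT.
    by apply: contraTneq hi => <-; rewrite (negbTE f3) f5.
  apply: contraTneq hj => <-; rewrite (negbTE f4) /=.
  by apply/eqP => e; rewrite e in qp.
- exact: mid_prot m.
- exact: mid_TR m.
- move=> x y; rewrite /upd2 mem_rcons inE xpair_eqE; case: andP => _; first by right.
  by move/(mid_logB m) => [->|->]; [left|right; rewrite orbT].
- move=> c; rewrite mem_rcons inE /upd2 => /orP[/eqP -> /=|/(mid_logBc m) ->].
    by rewrite !eqxx.
  by case: ifP.
- by move=> x y /(mid_B0 m) h; rewrite /upd2 h; case: ifP.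
- move=> x; rewrite map_rcons mem_rcons !inE /upd1 /= => /orP[/orP[->//|h]|h]; apply/orP; right;
    by apply: (mid_logR m); rewrite h ?orbT.
- move=> x; rewrite map_rcons mem_rcons !inE /upd1 /= => /orP[->//|h]; apply/orP; right.
  exact: (mid_logC m).
Qed.

Section Switch.

Variables (A0 A : ast n) (pr : seq (I * I * I * I)) (i j z : I).
Hypotheses (m : mid A0 A pr) (h : inter A i j z) (fi : aFR A i) (fj : aFC A j).
Hypothesis bij : aB A i j.
Let iz := Rw A j z.
Let jz := C A i z.
Let A' := switch A i j z.

Let hyp : [/\ ~~ aFR A iz, ~~ aFC A jz, good A i jz, good A iz j & good A iz jz /\
    L A iz jz = L A i j].
Proof. by case/and5P: h => a b c d /andP[e /eqP f]; split. Qed.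

Let niz : iz != i.
Proof. by have [a _ _ _ _] := hyp; apply: contraNneq a => ->. Qed.
Let njz : jz != j.
Proof. by have [_ a _ _ _] := hyp; apply: contraNneq a => ->. Qed.

Let W := [:: (i, j, z); (i, jz, L A i j); (iz, j, L A i j); (iz, jz, z)].

Let uW : uniq (map (@wcell n) W).
Proof.
rewrite /= !inE !xpair_eqE !eqxx /= !andbT ![i == iz]eq_sym ![j == jz]eq_sym.
by rewrite (negbTE niz) (negbTE njz).
Qed.

Let Liz : L A iz j = z.
Proof. by have [_ _ l _] := mid_lat m; apply: l. Qed.
Let Ljz : L A i jz = z.
Proof. by have [l _ _ _] := mid_lat m; apply: l. Qed.

Lemma switch_out x y : (x, y) \notin map (@wcell n) W -> L A' x y = L A x y.
Proof. exact: (@wr_out _ (aS A) W). Qed.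

Lemma switch_base : L A' i j = z.
Proof. exact: (wr_in (aS A) uW (mem_head _ _)). Qed.

Lemma switch_frame x y : aB A x y -> (x, y) != (i, j) -> L A' x y = L A x y.
Proof.
move=> b ne; apply: switch_out; rewrite /= !inE (negbTE ne) /=.
have [_ _ /andP[g1 _] /andP[g2 _] [/andP[g3 _] _]] := hyp.
by apply/negP => /or3P[] /eqP[e1 e2]; move: b g1 g2 g3; rewrite e1 e2 => ->.
Qed.

Lemma latin_switch : latin (aS A').
Proof.
have [_ _ _ _ [_ e]] := hyp.
apply: (@latin_wr _ (aS A) W) => //; first exact: mid_lat m.
- move=> w; rewrite !inE => /or4P[] /eqP-> /=; rewrite ?Liz ?Ljz ?e !xpair_eqE;
    by rewrite !eqxx ?orbT.
- move=> w; rewrite !inE => /or4P[] /eqP-> /=; rewrite ?Liz ?Ljz ?e !xpair_eqE;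
    by rewrite !eqxx ?orbT.
Qed.

Lemma switch_B x y : aB A' x y =
  [|| aB A x y, (x, y) == (i, jz), (x, y) == (iz, j) | (x, y) == (iz, jz)].
Proof.
rewrite /= /upd2 -/iz -/jz -!xpair_eqE.
by do 3! case: eqP => _; rewrite ?orbT ?orbF.
Qed.

Lemma mid_switch : P i j != Some (L A0 i j) -> mid A0 A' ((i, j, iz, jz) :: pr).
Proof.
move=> nP; have [nF nC g1 g2 [g3 e]] := hyp.
have notW x y : ~~ aB A' x y -> (x, y) \notin map (@wcell n) W.
  rewrite switch_B !negb_or => /and4P[n0 n1 n2 n3].
  rewrite /= /wcell /= ?inE (negbTE n1) (negbTE n2) (negbTE n3) ?orbF ?andbT.
  by apply: contraNN n0 => /eqP[-> ->].
have startL x y : good A x y -> P x y != Some (L A0 x y).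
  by case/andP => /(mid_free m)[_ <-].
split; rewrite ?(mid_rl m) ?(mid_cl m) ?(mid_sl m) //.
- exact: latin_switch.
- move=> x y nB; rewrite switch_out ?notW //; move: nB; rewrite switch_B negb_or => /andP[nB _].
  exact: (mid_free m nB).
- move=> x y; rewrite switch_B => /orP[/(mid_blk m)/or3P[->//|->|hh]|hh]; rewrite ?orbT //.
    by apply/or3P/Or33; apply/orP; right.
  by apply/or3P/Or33; apply/orP; left.
- move=> i0 j0 i1 j1; rewrite inE => /orP[/eqP[-> -> -> ->]|qp].
    by split=> //=; rewrite /upd1 eqxx.
  have [f1 f2 f3 f4 f5] := mid_pr m qp; split=> //=.
  by rewrite /upd1 f5 !orbT.
- move=> x y hP; rewrite switch_out; first exact: (mid_prot m hP).
  rewrite /= !inE /wcell /=; apply/negP => /or4P[] /eqP[ex ey]; rewrite ex ey in hP.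
  + by rewrite hP eqxx in nP.
  + by have := startL _ _ g1; rewrite hP eqxx.
  + by have := startL _ _ g2; rewrite hP eqxx.
  + by have := startL _ _ g3; rewrite hP eqxx.
- apply: (@leq_trans (#|[pred x : I | x == iz]| + #|[pred x | aTR A x]|)).
    apply: leq_trans (card_predU_le _ _); apply: card_sub_le => x /=.
    by rewrite /upd1 -/iz ?inE; case: eqP.
  by apply: (@leq_add _ _ 1); [rewrite card1|exact: mid_TR m].
- move=> x y; rewrite switch_B /= !(mem_rcons, inE) -/iz -/jz => /orP[/(mid_logB m)[->|->]|/or3P[]->];
    by [left|right; rewrite ?orbT].
- move=> c; rewrite switch_B -surjective_pairing /= !(mem_rcons, inE) -/iz -/jz.
  by move=> /or4P[->|->|->|/(mid_logBc m) ->]; rewrite ?orbT.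
- by move=> x y /(mid_B0 m) hb; rewrite switch_B hb.
- move=> x; rewrite /= /upd1 !map_rcons !(mem_rcons, inE) /= -/iz => /orP[f|/or3P[->//|->//|f]];
    by rewrite (mid_logR m) ?orbT ?f ?orbT.
- by move=> x /= f; rewrite !map_rcons !(mem_rcons, inE) (mid_logC m f) !orbT.
Qed.

(* A second intercalate with the same new symbol survives the switch of the
   first one, since its lines are different. *)
Lemma inter_switch i' j' : inter A i' j' z -> aFR A i' -> aFC A j' -> i != i' -> j != j' ->
  inter A' i' j' z.
Proof.
move=> h' fi' fj' nii njj; have [nF nC g1 g2 [g3 e]] := hyp.
case/and5P: h' => nF' nC' g1' g2' /andP[g3' /eqP e'].
set iz' := Rw A j' z in nF' g2' g3' e' *; set jz' := C A i' z in nC' g1' g3' e' *.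
have F u v : aFR A u -> ~~ aFR A v -> (u == v) = false.
  by move=> fu nv; apply: contraNF nv => /eqP <-.
have G u v : aFC A u -> ~~ aFC A v -> (u == v) = false.
  by move=> fu nv; apply: contraNF nv => /eqP <-.
have [l1 l2 l3 l4] := mid_lat m.
have nzz : (iz' == iz) = false.
  apply: contraNF njj => /eqP ez; apply/eqP; apply: (lat_row (i := iz) (mid_lat m)).
  by rewrite Liz -ez l3.
have oth x y : x \in [:: i'; iz'] -> y \in [:: j'; jz'] ->
    L A' x y = L A x y /\ aB A' x y = aB A x y.
  move=> hx hy; rewrite switch_B; suff hh : (x, y) \notin map (@wcell n) W.
    split; first exact: switch_out.
    by move: hh; rewrite /= !inE /wcell /= !negb_or => /and4P[_ /negbTE-> /negbTE-> /negbTE->]; rewrite !orbF.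
  move: hx hy; rewrite /= !inE /wcell /= !xpair_eqE.
  have a1 : (i' == i) = false by rewrite eq_sym (negbTE nii).
  have a2 : (j' == j) = false by rewrite eq_sym (negbTE njj).
  have a3 : (i' == iz) = false by rewrite F.
  have a4 : (j' == jz) = false by rewrite G.
  have a5 : (iz' == i) = false by rewrite eq_sym F.
  have a6 : (jz' == j) = false by rewrite eq_sym G.
  by case/orP=> /eqP-> /orP[] /eqP->; rewrite ?a1 ?a2 ?a3 ?a4 ?a5 ?a6 ?nzz ?andbF.
have [o1 b1] : L A' i' jz' = L A i' jz' /\ aB A' i' jz' = aB A i' jz'.
  by apply: oth; rewrite !inE eqxx ?orbT.
have [o2 b2] : L A' iz' j' = L A iz' j' /\ aB A' iz' j' = aB A iz' j'.
  by apply: oth; rewrite !inE eqxx ?orbT.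
have [o3 b3] : L A' iz' jz' = L A iz' jz' /\ aB A' iz' jz' = aB A iz' jz'.
  by apply: oth; rewrite !inE eqxx ?orbT.
have [o4 b4] : L A' i' j' = L A i' j' /\ aB A' i' j' = aB A i' j'.
  by apply: oth; rewrite !inE eqxx ?orbT.
have [k1 k2 k3 k4] := latin_switch.
have eC : C A' i' z = jz' by rewrite -[in LHS](l1 i' z) -/jz' -o1 k2.
have eR : Rw A' j' z = iz' by rewrite -[in LHS](l3 j' z) -/iz' -o2 k4.
have fR x : aFR A' x = aFR A x by [].
have fC x : aFC A' x = aFC A x by [].
rewrite /switchable eC eR; cbv zeta; rewrite fR fC nF' nC' /pristine /unprot b1 b2 b3 o1 o2 o3 o4 e' eqxx.
by move: g1' g2' g3'; rewrite /pristine /unprot ?e' => -> -> ->.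
Qed.

End Switch.

End Steps.

(** * The machine representation of a square *)

Inductive iexp :=
  | IV of nat
  | IL of iexp & iexp
  | IC of iexp & iexp
  | IR of iexp & iexp.

Inductive nexp :=
  | NRL of iexp
  | NCL of iexp
  | NSL of iexp
  | NAdd of nexp & nexp.

Inductive bexp :=
  | BEq of iexp & iexp
  | BAnd of bexp & bexp
  | BOr of bexp & bexp
  | BNot of bexp
  | BUnp of iexp & iexp
  | BBlk of iexp & iexp
  | BFR of iexp
  | BFC of iexp
  | BTR of iexp
  | BCore of iexp
  | BPar of iexp
  | BIff of bexp & bexp
  | BThr of nat & nexp.

Definition eIx e1 e2 := Bin Add (Bin Mul e1 (Var 0)) e2.

Fixpoint ci (e : iexp) : expr :=
  match e with
  | IV x => Var x
  | IL a b => Get 3 (eIx (ci a) (ci b))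
  | IC a b => Get 4 (eIx (ci a) (ci b))
  | IR a b => Get 5 (eIx (ci a) (ci b))
  end.

Fixpoint cn (e : nexp) : expr :=
  match e with
  | NRL a => Get 8 (ci a)
  | NCL a => Get 9 (ci a)
  | NSL a => Get 10 (ci a)
  | NAdd a b => Bin Add (cn a) (cn b)
  end.

Definition eNz e := eNot (eNot e).

Fixpoint cb (e : bexp) : expr :=
  match e with
  | BEq a b => Bin Eq (ci a) (ci b)
  | BAnd a b => Bin Mul (cb a) (cb b)
  | BOr a b => eNz (Bin Add (cb a) (cb b))
  | BNot a => eNot (cb a)
  | BUnp a b => eNot (Bin Eq (Get 6 (eIx (ci a) (ci b))) (Bin Add (ci (IL a b)) (Num 1)))
  | BBlk a b => Get 7 (eIx (ci a) (ci b))
  | BFR a => Get 11 (ci a)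
  | BFC a => Get 12 (ci a)
  | BTR a => Get 13 (ci a)
  | BCore a => eLt (ci a) (Bin Mul (Num 2) (Var 2))
  | BPar a => Bin Le (Var 2) (ci a)
  | BIff a b => Bin Eq (cb a) (cb b)
  | BThr w f => Bin LeEps (Bin Sub (Bin Mul (cn f) (Var 0)) (Bin Mul (Num w) (Var 3)))
                          (Bin Mul (Num 12) (Bin Mul (cn f) (Var 0)))
  end.

Definition LET x e := CAssign x (ci e).
Definition IF e p q := CIf (cb e) p q.
Definition FIND x e := search x (cb e).

Section Machine.

Variables (R : realType) (eps delta : R).
Variables (n k : nat) (i0 : 'I_n).
Notation I := 'I_n.
Variables (D : I -> I -> I) (P : I -> I -> option I).
Variables (st0 : state) (M idx : nat).

Implicit Type A : ast n.
Local Notation L A := (sqL (aS A)).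
Local Notation C A := (sqC (aS A)).
Local Notation Rw A := (sqR (aS A)).
Local Notation unp := (unprot P).
Local Notation good := (pristine P).
Local Notation inter := (switchable P).
Local Notation eval := (eval eps delta).

Definition ix (i j : I) : nat := i * n + j.

Lemma ix_eq i j i' j' : (ix i j == ix i' j') = ((i == i') && (j == j')).
Proof.
apply/eqP/andP => [|[/eqP-> /eqP->]//]; rewrite /ix => e.
have hj := ltn_ord j; have hj' := ltn_ord j'.
have ei : val i = val i'.
  have := congr1 (fun x => x %/ n) e; rewrite !divnMDl ?(leq_ltn_trans _ hj) //.
  by rewrite !divn_small // !addn0.
by split; apply/eqP; apply: val_inj => //; move: e; rewrite /= -/(val i) ei => /addnI.
Qed.

Fixpoint getd (s : seq (nat * I)) (x : nat) : I :=
  if s is (y, i) :: s' then if x == y then i else getd s' x else i0.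

(** Shifted by one so that the initial zero memory represents the blank square. *)
Definition psym (i j : I) : nat := if P i j is Some s then s.+1 else 0.

(** Variables from 20 on are local names, and [s] lists the values of those in use. Variables 6 to
    19 are left unconstrained: loop counters and the parameters of the initial square live there.
    Array 14 keeps the original table, to which symbol loads are charged. *)
Record rep (st : state) (A : ast n) (s : seq (nat * I)) : Prop := {
  rep0 : vars st 0 = n;
  rep1 : vars st 1 = vars st0 1;
  rep2 : vars st 2 = k;
  rep3 : vars st 3 = M;
  rep4 : vars st 4 = size (aLog A);
  rep5 : vars st 5 = idx;
  rep_in : forall a, a < 3 -> arrs st a = arrs st0 a;
  repL : forall i j, arrs st 3 (ix i j) = L A i j;
  repC : forall i j, arrs st 4 (ix i j) = C A i j;
  repR : forall i j, arrs st 5 (ix i j) = Rw A i j;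
  repP : forall i j, arrs st 6 (ix i j) = psym i j;
  repB : forall i j, arrs st 7 (ix i j) = aB A i j;
  repRL : forall i : I, arrs st 8 i = aRL A i;
  repCL : forall i : I, arrs st 9 i = aCL A i;
  repSL : forall i : I, arrs st 10 i = aSL A i;
  repFR : forall i : I, arrs st 11 i = aFR A i;
  repFC : forall i : I, arrs st 12 i = aFC A i;
  repTR : forall i : I, arrs st 13 i = aTR A i;
  repD : forall i j, arrs st 14 (ix i j) = D i j;
  rep_lr : forall l, l < size (aLog A) -> arrs st 15 l = (nth (i0, i0) (aLog A) l).1;
  rep_lc : forall l, l < size (aLog A) -> arrs st 16 l = (nth (i0, i0) (aLog A) l).2;
  rep_env : forall x, x \in map fst s -> 20 <= x /\ vars st x = getd s x
}.

Fixpoint di A s (e : iexp) : I :=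
  match e with
  | IV x => getd s x
  | IL a b => L A (di A s a) (di A s b)
  | IC a b => C A (di A s a) (di A s b)
  | IR a b => Rw A (di A s a) (di A s b)
  end.

Fixpoint ki (s : seq nat) (e : iexp) : bool :=
  match e with
  | IV x => x \in s
  | IL a b | IC a b | IR a b => ki s a && ki s b
  end.

Fixpoint dn A s (e : nexp) : nat :=
  match e with
  | NRL a => aRL A (di A s a)
  | NCL a => aCL A (di A s a)
  | NSL a => aSL A (di A s a)
  | NAdd a b => dn A s a + dn A s b
  end.

Fixpoint kn (s : seq nat) (e : nexp) : bool :=
  match e with
  | NRL a | NCL a | NSL a => ki s a
  | NAdd a b => kn s a && kn s b
  end.

(* Says that f * (1 - 12 eps) n <= w * M, rearranged so that the machine can test
   it. *)
Definition light (w f : nat) : bool :=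
  ((f * n - w * M)%:R <= eps * (12 * (f * n))%:R :> R)%R.

Fixpoint db A s (e : bexp) : bool :=
  match e with
  | BEq a b => di A s a == di A s b
  | BAnd a b => db A s a && db A s b
  | BOr a b => db A s a || db A s b
  | BNot a => ~~ db A s a
  | BUnp a b => unp A (di A s a) (di A s b)
  | BBlk a b => aB A (di A s a) (di A s b)
  | BFR a => aFR A (di A s a)
  | BFC a => aFC A (di A s a)
  | BTR a => aTR A (di A s a)
  | BCore a => core k (di A s a)
  | BPar a => par k (di A s a)
  | BIff a b => db A s a == db A s b
  | BThr w f => light w (dn A s f)
  end.

Fixpoint kb (s : seq nat) (e : bexp) : bool :=
  match e with
  | BEq a b | BUnp a b | BBlk a b => ki s a && ki s b
  | BAnd a b | BOr a b | BIff a b => kb s a && kb s b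
  | BNot a => kb s a
  | BFR a | BFC a | BTR a | BCore a | BPar a => ki s a
  | BThr w f => kn s f
  end.

Definition keys (s : seq (nat * I)) := map fst s.

Lemma ciE st A s e : rep st A s -> ki (keys s) e -> eval st (ci e) = di A s e.
Proof.
move=> r; elim: e => [x|a IHa b IHb|a IHa b IHb|a IHa b IHb] /=.
- by move/(rep_env r) => [].
- by case/andP=> /IHa -> /IHb ->; rewrite (rep0 r) -/(ix _ _) (repL r).
- by case/andP=> /IHa -> /IHb ->; rewrite (rep0 r) -/(ix _ _) (repC r).
- by case/andP=> /IHa -> /IHb ->; rewrite (rep0 r) -/(ix _ _) (repR r).
Qed.

Lemma cnE st A s e : rep st A s -> kn (keys s) e -> eval st (cn e) = dn A s e.
Proof.
move=> r; elim: e => [a|a|a|a IHa b IHb] /=.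
- by move/(ciE r) ->; rewrite (repRL r).
- by move/(ciE r) ->; rewrite (repCL r).
- by move/(ciE r) ->; rewrite (repSL r).
- by case/andP=> /IHa -> /IHb ->.
Qed.

Lemma cbE st A s e : rep st A s -> kb (keys s) e -> eval st (cb e) = db A s e.
Proof.
move=> r; elim: e => [a b|a IHa b IHb|a IHa b IHb|a IHa|a b|a b|a|a|a|a|a|a IHa b IHb|w f] /=.
- by case/andP=> /(ciE r) -> /(ciE r) ->.
- by case/andP=> /IHa -> /IHb ->; rewrite mulnb.
- by case/andP=> /IHa -> /IHb ->; case: (db _ _ _); case: (db _ _ _).
- by move/IHa ->; case: (db _ _ _).
- case/andP=> /(ciE r) -> /(ciE r) ->; rewrite (rep0 r) -/(ix _ _) (repL r) (repP r).
  rewrite /psym /unprot addn1; case: (P _ _) => [x|] //=.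
  have -> y : ((val x).+1 == (val y).+1) = (Some x == Some y) by rewrite eqSS.
  by case: (Some x == _).
- by case/andP=> /(ciE r) -> /(ciE r) ->; rewrite (rep0 r) -/(ix _ _) (repB r).
- by move/(ciE r) ->; rewrite (repFR r).
- by move/(ciE r) ->; rewrite (repFC r).
- by move/(ciE r) ->; rewrite (repTR r).
- by move/(ciE r) ->; rewrite (rep2 r) addn1.
- by move/(ciE r) ->; rewrite (rep2 r).
- by case/andP=> /IHa -> /IHb ->; case: (db _ _ _); case: (db _ _ _).
- by move/(cnE r) ->; rewrite (rep0 r) (rep3 r).
Qed.

(** * Programs acting on abstract states *)

Variable N : nat.
Hypothesis nN : n <= N.
Local Notation wp := (wp eps delta N).

(* A record, so that unification does not look through it. *)
Record awp (p : cprog) (Q : ast n -> seq (nat * I) -> Prop) A s : Prop := Awp {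
  awpP : forall st, rep st A s ->
    wp p (fun st' => exists A' s', rep st' A' s' /\ Q A' s') st }.

Lemma awp_mono p (Q Q' : ast n -> seq (nat * I) -> Prop) A s :
  awp p Q A s -> (forall A' s', Q A' s' -> Q' A' s') -> awp p Q' A s.
Proof.
move=> [h] hQ; split=> st /h hst; apply: wp_mono hst _ => st' [A' [s' [r q]]].
by exists A', s'; split=> //; apply: hQ.
Qed.

Lemma awp_skip (Q : ast n -> seq (nat * I) -> Prop) A s : Q A s -> awp CSkip Q A s.
Proof. by move=> q; split=> st r; apply: wp_skip; exists A, s. Qed.

Lemma awp_seq p q Q A s : awp p (awp q Q) A s -> awp (CSeq p q) Q A s.
Proof.
move=> [h]; split=> st /h hst; apply: wp_seq; apply: wp_mono hst _ => st' [A' [s' [r [hq]]]].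
exact: hq r.
Qed.

Lemma n0 : 0 < n. Proof. exact: leq_ltn_trans (ltn_ord i0). Qed.

Lemma ord_cap (i : I) : i <= capv n.
Proof. by apply: leq_trans (ltnW (ltn_ord i)) _; rewrite /capv; have := n0; nia. Qed.

Lemma rep_var st A s x (i : I) : rep st A s -> 20 <= x ->
  rep (set_var st x i) A ((x, i) :: s).
Proof.
move=> r x20; have ne y : y < 20 -> (y == x) = false by move=> h; apply/eqP; lia.
case: r => *; split=> //=; rewrite /upd ?ne // => y.
by rewrite inE; case: eqP => [->|_] //= ; auto.
Qed.

Definition subenv (s s' : seq (nat * I)) : Prop :=
  forall x, x \in keys s -> x \in keys s' /\ getd s' x = getd s x.

Lemma rep_sub st A s s' : rep st A s' -> subenv s s' -> rep st A s.
Proof.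
move=> r h; case: (r) => *; split=> // x /h[/(rep_env r)[x20 vx] e].
by split=> //; rewrite vx e.
Qed.

Lemma subenv_cons s s' x i : subenv s s' -> x \notin keys s -> subenv s ((x, i) :: s').
Proof.
move=> h nx y hy; have [h1 h2] := h y hy; rewrite inE h1 orbT /=.
by case: eqP => // e; move: nx; rewrite -e hy.
Qed.

Lemma awp_let x e i (Q : ast n -> seq (nat * I) -> Prop) A s :
  20 <= x -> ki (keys s) e -> di A s e = i -> Q A ((x, i) :: s) ->
  awp (LET x e) Q A s.
Proof.
move=> x20 ke ei q; split=> st r; apply: (wp_assign i).
- by rewrite (ciE r ke) ei.
- by rewrite (rep0 r) ord_cap.
- by exists A, ((x, i) :: s); split=> //; apply: rep_var.
Qed.

Lemma awp_if e p q Q A s : kb (keys s) e ->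
  (db A s e -> awp p Q A s) -> (~~ db A s e -> awp q Q A s) ->
  awp (IF e p q) Q A s.
Proof.
move=> ke hp hq; split=> st r; apply: (wp_if (b := db A s e)).
- by rewrite (cbE r ke); case: (db _ _ _).
- by move=> /hp[]; apply.
- by move=> /hq[]; apply.
Qed.

Lemma awp_search x e (Q : ast n -> seq (nat * I) -> Prop) A s :
  20 <= x -> kb (x :: keys s) e ->
  (exists i, db A ((x, i) :: s) e) ->
  (forall i, db A ((x, i) :: s) e -> Q A ((x, i) :: s)) ->
  awp (FIND x e) Q A s.
Proof.
move=> x20 ke [i hi] hq; split=> st r; apply: (wp_search (n := n)) => //.
- by apply/eqP => e0; rewrite e0 in x20.
- exact: rep0 r.
- by exists i => //; rewrite (cbE (rep_var i r x20) ke) hi.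
- move=> j jn; have rj := rep_var (Ordinal jn) r x20.
  rewrite (cbE rj ke) => h; exists A, ((x, Ordinal jn) :: s); split=> //.
  by apply: hq; move: h; case: (db _ _ _).
Qed.

(** * Basic commands *)

Definition WR i j s :=
  CSeq (CPut 3 (eIx (Var i) (Var j)) (Var s))
  (CSeq (CPut 4 (eIx (Var i) (Var s)) (Var j))
        (CPut 5 (eIx (Var j) (Var s)) (Var i))).

Definition LOG i j :=
  CSeq (CPut 7 (eIx (Var i) (Var j)) (Num 1))
  (CSeq (CPut 15 (Var 4) (Var i))
  (CSeq (CPut 16 (Var 4) (Var j))
        (CAssign 4 (Bin Add (Var 4) (Num 1))))).

Definition RES i j :=
  CSeq (LOG i j) (CSeq (CPut 11 (Var i) (Num 1)) (CPut 12 (Var j) (Num 1))).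

Definition TCH i j := CSeq (LOG i j) (CPut 13 (Var i) (Num 1)).

Lemma ev st A s x : rep st A s -> x \in keys s -> vars st x = getd s x.
Proof. by move=> r /(rep_env r)[]. Qed.

Lemma capv100 : 100 <= capv n.
Proof. by rewrite /capv; have := n0; nia. Qed.

Lemma awp_WR i j x (Q : ast n -> seq (nat * I) -> Prop) A s :
  i \in keys s -> j \in keys s -> x \in keys s ->
  Q (wrs A [:: (getd s i, getd s j, getd s x)]) s -> awp (WR i j x) Q A s.
Proof.
move=> hi hj hx q; split=> st r.
have vi := ev r hi; have vj := ev r hj; have vx := ev r hx.
apply: wp_seq; apply: (wp_put (ix (getd s i) (getd s j)) (getd s x));
  rewrite /= ?(rep0 r) ?vi ?vj ?vx ?ord_cap //.
apply: wp_seq; apply: (wp_put (ix (getd s i) (getd s x)) (getd s j));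
  rewrite /= ?(rep0 r) ?vi ?vj ?vx ?ord_cap //.
apply: (wp_put (ix (getd s j) (getd s x)) (getd s i));
  rewrite /= ?(rep0 r) ?vi ?vj ?vx ?ord_cap //.
exists (wrs A [:: (getd s i, getd s j, getd s x)]), s; split=> //.
case: r => *; split=> //=.
- by move=> a a3; rewrite /upd; do 3! (case: eqP => [ea|_]; first by move: a3; rewrite ea); auto.
- by move=> i' j'; rewrite /upd /= ix_eq /upd2; case: ifP => _; auto.
- by move=> i' j'; rewrite /upd /= ix_eq /upd2; case: ifP => _; auto.
- by move=> i' j'; rewrite /upd /= ix_eq /upd2; case: ifP => _; auto.
Qed.

Lemma awp_LOG i j (Q : ast n -> seq (nat * I) -> Prop) A s :
  i \in keys s -> j \in keys s -> size (aLog A) < 100 ->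
  Q (touch' A (getd s i) (getd s j)) s -> awp (LOG i j) Q A s.
Proof.
move=> hi hj sz q; split=> st r.
have vi := ev r hi; have vj := ev r hj; have c100 := capv100.
have i4 x : x \in keys s -> (x == 4) = false.
  by move/(rep_env r) => [h _]; apply/eqP; lia.
have r0 := rep0 r; have r4 := rep4 r.
apply: wp_seq; apply: (wp_put (ix (getd s i) (getd s j)) 1);
  rewrite /= ?r0 ?vi ?vj //; first by lia.
apply: wp_seq; apply: (wp_put (size (aLog A)) (getd s i));
  rewrite /= ?r0 ?r4 ?vi ?ord_cap //.
apply: wp_seq; apply: (wp_put (size (aLog A)) (getd s j));
  rewrite /= ?r0 ?r4 ?vj ?ord_cap //.
apply: (wp_assign (size (aLog A)).+1); rewrite /= ?r0 ?r4 ?addn1 //; first by lia.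
exists (touch' A (getd s i) (getd s j)), s; split=> //.
have lr0 := rep_lr r; have lc0 := rep_lc r.
case: r => *; split=> //=; rewrite ?size_rcons //.
- by move=> a a3; rewrite /upd; do 3! (case: eqP => [ea|_]; first by move: a3; rewrite ea); auto.
- by move=> i' j'; rewrite /upd /= ix_eq /upd2; case: ifP => _; auto.
- move=> l; rewrite ltnS nth_rcons /upd /= => hl.
  by case: eqP => [->|/eqP ne]; [rewrite ltnn|rewrite ltn_neqAle ne hl lr0 // ltn_neqAle ne].
- move=> l; rewrite ltnS nth_rcons /upd /= => hl.
  by case: eqP => [->|/eqP ne]; [rewrite ltnn|rewrite ltn_neqAle ne hl lc0 // ltn_neqAle ne].
- by move=> x hx; rewrite /upd i4 //; auto.
Qed.

Lemma awp_RES i j (Q : ast n -> seq (nat * I) -> Prop) A s :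
  i \in keys s -> j \in keys s -> size (aLog A) < 100 ->
  Q (reserve A (getd s i) (getd s j)) s -> awp (RES i j) Q A s.
Proof.
move=> hi hj sz q; apply: awp_seq; apply: awp_LOG => //; split=> st r.
have vi := ev r hi; have vj := ev r hj; have c100 := capv100.
have r0 := rep0 r; have r4 := rep4 r.
apply: wp_seq; apply: (wp_put (getd s i) 1); rewrite /= ?r0 ?vi //; first by lia.
apply: (wp_put (getd s j) 1); rewrite /= ?r0 ?vj //; first by lia.
exists (reserve A (getd s i) (getd s j)), s; split=> //.
case: r => *; split=> //=.
- by move=> a a3; rewrite /upd; do 2! (case: eqP => [ea|_]; first by move: a3; rewrite ea); auto.
- move=> x; rewrite /upd /upd1 /= -[val x == _]/(x == _).
  by case: eqP => //= _; auto.
- move=> x; rewrite /upd /upd1 /= -[val x == _]/(x == _).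
  by case: eqP => //= _; auto.
Qed.

Lemma awp_TCH i j (Q : ast n -> seq (nat * I) -> Prop) A s :
  i \in keys s -> j \in keys s -> size (aLog A) < 100 ->
  Q (touch A (getd s i) (getd s j)) s -> awp (TCH i j) Q A s.
Proof.
move=> hi hj sz q; apply: awp_seq; apply: awp_LOG => //; split=> st r.
have vi := ev r hi; have c100 := capv100; have r0 := rep0 r.
apply: (wp_put (getd s i) 1); rewrite /= ?r0 ?vi //; first by lia.
exists (touch A (getd s i) (getd s j)), s; split=> //.
case: r => *; split=> //=.
- by move=> a a3; rewrite /upd; do 1! (case: eqP => [ea|_]; first by move: a3; rewrite ea); auto.
- move=> x; rewrite /upd /upd1 /= -[val x == _]/(x == _).
  by case: eqP => //= _; auto.
Qed.

(** Allows a command to forget its temporaries, so that specifications mention only the caller's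
    environment. *)
Lemma awp_fin p (Q : ast n -> seq (nat * I) -> Prop) A s :
  awp p (fun A' s' => exists2 s1, subenv s1 s' & Q A' s1) A s -> awp p Q A s.
Proof.
move=> [h]; split=> st /h hst; apply: wp_mono hst _ => st' [A' [s' [r [s1 hs q]]]].
by exists A', s1; split=> //; apply: rep_sub hs.
Qed.

Definition SW i j z :=
  CSeq (LET 80 (IL (IV i) (IV j)))
  (CSeq (LET 81 (IR (IV j) (IV z)))
  (CSeq (LET 82 (IC (IV i) (IV z)))
  (CSeq (WR i j z) (CSeq (WR i 82 80) (CSeq (WR 81 j 80) (CSeq (WR 81 82 z)
  (CSeq (LOG i 82) (CSeq (TCH 81 j) (TCH 81 82))))))))).

Lemma awp_SW i j z (Q : ast n -> seq (nat * I) -> Prop) A s :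
  i \in keys s -> j \in keys s -> z \in keys s -> all (gtn 80) (keys s) ->
  size (aLog A) < 97 ->
  Q (switch A (getd s i) (getd s j) (getd s z)) s -> awp (SW i j z) Q A s.
Proof.
move=> hi hj hz /allP h80 sz q; apply: awp_fin.
have ne x y : x \in keys s -> 80 <= y -> (x == y) = false.
  by move=> /h80 /= h hy; apply/eqP; lia.
apply: awp_seq; apply: awp_let => //=; rewrite ?hi ?hj ?hz //.
apply: awp_seq; apply: awp_let => //=; rewrite ?inE ?hi ?hj ?hz ?orbT //.
apply: awp_seq; apply: awp_let => //=; rewrite ?inE ?hi ?hj ?hz ?orbT //.
rewrite !ne //.
do 4! (apply: awp_seq; apply: awp_WR; rewrite /= ?inE ?hi ?hj ?hz ?orbT // ?ne //).
apply: awp_seq; apply: awp_LOG; rewrite /= ?inE ?hi ?hj ?hz ?orbT // ?ne //; first by lia.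
apply: awp_seq; apply: awp_TCH; rewrite /= ?inE ?hi ?hj ?hz ?orbT // ?ne ?size_rcons //; first by lia.
apply: awp_TCH; rewrite /= ?inE ?hi ?hj ?hz ?orbT // ?ne ?size_rcons //; first by lia.
exists s; last exact: q.
by do 3! (apply: subenv_cons; last by apply/negP => /h80).
Qed.

End Machine.

(** * Composing the changes made inside a trade *)

Section Ext.

Variables (n k : nat).
Notation I := 'I_n.
Variables (P : I -> I -> option I).
Implicit Type A : ast n.
Local Notation L A := (sqL (aS A)).
Local Notation C A := (sqC (aS A)).
Local Notation Rw A := (sqR (aS A)).
Local Notation unp := (unprot P).
Local Notation good := (pristine P).
Local Notation inter := (switchable P).
Local Notation mid := (mid P).

Definition bases (pr : seq (I * I * I * I)) : seq (I * I) := [seq q.1.1 | q <- pr].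

(* [A'] is obtained from [A] by reserving rows [rs] and columns [cs], and by
   switching intercalates based at cells among [bs]. *)
Record ext A0 A pr A' pr' (bs : seq (I * I)) (rs cs : seq I) (c : nat) : Prop := {
  ext_mid : mid A0 A' pr';
  ext_bases : forall x, x \in bases pr' -> x \in bs ++ bases pr;
  ext_size : size pr' <= size bs + size pr;
  ext_frame : forall x y, aB A x y -> (x, y) \notin bs -> L A' x y = L A x y;
  ext_B : forall x y, aB A x y -> aB A' x y;
  ext_FR : forall x, aFR A' x = (x \in rs) || aFR A x;
  ext_FC : forall x, aFC A' x = (x \in cs) || aFC A x;
  ext_log : size (aLog A') <= size (aLog A) + c
}.

Lemma ext_refl A0 A pr : mid A0 A pr -> ext A0 A pr A pr [::] [::] [::] 0.
Proof. by move=> m; split; rewrite ?addn0. Qed.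

Lemma ext_trans A0 A pr A1 pr1 A2 pr2 bs rs cs c bs' rs' cs' c' :
  ext A0 A pr A1 pr1 bs rs cs c -> ext A0 A1 pr1 A2 pr2 bs' rs' cs' c' ->
  ext A0 A pr A2 pr2 (bs ++ bs') (rs ++ rs') (cs ++ cs') (c + c').
Proof.
move=> h1 h2; split.
- exact: ext_mid h2.
- move=> x /(ext_bases h2); rewrite !mem_cat => /orP[->|/(ext_bases h1)]; rewrite ?orbT //.
  by rewrite mem_cat => /orP[]->; rewrite ?orbT.
- by have := ext_size h1; have := ext_size h2; rewrite size_cat; lia.
- move=> x y b; rewrite mem_cat negb_or => /andP[n1 n2].
  by rewrite (ext_frame h2) ?(ext_frame h1) //; apply: (ext_B h1).
- by move=> x y /(ext_B h1)/(ext_B h2).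
- by move=> x; rewrite (ext_FR h2) (ext_FR h1) mem_cat orbCA orbA.
- by move=> x; rewrite (ext_FC h2) (ext_FC h1) mem_cat orbCA orbA.
- by have := ext_log h1; have := ext_log h2; lia.
Qed.

Lemma ext_weak A0 A pr A' pr' bs rs cs c bs' rs' cs' c' :
  ext A0 A pr A' pr' bs rs cs c -> {subset bs <= bs'} -> size bs <= size bs' ->
  rs =i rs' -> cs =i cs' -> c <= c' ->
  ext A0 A pr A' pr' bs' rs' cs' c'.
Proof.
move=> h hb hs hr hc hcc; split.
- exact: ext_mid h.
- by move=> x /(ext_bases h); rewrite !mem_cat => /orP[/hb->//|->]; rewrite orbT.
- by apply: leq_trans (ext_size h) _; rewrite leq_add2r.
- by move=> x y b nb; apply: (ext_frame h) => //; apply: contra nb; apply: hb.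
- exact: ext_B h.
- by move=> x; rewrite (ext_FR h) hr.
- by move=> x; rewrite (ext_FC h) hc.
- by apply: leq_trans (ext_log h) _; rewrite leq_add2l.
Qed.

Lemma ext_reserve A0 A pr i j : mid A0 A pr ->
  aFR A i || ~~ aTR A i -> aFC A j || (pr == [::]) ->
  ext A0 A pr (reserve A i j) pr [::] [:: i] [:: j] 1.
Proof.
move=> m hi hj; split=> //=.
- exact: mid_reserve.
- by move=> x y b; rewrite /upd2 b; case: ifP.
- by move=> x; rewrite inE.
- by move=> x; rewrite inE.
- by rewrite size_rcons addn1.
Qed.

Lemma reserve_B A i j : aB (reserve A i j) i j.
Proof. by rewrite /= /upd2 !eqxx. Qed.

Lemma ext_switch A0 A pr i j z : mid A0 A pr -> inter A i j z -> aFR A i -> aFC A j ->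
  aB A i j -> P i j != Some (L A0 i j) ->
  ext A0 A pr (switch A i j z) ((i, j, Rw A j z, C A i z) :: pr)
      [:: (i, j)] [::] [::] 3.
Proof.
move=> m h fi fj b nP; split=> //.
- exact: mid_switch.
- move=> x y bx; rewrite inE => ne; exact: (switch_frame h bx ne).
- by move=> x y bx; rewrite (switch_B A i j z) bx.
- by rewrite /= !size_rcons !addnS addn0.
Qed.

End Ext.

(** * Making symbols agree by switching intercalates *)

Definition bGood i j := BAnd (BNot (BBlk i j)) (BUnp i j).

Definition bInter i j z :=
  let iz := IR j z in let jz := IC i z in
  BAnd (BNot (BFR iz)) (BAnd (BNot (BFC jz)) (BAnd (bGood i jz) (BAnd (bGood iz j)
    (BAnd (bGood iz jz) (BEq (IL iz jz) (IL i j)))))).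

Definition ZEQ i j i' j' :=
  CSeq (FIND 79 (BAnd (bInter (IV i) (IV j) (IV 79)) (bInter (IV i') (IV j') (IV 79))))
  (CSeq (SW i j 79) (SW i' j' 79)).

Definition bXor a b := BNot (BIff a b).

Definition bCondQ al u v be q :=
  BAnd (BCore q) (BAnd (BIff (BPar q) (bXor (bXor (BPar be) (BPar u)) (BPar v)))
  (BAnd (BNot (BFR q)) (BAnd (BNot (BTR q)) (BAnd (bGood q u) (BAnd (bGood q v)
  (BAnd (BThr 24 (NAdd (NAdd (NRL q) (NSL (IL q u))) (NSL (IL q v))))
        (BOr (BIff (BPar al) (BPar be)) (bInter al v (IL q u))))))))).

(* Switches intercalates until (al,v) and (q,u) carry the same symbol z1, and
   (be,u) and (q,v) the same symbol z2.  Writing z1, s1 in row al, z2, z1 in row q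
   and s2, z2 in row be of the columns u, v then only changes the symbol of (al,u)
   into s1 in row al and that of (be,v) into s2 in row be. *)
Definition EQ al u v be q z1 z2 :=
  CSeq (FIND q (bCondQ (IV al) (IV u) (IV v) (IV be) (IV q)))
  (CSeq (RES q u) (CSeq (RES q v)
  (CSeq (IF (BIff (BPar (IV al)) (BPar (IV be))) (ZEQ al v q u)
            (CSeq (LET 78 (IL (IV q) (IV u))) (SW al v 78)))
  (CSeq (ZEQ be u q v)
  (CSeq (LET z1 (IL (IV al) (IV v))) (LET z2 (IL (IV be) (IV u)))))))).

(** 60 = 6 + 2 * (10 + 7 + 10). A trade reserves five rows at first, then [rho], [be] and up to
    three rows q; five columns, then d and [be2]; and it has switched at most ten intercalates when
    the last pair is sought. *)
Lemma zeq_count p x y q l a b c k : 6 * p + 60 + x + y + q < k -> l <= x + y + q ->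
  a <= 10 -> b <= 7 -> c <= 10 -> 6 * p + 6 + l + 2 * (a + b + c) < k.
Proof. lia. Qed.

Lemma q_count p x y q l a b c k : 5 * p + 48 + x + y + q < k -> l <= x + y ->
  a <= 9 -> b <= 7 -> c <= 8 -> 5 * p + 5 + l + 2 * a + b + 2 * c + q < k.
Proof. lia. Qed.

Section Equalize.

Variables (R : realType) (eps delta : R).
Variables (n k : nat) (i0 : 'I_n).
Notation I := 'I_n.
Variables (D : I -> I -> I) (csym sp : pred I).
Hypothesis dih : dihedral k D csym sp.
Variables (P : I -> I -> option I) (p : nat).
Hypothesis P_row : forall i, #|[pred j | P i j != None]| <= p.
Hypothesis P_col : forall j, #|[pred i | P i j != None]| <= p.
Hypothesis P_sym : forall s, #|[pred c : I * I | P c.1 c.2 == Some s]| <= p.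
Variables (st0 : state) (M idx N : nat).
Hypothesis nN : n <= N.

Implicit Type A : ast n.
Local Notation core := (core k).
Local Notation par := (par k).
Local Notation L A := (sqL (aS A)).
Local Notation C A := (sqC (aS A)).
Local Notation Rw A := (sqR (aS A)).
Local Notation unp := (unprot P).
Local Notation good := (pristine P).
Local Notation inter := (switchable P).
Local Notation mid := (mid P).
Local Notation thr := (light eps n M).
Local Notation awp := (awp eps delta k i0 D P st0 M idx N).
Local Notation db := (db eps k i0 P M).
Local Notation getd := (getd i0).

Lemma dbInterE A s i j z :
  db A s (bInter i j z) = inter A (di i0 A s i) (di i0 A s j) (di i0 A s z).
Proof. by []. Qed.

Lemma dbAndE A s a b : db A s (BAnd a b) = db A s a && db A s b.
Proof. by []. Qed.

Variable A0 : ast n.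
Hypothesis V : inv k D A0 M.

Lemma notin_bases (pr : seq (I * I * I * I)) i j : (i, j) \notin bases pr ->
  forall iz jz, (i, j, iz, jz) \notin pr.
Proof.
move=> h iz jz; apply: contra h => hp.
by apply/mapP; exists (i, j, iz, jz).
Qed.

Lemma subset_card (T : finType) (f : T -> bool) rs c :
  (forall x, f x -> x \in rs) -> size rs <= c -> #|[pred x | f x]| <= c.
Proof.
move=> h; apply: leq_trans; apply: leq_trans (card_size rs).
by apply: subset_leq_card; apply/subsetP => x; apply: h.
Qed.

Variable x y : nat. (* loads *)
Hypothesis hz : forall q, thr 24 q -> 6 * p + 60 + x + y + q < k.
Variable mLq : nat.
Hypothesis hmark : forall f : I -> nat, \sum_q f q <= 3 * M -> #|[pred q | ~~ thr 24 (f q)]| <= mLq.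
Hypothesis hq : 5 * p + 48 + x + y + mLq < k.

Lemma awp_ZEQ (i j i' j' : nat) vi vj vi' vj' rs cs q (Q : ast n -> seq (nat * I) -> Prop) A pr s :
  getd s i = vi -> getd s j = vj -> getd s i' = vi' -> getd s j' = vj' ->
  mid A0 A pr ->
  i \in keys s -> j \in keys s -> i' \in keys s -> j' \in keys s ->
  all (gtn 79) (keys s) -> size (aLog A) < 94 ->
  core vi -> core vj -> L A vi vj = D vi vj -> aFR A vi -> aFC A vj ->
  (vi, vj) \notin bases pr -> aB A vi vj -> P vi vj != Some (L A0 vi vj) ->
  core vi' -> core vj' -> L A vi' vj' = D vi' vj' -> aFR A vi' -> aFC A vj' ->
  (vi', vj') \notin bases pr -> aB A vi' vj' -> P vi' vj' != Some (L A0 vi' vj') ->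
  vi != vi' -> vj != vj' -> sp (D vi vj) = sp (D vi' vj') ->
  (forall x, aFR A x -> x \in rs) -> size rs <= 10 ->
  (forall x, aFC A x -> x \in cs) -> size cs <= 7 -> size pr <= 10 ->
  thr 24 q ->
  aRL A0 vi + aCL A0 vj + aSL A0 (D vi vj) + aRL A0 vi' + aCL A0 vj' + aSL A0 (D vi' vj')
   <= x + y + q ->
  (forall A' pr', ext P A0 A pr A' pr' [:: (vi, vj); (vi', vj')] [::] [::] 6 ->
     L A' vi vj = L A' vi' vj' -> Q A' s) ->
  awp (ZEQ i j i' j') Q A s.
Proof.
move=> <- <- <- <- m ki kj ki' kj' /allP h79 sz ci cj Lij fi fj nb b nP ci' cj' Lij' fi' fj' nb' b' nP'
  nii njj ess hrs srs hcs scs spr tq hl hQ.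
have ne a : a \in keys s -> (a == 79) = false.
  by move=> /h79 /ltn_eqF.
apply: awp_fin; apply: awp_seq; apply: awp_search => //.
- by rewrite /= !inE ki kj ki' kj' !orbT.
- have [|z hzz] := exists_z dih P_row P_col P_sym V m ci cj Lij fi fj (notin_bases nb)
     ci' cj' Lij' fi' fj' (notin_bases nb') ess.
    exact: zeq_count (hz tq) hl (subset_card hrs srs) (subset_card hcs scs) spr.
  by exists z; rewrite dbAndE !dbInterE /= !ne.
move=> z; rewrite dbAndE !dbInterE /= !ne // => /andP[h1 h2].
have e1 := ext_switch m h1 fi fj b nP.
have h2' := inter_switch m h1 fi fj h2 fi' fj' nii njj.
have h79' : all (gtn 80) (keys ((79, z) :: s)).
  by apply/allP => a; rewrite inE => /orP[/eqP->//|/h79 /= /leqW].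
apply: awp_seq; apply: awp_SW; rewrite ?inE ?ki ?kj ?orbT //; first by clear -sz; lia.
rewrite /= !ne //.
have e2 := ext_switch (ext_mid e1) h2' fi' fj' (ext_B e1 b') nP'.
apply: awp_SW; rewrite ?inE ?ki' ?kj' ?orbT //; first by move: (ext_log e1); clear -sz; lia.
rewrite /= !ne //; exists s; first by apply: subenv_cons => //; apply/negP => /h79.
apply: hQ (ext_trans e1 e2) _.
rewrite (switch_base h2' fi' fj').
rewrite (ext_frame e2) ?(ext_B e1) // ?inE ?xpair_eqE ?(negbTE nii) //.
exact: (switch_base h1 fi fj).
Qed.

Lemma dbCondQE A s al u v be q :
  db A s (bCondQ al u v be q) =
  condQ k P thr A (di i0 A s al) (di i0 A s u) (di i0 A s v) (di i0 A s be) (di i0 A s q).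
Proof. by rewrite /bCondQ /bXor /= !negb_eqb. Qed.

Lemma awp_EQ (al u v be q z1 z2 : nat) val_ vu vv vbe rs cs
    (Q : ast n -> seq (nat * I) -> Prop) A pr s :
  getd s al = val_ -> getd s u = vu -> getd s v = vv -> getd s be = vbe ->
  mid A0 A pr ->
  [&& al \in keys s, u \in keys s, v \in keys s & be \in keys s] ->
  all (gtn 78) [:: z2, z1, q & keys s] -> all (leq 20) [:: z2; z1; q] ->
  uniq [:: z2; z1; q] -> [&& z2 \notin keys s, z1 \notin keys s & q \notin keys s] ->
  size (aLog A) < 86 ->
  core val_ -> core vbe -> core vu -> core vv -> val_ != vbe -> vu != vv ->
  aFR A val_ -> aFR A vbe -> aFC A vu -> aFC A vv ->
  L A val_ vv = D val_ vv -> (val_, vv) \notin bases pr -> aB A val_ vv ->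
  P val_ vv != Some (L A0 val_ vv) ->
  L A vbe vu = D vbe vu -> (vbe, vu) \notin bases pr -> aB A vbe vu ->
  P vbe vu != Some (L A0 vbe vu) ->
  (forall x, aFR A x -> x \in rs) -> size rs <= 9 ->
  (forall x, aFC A x -> x \in cs) -> size cs <= 7 -> size pr <= 8 ->
  aCL A0 vu + 2 * aCL A0 vv + aRL A0 val_ + aSL A0 (D val_ vv) <= x + y ->
  aRL A0 vbe + aCL A0 vu + aCL A0 vv + aSL A0 (D vbe vu) <= x + y ->
  (forall A' pr' vq, core vq -> ~~ aFR A vq -> 
     ext P A0 A pr A' pr' [:: (val_, vv); (vq, vu); (vbe, vu); (vq, vv)] [:: vq] [:: vu; vv] 14 ->
     aB A' vq vu -> aB A' vq vv -> P vq vu != Some (L A0 vq vu) -> P vq vv != Some (L A0 vq vv) ->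
     L A' val_ vv = L A' vq vu -> L A' vbe vu = L A' vq vv ->
     Q A' [:: (z2, L A' vbe vu), (z1, L A' val_ vv), (q, vq) & s]) ->
  awp (EQ al u v be q z1 z2) Q A s.
Proof.
move=> gal gu gv gbe m /and4P[kal ku kv kbe] h78 h20 un kz sz cal cbe cu cv nab nuv
  fal fbe fu fv nat1 nb1 b1 nP1 nat2 nb2 b2 nP2 hrs srs hcs scs spr ld1 ld2 hQ.
have /and4P[z2_20 z1_20 q20 _] := h20.
have /and3P[nz2 nz1 nq] := kz.
have neq a b : a \in keys s -> b \notin keys s -> (a == b) = false.
  by move=> ha hb; apply: contraNF hb => /eqP <-.
have nk78 : 78 \notin keys s.
  by apply/negP => h; move/allP: h78 => /(_ 78); rewrite !inE h !orbT => /(_ isT).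
have kqs : all (gtn 79) (keys ((q, i0) :: s)).
  by apply/allP => a ha; move/allP: h78 => /(_ a) /=; rewrite !inE in ha *; case/orP: ha => ->; rewrite ?orbT => /(_ isT) /leqW.
apply: awp_seq; apply: awp_search => //.
  by rewrite /= !inE kal ku kv kbe eqxx !orbT.
- have hL : #|[pred r | ~~ thr 24 (q_load A r vu vv)]| <= mLq.
    apply: hmark; rewrite !big_split /= (mid_rl m) (mid_sl m).
    have iu w : injective (L A ^~ w) by exact: (col_inj m).
    rewrite (sum_inj_le (aSL A0) (iu vu)) (sum_inj_le (aSL A0) (iu vv)).
    rewrite !mulSn mul0n addn0 addnA.
    exact: leq_add (leq_add (inv_rs V) (inv_ss V)) (inv_ss V).
  have [|r hr] := exists_q dih P_row P_col P_sym V m cal cbe cu cv nat1 fal fv (notin_bases nb1) hL.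
    exact: q_count hq ld1 (subset_card hrs srs) (subset_card hcs scs) spr.
  by exists r; rewrite dbCondQE /= eqxx !neq // gal gu gv gbe.
move=> vq; rewrite dbCondQE /= eqxx !neq // gal gu gv gbe.
case/and5P=> cq /eqP pq nfq ntq /and4P[gqu gqv tq hal].
have [_ _ Dqu] := good_nat V m gqu; have [_ _ Dqv] := good_nat V m gqv.
have startP i j : good A i j -> P i j != Some (L A0 i j).
  by case/andP => /(mid_free m)[_ <-].
have nbq w : (vq, w) \notin bases pr.
  apply/negP => /mapP[[[[i1 j1] i2] j2] hp /= [e1 _]].
  by have [f1 _ _ _ _] := mid_pr m hp; rewrite -e1 (negbTE nfq) in f1.
have e1 := ext_reserve m (_ : aFR A vq || ~~ aTR A vq) (_ : aFC A vu || (pr == [::])).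
have {}e1 : ext P A0 A pr (reserve A vq vu) pr [::] [:: vq] [:: vu] 1.
  by apply: e1; rewrite ?ntq ?fu ?orbT.
pose A1 := reserve A vq vu; pose A2 := reserve A1 vq vv.
have e2 : ext P A0 A1 pr A2 pr [::] [:: vq] [:: vv] 1.
  apply: ext_reserve; first exact: ext_mid e1.
    by rewrite (ext_FR e1) mem_head.
  by rewrite (ext_FC e1) fv orbT.
have e12 := ext_trans e1 e2.
apply: awp_seq; apply: awp_RES; rewrite ?inE ?ku ?eqxx ?orbT //; first by apply: ltn_trans sz _.
rewrite /= eqxx neq // gu -/A1.
apply: awp_seq; apply: awp_RES; rewrite ?inE ?kv ?eqxx ?orbT //; first by rewrite size_rcons ltnS; apply: ltn_trans sz _.
rewrite /= eqxx neq // gv -/A2.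
have m2 : mid A0 A2 pr := ext_mid e12.
have Bqu : aB A2 vq vu by apply: (ext_B e2); exact: reserve_B.
have Bqv : aB A2 vq vv by exact: reserve_B.
have FRq : aFR A2 vq by rewrite (ext_FR e12) mem_head.
have FR2 w : aFR A w -> aFR A2 w by move=> h; rewrite (ext_FR e12) h orbT.
have FC2 w : aFC A w -> aFC A2 w by move=> h; rewrite (ext_FC e12) h orbT.
have naq : val_ != vq by apply: contraNneq nfq => <-.
have nbeq : vbe != vq by apply: contraNneq nfq => <-.
have hrs2 w : aFR A2 w -> w \in vq :: rs.
  rewrite (ext_FR e12) !inE orbb => /orP[/eqP->|/hrs->]; by rewrite ?eqxx ?orbT.
have hcs2 w : aFC A2 w -> w \in cs.
  by rewrite (ext_FC e12) !inE => /orP[/orP[]/eqP->|/hcs//]; apply: hcs.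
have lq : q_load A vq vu vv = aRL A0 vq + aSL A0 (D vq vu) + aSL A0 (D vq vv).
  by rewrite /q_load (mid_rl m) (mid_sl m) Dqu Dqv.
have sz2 : size (aLog A2) <= size (aLog A) + 2 by exact: ext_log e12.
pose s1 := (q, vq) :: s.
have k1 w : w \in keys s -> w \in keys s1 by rewrite inE => ->; rewrite orbT.
have kq : q \in keys s1 by rewrite mem_head.
have g1 w a : w \in keys s -> getd s w = a -> getd s1 w = a by move=> hw; rewrite /= neq.
have gq : getd s1 q = vq by rewrite /= eqxx.
have srs2 : size (vq :: rs) <= 10 by [].
have spr10 : size pr <= 10 by apply: leq_trans spr _.
have blk : awp (IF (BIff (BPar (IV al)) (BPar (IV be))) (ZEQ al v q u)
            (CSeq (LET 78 (IL (IV q) (IV u))) (SW al v 78)))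
   (fun A3 s3 => s3 = s1 /\ exists pr3,
      ext P A0 A2 pr A3 pr3 [:: (val_, vv); (vq, vu)] [::] [::] 6 /\
      L A3 val_ vv = L A3 vq vu) A2 s1.
  apply: awp_if; first by rewrite /= !inE kal kbe !orbT.
    move=> hp; apply: (@awp_ZEQ al v q u val_ vv vq vu (vq :: rs) cs (q_load A vq vu vv) _ A2 pr s1);
      rewrite ?g1 ?gq ?kq ?k1 //; auto; try by [exact: (ext_B e12)|exact: startP|rewrite eq_sym].
    - by move: sz sz2; clear; lia.
    - rewrite !(dih_par dih) // pq; move: hp; rewrite /= !neq // gal gbe => /eqP ->.
      by case: (par vbe); case: (par vu); case: (par vv).
    - by move: ld1; rewrite lq; clear; lia.
    - by move=> A3 pr3 e3 eq3; split=> //; exists pr3.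
  (* Parities differ, so no common second symbol exists; one switch at (al, v) brings there the
     symbol already present at (q, u). *)
  move=> hp; have npar : par val_ != par vbe by move: hp; rewrite /= !neq // gal gbe.
  move: hal; rewrite (negbTE npar) /= => hin.
  apply: awp_fin; apply: awp_seq; apply: awp_let => //; first by rewrite /= !inE eqxx ku orbT.
  rewrite [di _ _ _ _]/= eqxx neq // gu.
  (* The intercalate was tested before (q, u) and (q, v) were reserved. It survives because its
     other row is not q: the symbols of q in columns u and v differ. *)
  have hin2 : inter A2 val_ vv (L A vq vu).
    case/and5P: (hin) => f1 f2 g1' g2' /andP[g3' g4'].
    have niq : Rw A vv (L A vq vu) != vq.
      apply: contraNneq nuv => e.
      apply/eqP; apply: (row_inj m (i := vq)).
      by have [_ _ l3 _] := mid_lat m; rewrite -[in RHS]e l3.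
    have keep i j : i != vq -> good A i j -> good A2 i j.
      rewrite /pristine /unprot /= /upd2 => ni; by rewrite (negbTE ni).
    rewrite /switchable; cbv zeta; rewrite (ext_FR e12) (ext_FC e12) !inE !orbb.
    have nju : C A val_ (L A vq vu) != vu by apply: contraNneq f2 => ->.
    have njv : C A val_ (L A vq vu) != vv by apply: contraNneq f2 => ->.
    rewrite (negbTE niq) f1 (negbTE nju) (negbTE njv) f2 /= !keep //.
  have e3 := ext_switch m2 hin2 (FR2 _ fal) (FC2 _ fv) (ext_B e12 b1) nP1.
  have L3 : L (switch A2 val_ vv (L A vq vu)) val_ vv = L (switch A2 val_ vv (L A vq vu)) vq vu.
    rewrite (switch_base hin2 (FR2 _ fal) (FC2 _ fv)).
    by rewrite (ext_frame e3) // inE xpair_eqE eq_sym (negbTE naq).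
  apply: awp_SW; rewrite ?inE ?kal ?kv ?eqxx ?orbT //.
    by apply/allP => a; rewrite inE => /orP[/eqP->//|/(allP kqs) /leqW].
    by move: sz sz2; clear; lia.
  rewrite /= !neq // gal gv.
  exists s1; first by apply: subenv_cons => //; rewrite inE negb_or nk78 andbT; apply/eqP => /= e; move/allP: h78 => /(_ q); rewrite !inE eqxx !orbT -e => /(_ isT).
  split=> //; exists ((val_, vv, Rw A2 vv (L A vq vu), C A2 val_ (L A vq vu)) :: pr).
  split; last exact: L3.
  apply: ext_weak e3 _ _ _ _ _ => //.
  by move=> w; rewrite !inE => /eqP->; rewrite eqxx.
apply: awp_seq; apply: awp_mono blk _ => A3 s3 [-> [pr3 [e3 eq3]]].
have e13 := ext_trans e12 e3; have m3 := ext_mid e3.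
have sp3 : size pr3 <= 10 by move: (ext_size e3) spr; rewrite /=; clear; lia.
have nb2' : (vbe, vu) \notin bases pr3.
  apply/negP => /(ext_bases e3); rewrite !inE (negbTE nb2) !xpair_eqE (negbTE nbeq) eq_sym (negbTE nab).
  by [].
have nbq' : (vq, vv) \notin bases pr3.
  apply/negP => /(ext_bases e3); rewrite !inE (negbTE (nbq _)) !xpair_eqE eq_sym (negbTE naq).
  by rewrite [vv == vu]eq_sym (negbTE nuv) andbF.
have fr3 : L A3 vbe vu = L A vbe vu.
  rewrite (ext_frame e3) ?(ext_B e12) // !inE !xpair_eqE (negbTE nbeq) eq_sym (negbTE nab) //.
have fr3' : L A3 vq vv = L A vq vv.
  rewrite (ext_frame e3) // !inE !xpair_eqE eq_sym (negbTE naq).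
  by rewrite [vv == vu]eq_sym (negbTE nuv) andbF.
have sz3 : size (aLog A3) <= size (aLog A) + 8 by exact: ext_log e13.
apply: awp_seq; apply: (@awp_ZEQ be u q v vbe vu vq vv (vq :: rs) cs (q_load A vq vu vv) _ A3 pr3 s1);
      rewrite ?g1 ?gq ?kq ?k1 ?fr3 ?fr3' //; auto; try by [exact: startP].
- by move: sz sz3; clear; lia.
- by rewrite (ext_FR e3) FR2.
- by rewrite (ext_FC e3) FC2.
- by rewrite (ext_B e13).
- by rewrite (ext_FR e3) FRq.
- by rewrite (ext_FC e3) FC2.
- by rewrite (ext_B e3).
- rewrite !(dih_par dih) // pq.
  by case: (par vbe); case: (par vu); case: (par vv).
- by move=> w; rewrite (ext_FR e3) /=; apply: hrs2.
- by move=> w; rewrite (ext_FC e3) /=; apply: hcs2.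
- by move: ld2; rewrite lq; clear; lia.
move=> A4 pr4 e4 eq4.
have e14 := ext_trans e13 e4.
have fr4 : L A4 val_ vv = L A3 val_ vv.
  by rewrite (ext_frame e4) ?(ext_B e13) // !inE !xpair_eqE (negbTE naq) (negbTE nab).
have fr4' : L A4 vq vu = L A3 vq vu.
  rewrite (ext_frame e4) ?(ext_B e3) // !inE !xpair_eqE eq_sym (negbTE nbeq) (negbTE nuv) andbF.
  by [].
have z12 : (z2 == z1) = false /\ (z1 == q) = false /\ (z2 == q) = false.
  by move: un; rewrite /= !inE negb_or => /and3P[/andP[/negbTE-> /negbTE->] /negbTE-> _].
apply: awp_seq; apply: awp_let => //; first by rewrite /= !inE kal kv !orbT.
rewrite [di _ _ _ _]/= !neq // gal gv.
apply: awp_let => //; first by rewrite /= !inE kbe ku !orbT.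
rewrite [di _ _ _ _]/= !neq // gbe gu.
apply: hQ => //.
- apply: ext_weak e14 _ _ _ _ _ => //.
  by move=> w; rewrite !inE orbb.
- by rewrite (ext_B e4) ?(ext_B e3).
- by rewrite (ext_B e4) ?(ext_B e3).
- exact: startP.
- exact: startP.
- by rewrite fr4 eq3 fr4'.
Qed.

End Equalize.

(** * Closing the open ends of a trade *)

Definition RESS (l : seq (nat * nat)) : cprog :=
  foldr (fun x c => CSeq (RES x.1 x.2) c) CSkip l.

(** Gives dummy values to the variables of an omitted [EQ], so that the environment has the same
    shape in all cases. *)
Definition DUM q z1 z2 :=
  CSeq (LET q (IV 20)) (CSeq (LET z1 (IV 20)) (LET z2 (IV 20))).

Definition bTrue := BEq (IV 20) (IV 20).

Definition bCondD (act1 act2 : bool) kap :=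
  let d := IV 34 in let h := IV 28 in let g := IV 29 in let al := IV 32 in
  let c2 := IV 27 in let al2 := IV 33 in let r3 := IV 31 in
  let rho := IR d (IV kap) in let be := IR d (IV 26) in let be2 := IC rho (IV 30) in
  BAnd (BNot (BFC d)) (BAnd (BNot (BFR rho)) (BAnd (BUnp rho d) (BAnd (bGood h d)
  (BAnd (bGood rho g)
  (BAnd (if act1 then BAnd (BNot (BFR be)) (BAnd (BUnp be d) (BAnd (bGood al d) (bGood be c2)))
         else bTrue)
  (BAnd (if act2 then BAnd (BNot (BFC be2)) (BAnd (BUnp rho be2)
           (BAnd (bGood rho al2) (bGood r3 be2))) else bTrue)
  (BThr 24 (NAdd (NAdd (NAdd (NAdd (NAdd (NCL d) (NCL d)) (NAdd (NRL rho) (NRL rho)))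
      (NRL be)) (NCL be2))
    (NAdd (NAdd (NAdd (NAdd (NAdd (NSL (IL h d)) (NSL (IL rho g))) (NSL (IL al d)))
      (NSL (IL be c2))) (NSL (IL rho al2))) (NSL (IL r3 be2))))))))))).

(* Column d (variable 34) and row rho (variable 35), with kap in (rho,d), close up to
   three chains of exchanges left open by the choice of e; [act1] and [act2] tell
   which of the first two are needed. *)
Definition DST (act1 act2 : bool) kap :=
  CSeq (FIND 34 (bCondD act1 act2 kap))
  (CSeq (LET 35 (IR (IV 34) (IV kap))) (CSeq (LET 36 (IR (IV 34) (IV 26)))
  (CSeq (LET 37 (IC (IV 35) (IV 30)))
  (CSeq (RESS ([:: (35, 34); (35, 29); (28, 34)]
      ++ (if act1 then [:: (32, 34); (36, 27); (36, 34)] else [::])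
      ++ (if act2 then [:: (35, 33); (31, 37); (35, 37)] else [::])))
  (CSeq (if act1 then EQ 32 27 34 36 39 40 41 else DUM 39 40 41)
  (CSeq (if act2 then EQ 35 37 33 31 42 43 44 else DUM 42 43 44)
        (EQ 28 29 34 35 45 46 47))))))).

Section Ress.

Variables (n : nat) (P : 'I_n -> 'I_n -> option 'I_n).
Notation I := 'I_n.
Implicit Type A : ast n.
Local Notation L A := (sqL (aS A)).

Definition ress A (l : seq (I * I)) : ast n := foldl (fun A x => reserve A x.1 x.2) A l.

Lemma ress_S A l : aS (ress A l) = aS A.
Proof. by elim: l A => //= x l IH A; rewrite IH. Qed.

Lemma mid0_TR A0 A i : mid P A0 A [::] -> aTR A i = false.
Proof.
move=> m; have := mid_TR m; rewrite leqn0 => /eqP/card0_eq/(_ i).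
by rewrite inE.
Qed.

Lemma ext_ress A0 A l : mid P A0 A [::] ->
  ext P A0 A [::] (ress A l) [::] [::] [seq x.1 | x <- l] [seq x.2 | x <- l] (size l).
Proof.
elim: l A => [|[i j] l IH] A m; first exact: ext_refl.
have e1 : ext P A0 A [::] (reserve A i j) [::] [::] [:: i] [:: j] 1.
  by apply: ext_reserve; rewrite ?(mid0_TR _ m) ?orbT.
exact: ext_trans e1 (IH _ (ext_mid e1)).
Qed.

Lemma ress_B A0 A l x : mid P A0 A [::] -> x \in l -> aB (ress A l) x.1 x.2.
Proof.
elim: l A => [|[i j] l IH] A m //.
have e1 : ext P A0 A [::] (reserve A i j) [::] [::] [:: i] [:: j] 1.
  by apply: ext_reserve; rewrite ?(mid0_TR _ m) ?orbT.
rewrite inE => /orP[/eqP->|xl]; last exact: IH (ext_mid e1) xl.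
by apply: (ext_B (ext_ress l (ext_mid e1))); exact: reserve_B.
Qed.

End Ress.

Section DStage.

Variables (R : realType) (eps delta : R).
Variables (n k : nat) (i0 : 'I_n).
Notation I := 'I_n.
Variables (D : I -> I -> I) (csym sp : pred I).
Hypothesis dih : dihedral k D csym sp.
Variables (P : I -> I -> option I) (p : nat).
Hypothesis P_row : forall i, #|[pred j | P i j != None]| <= p.
Hypothesis P_col : forall j, #|[pred i | P i j != None]| <= p.
Hypothesis P_sym : forall s, #|[pred c : I * I | P c.1 c.2 == Some s]| <= p.
Variables (st0 : state) (M idx N : nat).
Hypothesis nN : n <= N.

Implicit Type A : ast n.
Local Notation core := (core k).
Local Notation par := (par k).
Local Notation L A := (sqL (aS A)).
Local Notation C A := (sqC (aS A)).
Local Notation Rw A := (sqR (aS A)).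
Local Notation unp := (unprot P).
Local Notation good := (pristine P).
Local Notation inter := (switchable P).
Local Notation mid := (mid P).
Local Notation thr := (light eps n M).
Local Notation awp := (awp eps delta k i0 D P st0 M idx N).
Local Notation db := (db eps k i0 P M).
Local Notation getd := (getd i0).

Lemma awp_RESS l (Q : ast n -> seq (nat * I) -> Prop) A s :
  all (fun x => (x.1 \in keys s) && (x.2 \in keys s)) l ->
  size (aLog A) + size l <= 100 ->
  Q (ress A [seq (getd s x.1, getd s x.2) | x <- l]) s -> awp (RESS l) Q A s.
Proof.
elim: l A => [|[i j] l IH] A /=; first by move=> _ _; exact: awp_skip.
case/andP=> /andP[hi hj] hl sz q; apply: awp_seq; apply: awp_RES => //.
  by move: sz; clear; lia.
by apply: IH => //; rewrite /= size_rcons; move: sz; clear; lia.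
Qed.

Variables (mLd mLq : nat).
Hypothesis hmark_d : forall f : I -> nat, \sum_q f q <= 12 * M ->
  #|[pred q | ~~ thr 24 (f q)]| <= mLd.
Hypothesis hmark_q : forall f : I -> nat, \sum_q f q <= 3 * M ->
  #|[pred q | ~~ thr 24 (f q)]| <= mLq.
Hypothesis hnd : forall x, thr 14 x -> 9 * p + 32 + x + mLd < n.
Hypothesis hnq : forall x y, thr 14 x -> thr 24 y -> 5 * p + 48 + x + y + mLq < k.
Hypothesis hnz : forall x y q, thr 14 x -> thr 24 y -> thr 24 q ->
  6 * p + 60 + x + y + q < k.

Variables (A0 A1 : ast n) (r c b a c1 r1 e c2 h g f r3 al al2 : I).
Hypothesis V : inv k D A0 M.
Definition R0 := [:: r; r1; h; r3; al].
Definition C0 := [:: c; c1; c2; g; al2].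
Hypothesis E1 : ext P A0 A0 [::] A1 [::] [::] R0 C0 10.
Hypothesis L1 : aS A1 = aS A0.
Hypotheses (ch : core h) (cr3 : core r3) (cal : core al) (cc2 : core c2) (cg : core g)
  (cal2 : core al2).
Hypothesis hle : thr 14 (e_load A0 h r3 al c2 g al2).

Definition sE : seq (nat * I) :=
  [:: (33, al2); (32, al); (31, r3); (30, f); (29, g); (28, h); (27, c2); (26, e);
      (25, r1); (24, c1); (23, a); (22, b); (21, c); (20, r)].

Variables (act1 act2 : bool) (kap : nat) (vk : I).
Hypotheses (hkap : (kap, vk) = (23, a) \/ (kap, vk) = (30, f)) (nke : vk != e)
  (nkf : act2 -> vk != f) (nalh : act1 -> al != h) (nal2g : act2 -> al2 != g).

Definition okc A (x : I * I) : bool := aB A x.1 x.2 && (P x.1 x.2 != Some (L A0 x.1 x.2)).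

Definition opt T (act : bool) (l : seq T) := if act then l else [::].

Record dpost A3 pr3 d rho be be2 q1 z11 z12 q2 z21 z22 q3 z31 z32 : Prop := {
  dp_mid : mid A0 A3 pr3;
  dp_log : size (aLog A3) <= 61;
  dp_B : forall i j, aB A1 i j -> aB A3 i j;
  dp_keep : forall i j, aB A1 i j -> i \in R0 -> j \in C0 -> L A3 i j = L A0 i j;
  dp_rows : uniq ([:: rho] ++ opt act1 [:: be; q1] ++ opt act2 [:: q2] ++ [:: q3]);
  dp_rows0 : all (fun i => i \notin R0)
    ([:: rho] ++ opt act1 [:: be; q1] ++ opt act2 [:: q2] ++ [:: q3]);
  dp_cols : uniq ([:: d] ++ opt act2 [:: be2]);
  dp_cols0 : all (fun j => j \notin C0) ([:: d] ++ opt act2 [:: be2]);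
  dp_ok : all (okc A3) ([:: (rho, d); (rho, g); (h, d); (q3, g); (q3, d)]
    ++ opt act1 [:: (be, d); (be, c2); (al, d); (q1, c2); (q1, d)]
    ++ opt act2 [:: (rho, be2); (rho, al2); (r3, be2); (q2, be2); (q2, al2)]);
  dp_new : [/\ L A3 rho d = vk, L A3 h d = z31, L A3 q3 g = z31, L A3 rho g = z32
    & L A3 q3 d = z32];
  dp_new1 : act1 -> [/\ L A3 be d = e, L A3 al d = z11, L A3 q1 c2 = z11,
    L A3 be c2 = z12 & L A3 q1 d = z12];
  dp_new2 : act2 -> [/\ L A3 rho be2 = f, L A3 rho al2 = z21, L A3 q2 be2 = z21,
    L A3 r3 be2 = z22 & L A3 q2 al2 = z22]
}.

Lemma d_count x l u v : l <= x -> 9 * p + 32 + x + mLd < n -> u <= 5 -> v <= 5 ->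
  9 * p + 12 + l + 2 * u + 2 * v + mLd < n.
Proof. by clear; lia. Qed.

Lemma sum12 (F1 F2 F3 F4 G1 G2 G3 G4 G5 G6 : I -> nat) :
  \sum_i F1 i <= M -> \sum_i F2 i <= M -> \sum_i F3 i <= M -> \sum_i F4 i <= M ->
  \sum_i G1 i <= M -> \sum_i G2 i <= M -> \sum_i G3 i <= M -> \sum_i G4 i <= M ->
  \sum_i G5 i <= M -> \sum_i G6 i <= M ->
  \sum_i (2 * F1 i + 2 * F2 i + F3 i + F4 i +
     (G1 i + G2 i + G3 i + G4 i + G5 i + G6 i)) <= 12 * M.
Proof. by rewrite !big_split /= !big1_eq; clear; lia. Qed.

(** Each term of the load is evaluated along an injective function of d, so its sum is that of the
    whole load, at most M; counted with multiplicity there are twelve terms. *)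
Lemma d_load_sum A pr : mid A0 A pr ->
  \sum_d d_load A e f vk h g al c2 al2 r3 d <= 12 * M.
Proof.
move=> m; rewrite /d_load (mid_rl m) (mid_cl m) (mid_sl m).
have irho : injective (fun d => Rw A d vk) by exact: (R_injs m).
have ibe : injective (fun d => Rw A d e) by exact: (R_injs m).
have ibe2 : injective (fun d => C A (Rw A d vk) f) by exact: (inj_comp (C_injs m (s := f)) irho).
have rowi i : injective (L A i) by exact: (row_inj m).
have coli j : injective (L A ^~ j) by exact: (col_inj m).
have rs (F : I -> I) : \sum_i aRL A0 i <= M -> injective F -> \sum_i aRL A0 (F i) <= M.
  by move=> hs iF; rewrite (sum_inj_le (aRL A0) iF).
have cs (F : I -> I) : \sum_i aCL A0 i <= M -> injective F -> \sum_i aCL A0 (F i) <= M.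
  by move=> hs iF; rewrite (sum_inj_le (aCL A0) iF).
have ss (F : I -> I) : \sum_i aSL A0 i <= M -> injective F -> \sum_i aSL A0 (F i) <= M.
  by move=> hs iF; rewrite (sum_inj_le (aSL A0) iF).
apply: sum12.
- exact: inv_cs V.
- exact: rs (inv_rs V) irho.
- exact: rs (inv_rs V) ibe.
- exact: cs (inv_cs V) ibe2.
- exact: ss (inv_ss V) (rowi h).
- exact: ss (inv_ss V) (inj_comp (coli g) irho).
- exact: ss (inv_ss V) (rowi al).
- exact: ss (inv_ss V) (inj_comp (coli c2) ibe).
- exact: ss (inv_ss V) (inj_comp (coli al2) irho).
- exact: ss (inv_ss V) (inj_comp (rowi r3) ibe2).
Qed.

(* The hypotheses of [awp_EQ] which do not concern the program variables. *)
Record eqpre A (pr : seq (I * I * I * I)) (rs cs : seq I) (i u v j : I) (ld : nat) : Prop := {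
  ep_cores : [/\ core i, core j, core u & core v];
  ep_ne : i != j /\ u != v;
  ep_F : [/\ aFR A i, aFR A j, aFC A u & aFC A v];
  ep_1 : [/\ L A i v = D i v, (i, v) \notin bases pr & okc A (i, v)];
  ep_2 : [/\ L A j u = D j u, (j, u) \notin bases pr & okc A (j, u)];
  ep_rs : (forall x, aFR A x -> x \in rs) /\ size rs <= 9;
  ep_cs : (forall x, aFC A x -> x \in cs) /\ size cs <= 7;
  ep_pr : size pr <= 8;
  ep_ld1 : aCL A0 u + 2 * aCL A0 v + aRL A0 i + aSL A0 (D i v) <= ld;
  ep_ld2 : aRL A0 j + aCL A0 u + aCL A0 v + aSL A0 (D j u) <= ld
}.

Lemma awp_EQopt (act : bool) (al_ u v be q z1 z2 : nat) i vu vv j rs cs x y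
    (Q : ast n -> seq (nat * I) -> Prop) A pr s :
  thr 14 x -> thr 24 y ->
  getd s al_ = i -> getd s u = vu -> getd s v = vv -> getd s be = j ->
  mid A0 A pr -> 20 \in keys s ->
  [&& al_ \in keys s, u \in keys s, v \in keys s & be \in keys s] ->
  all (gtn 78) [:: z2, z1, q & keys s] -> all (leq 20) [:: z2; z1; q] ->
  uniq [:: z2; z1; q] -> [&& z2 \notin keys s, z1 \notin keys s & q \notin keys s] ->
  size (aLog A) < 86 ->
  (act -> eqpre A pr rs cs i vu vv j (x + y)) ->
  (forall A' pr' vq vz1 vz2,
     ext P A0 A pr A' pr' (opt act [:: (i, vv); (vq, vu); (j, vu); (vq, vv)])
       (opt act [:: vq]) (opt act [:: vu; vv]) 14 ->
     (act -> [/\ ~~ aFR A vq, okc A' (vq, vu) && okc A' (vq, vv) &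
       [/\ L A' i vv = vz1, L A' vq vu = vz1, L A' j vu = vz2 & L A' vq vv = vz2]]) ->
     Q A' [:: (z2, vz2), (z1, vz1), (q, vq) & s]) ->
  awp (if act then EQ al_ u v be q z1 z2 else DUM q z1 z2) Q A s.
Proof.
move=> tx ty gal gu gv gbe m k20 kin h78 h20 un kz sz pre hQ.
have kin' := kin; case/and4P: kin' => kal ku kv kbe.
case: act pre hQ => pre hQ; last first.
  have /and4P[z2_20 z1_20 q20 _] := h20.
  apply: awp_seq; apply: awp_let => //.
  apply: awp_seq; apply: awp_let => //; first by rewrite /= in_cons k20 orbT.
  apply: awp_let => //; first by rewrite /= !in_cons k20 !orbT.
  apply: hQ => //; apply: ext_weak (ext_refl m) _ _ _ _ _ => //.
have {}pre := pre isT.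
have [c1' c2' c3' c4'] := ep_cores pre; have [n1 n2] := ep_ne pre.
have [f1 f2 f3 f4] := ep_F pre; have [d1 d2 /andP[d3 d4]] := ep_1 pre.
have [d5 d6 /andP[d7 d8]] := ep_2 pre; have [a1 a2] := ep_rs pre; have [a3 a4] := ep_cs pre.
apply: (awp_EQ delta dih P_row P_col P_sym st0 idx nN V (fun q' => @hnz x y q' tx ty) hmark_q (hnq tx ty)
   gal gu gv gbe m kin h78 h20 un kz sz c1' c2' c3' c4' n1 n2 f1 f2 f3 f4 d1 d2 d3 d4
   d5 d6 d7 d8 a1 a2 a3 a4 (ep_pr pre) (ep_ld1 pre) (ep_ld2 pre)).
move=> A' pr' vq _ nq e' B1 B2 P1 P2 eq1 eq2; apply: (hQ A' pr' vq _ _ e') => _.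
by split=> //; rewrite /okc /= ?B1 ?B2 ?P1 ?P2.
Qed.

Lemma dbCondDE A d : db A ((34, d) :: sE) (bCondD act1 act2 kap) =
  condD P thr A act1 act2 e f vk h g al c2 al2 r3 d.
Proof.
rewrite /condD /d_load !mulSn !mul0n !addn0 /bCondD.
by case: hkap => -[-> ->]; case: act1; case: act2; rewrite /bTrue ![db _ _ _]/= ?eqxx.
Qed.

Lemma okc_ext A pr A' pr' bs rs cs m x : ext P A0 A pr A' pr' bs rs cs m ->
  okc A x -> okc A' x.
Proof. by move=> e' /andP[b' u']; rewrite /okc (ext_B e' b') u'. Qed.

Ltac neqs := repeat match goal with
  | H : is_true (?x != ?y) |- context[?x == ?y] => rewrite (negbTE H)
  | H : is_true (?x != ?y) |- context[?y == ?x] => rewrite (eq_sym y x) (negbTE H)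
  end; rewrite ?eqxx ?andbF ?orbF //=.

Ltac brks :=
  repeat match goal with
  | H : is_true (_ \notin _) |- _ => move: H
  end; rewrite /R0 /C0 ?inE ?negb_or => *;
  repeat match goal with
  | H : is_true (_ && _) |- _ => case/andP: H => ? ?
  end.

Lemma awp_DST (Q : ast n -> seq (nat * I) -> Prop) :
  (forall A3 pr3 d rho be be2 q1 z11 z12 q2 z21 z22 q3 z31 z32,
     dpost A3 pr3 d rho be be2 q1 z11 z12 q2 z21 z22 q3 z31 z32 ->
     Q A3 [:: (47, z32), (46, z31), (45, q3), (44, z22), (43, z21), (42, q2),
              (41, z12), (40, z11), (39, q1), (37, be2), (36, be), (35, rho), (34, d) & sE]) ->
  awp (DST act1 act2 kap) Q A1 sE.
Proof.
move=> hQ; have m1 := ext_mid E1.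
have F1 w : aFR A1 w = (w \in R0) by rewrite (ext_FR E1) (inv_FR V) orbF.
have G1 w : aFC A1 w = (w \in C0) by rewrite (ext_FC E1) (inv_FC V) orbF.
have sz1 : size (aLog A1) <= 10 by have := ext_log E1; rewrite (inv_log V).
have [l1 l2 l3 l4] := mid_lat m1.
apply: awp_seq; apply: awp_search => //.
- by case: hkap => -[-> _]; case: act1; case: act2.
- have cF : #|[pred w | aFR A1 w]| <= 5.
    by apply: (@subset_card _ (aFR A1) R0) => // w; rewrite F1.
  have cG : #|[pred w | aFC A1 w]| <= 5.
    by apply: (@subset_card _ (aFC A1) C0) => // w; rewrite G1.
  have [|d hd] := @exists_d _ _ _ _ _ dih _ _ P_row P_col P_sym thr _ _ _ _ V m1
      act1 act2 e f vk h g al c2 al2 r3 mLd erefl ch cg cal cc2 cal2 cr3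
      (hmark_d (d_load_sum m1)).
    apply: (d_count _ (hnd hle) cF cG).
    by rewrite /e_load; clear; lia.
  by exists d; rewrite dbCondDE.
move=> d; rewrite dbCondDE => /and5P[nFd nFrho u_rho_d g_h_d /and4P[g_rho_g hc1 hc2 hld]].
set rho := Rw A1 d vk in nFrho u_rho_d g_rho_g hc1 hc2 hld.
set be := Rw A1 d e in hc1 hld.
set be2 := C A1 rho f in hc2 hld.
pose y := d_load A1 e f vk h g al c2 al2 r3 d.
pose x := e_load A0 h r3 al c2 g al2.
have Lrho : L A1 rho d = vk by exact: l3.
have Lbe : L A1 be d = e by exact: l3.
have Lbe2 : L A1 rho be2 = f by exact: l1.
have {}hc1 : act1 -> [/\ ~~ aFR A1 be, unp A1 be d, good A1 al d & good A1 be c2].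
  by move=> h1; move: hc1; rewrite h1 => /and4P[].
have {}hc2 : act2 -> [/\ ~~ aFC A1 be2, unp A1 rho be2, good A1 rho al2 & good A1 r3 be2].
  by move=> h1; move: hc2; rewrite h1 => /and4P[].
have nat1 i j : good A1 i j -> [/\ core i, core j & L A1 i j = D i j] by exact: (good_nat V m1).
have st1 i j : unp A1 i j -> P i j != Some (L A0 i j) by rewrite /unprot L1.
have st2 i j : good A1 i j -> P i j != Some (L A0 i j) by case/andP => _; exact: st1.
have nrho : rho \notin R0 by rewrite -F1.
have nd : d \notin C0 by rewrite -G1.
(* Rows [rho] and [be] hold in column d the symbols [vk] and e, which are distinct. In the same way
   [be2] differs from d because row [rho] holds f and [vk] there. *)
have nrb : act1 -> rho != be.
  by move=> _; apply: contraNneq nke => e'; rewrite -Lrho e' Lbe.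
have nb2d : act2 -> be2 != d.
  by move=> h2; apply: contraNneq (nkf h2) => e'; rewrite -Lrho -e' Lbe2.
pose sD : seq (nat * I) := [:: (37, be2), (36, be), (35, rho), (34, d) & sE].
apply: awp_seq; apply: (@awp_let _ _ _ _ _ _ _ _ _ _ _ _ nN _ _ rho) => //.
- by case: hkap => -[-> _].
- by rewrite /rho; case: hkap => -[-> ->].
apply: awp_seq; apply: (@awp_let _ _ _ _ _ _ _ _ _ _ _ _ nN _ _ be) => //.
apply: awp_seq; apply: (@awp_let _ _ _ _ _ _ _ _ _ _ _ _ nN _ _ be2) => //.
rewrite -/sD; pose lv := [:: (rho, d); (rho, g); (h, d)]
  ++ opt act1 [:: (al, d); (be, c2); (be, d)]
  ++ opt act2 [:: (rho, al2); (r3, be2); (rho, be2)].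
have slv : size lv <= 9 by rewrite /lv; case: act1; case: act2.
apply: awp_seq; apply: awp_RESS.
- by case: act1; case: act2.
- by apply: leq_trans (leq_add sz1 (_ : _ <= 9)) _; rewrite // /lv; case: act1; case: act2.
set lv' := (X in ress A1 X); have {lv'}-> : lv' = lv by rewrite /lv' /lv; case: act1; case: act2.
pose A2 := ress A1 lv; rewrite -/A2.
have e2 := ext_ress lv m1; rewrite -/A2 in e2.
have m2 : mid A0 A2 [::] := ext_mid e2.
have L2 : aS A2 = aS A1 := ress_S A1 lv.
have B2 w : w \in lv -> aB A2 w.1 w.2 by exact: ress_B m1.
have sz2 : size (aLog A2) <= 19.
  by move: (ext_log e2) sz1 slv; rewrite -/A2; clear; lia.
pose R2 := [:: rho, be & R0]; pose C2 := [:: d, be2 & C0].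
have R2P w : aFR A2 w -> w \in R2.
  rewrite (ext_FR e2) F1 => /orP[|h0]; last by apply/or3P/Or33.
  move: w; apply/allP; rewrite /lv.
  by case: act1; case: act2; rewrite /= !inE !eqxx !orbT.
have C2P w : aFC A2 w -> w \in C2.
  rewrite (ext_FC e2) G1 => /orP[|h0]; last by apply/or3P/Or33.
  move: w; apply/allP; rewrite /lv.
  by case: act1; case: act2; rewrite /= !inE !eqxx !orbT.
have F2R w : w \in R0 -> aFR A2 w by move=> h0; rewrite (ext_FR e2) F1 h0 orbT.
have F2C w : w \in C0 -> aFC A2 w by move=> h0; rewrite (ext_FC e2) G1 h0 orbT.
have F2rho : aFR A2 rho by rewrite (ext_FR e2) mem_head.
have F2d : aFC A2 d by rewrite (ext_FC e2) mem_head.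
have F2be : act1 -> aFR A2 be.
  by move=> h1; rewrite (ext_FR e2) /lv h1 /= !inE eqxx !orbT.
have F2be2 : act2 -> aFC A2 be2.
  move=> h2; rewrite (ext_FC e2) /lv h2 /=; case: act1; by rewrite /= !inE eqxx !orbT.
have okB2 i j : (i, j) \in lv -> P i j != Some (L A0 i j) -> okc A2 (i, j).
  by move=> h0 h0'; rewrite /okc (B2 _ h0) h0'.
have inR0 : [/\ r \in R0, r1 \in R0, h \in R0, r3 \in R0 & al \in R0].
  by rewrite !inE !eqxx !orbT.
have inC0 : [/\ c \in C0, c1 \in C0, c2 \in C0, g \in C0 & al2 \in C0].
  by rewrite !inE !eqxx !orbT.
have [R0r R0r1 R0h R0r3 R0al] := inR0; have [C0c C0c1 C0c2 C0g C0al2] := inC0.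
have nR w v : v \notin R0 -> w \in R0 -> (v == w) = false /\ (w == v) = false.
  move=> hv hw; rewrite eq_sym; split; by apply: contraNF hv => /eqP <-.
have nC w v : v \notin C0 -> w \in C0 -> (v == w) = false /\ (w == v) = false.
  move=> hv hw; rewrite eq_sym; split; by apply: contraNF hv => /eqP <-.
have hy : thr 24 y := hld.
have eqL A i j : aS A = aS A1 -> L A i j = L A1 i j by move->.
have yE : y = 2 * aCL A0 d + 2 * aRL A0 rho + aRL A0 be + aCL A0 be2 +
  (aSL A0 (L A1 h d) + aSL A0 (L A1 rho g) + aSL A0 (L A1 al d) + aSL A0 (L A1 be c2)
   + aSL A0 (L A1 rho al2) + aSL A0 (L A1 r3 be2)).
  by rewrite /y /d_load -/rho -/be -/be2 (mid_rl m1) (mid_cl m1) (mid_sl m1).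
have [_ cd Dhd] := nat1 _ _ g_h_d; have [crho _ Drg] := nat1 _ _ g_rho_g.
have nbe : act1 -> be \notin R0 by case/hc1 => h0 _ _ _; rewrite -F1.
have nbe2 : act2 -> be2 \notin C0 by case/hc2 => h0 _ _ _; rewrite -G1.
apply: awp_seq; apply: (@awp_EQopt act1 32 27 34 36 39 40 41 al c2 d be R2 C2 x y _ A2 [::] sD) => //.
  by apply: leq_ltn_trans sz2 _.
  move=> h1; have [n1 n2 n3 n4] := hc1 h1; have [_ _ D1] := nat1 _ _ n3.
  have [cbe _ D2] := nat1 _ _ n4.
  split=> //.
  - by rewrite (nR _ _ (nbe h1) R0al).2 (nC _ _ nd C0c2).2.
  - by split; [exact: F2R|exact: F2be|exact: F2C|exact: F2d].
  - rewrite (eqL A2) // D1; split=> //; apply: okB2; last exact: st2.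
    by rewrite /lv h1 !inE eqxx !orbT.
  - rewrite (eqL A2) // D2; split=> //; apply: okB2; last exact: st2.
    by rewrite /lv h1 !inE eqxx !orbT.
  - by rewrite yE /x /e_load D1; clear; lia.
  - by rewrite yE /x /e_load D2; clear; lia.
move=> A3 pr3 q1 z11 z12 e3 h3.
have m3 := ext_mid e3.
have nq1 w : act1 -> aFR A2 w -> (q1 == w) = false /\ (w == q1) = false.
  move=> h1 fw; have [nf _ _] := h3 h1; rewrite eq_sym; split; by apply: contraNF nf => /eqP <-.
have nb1 i j : (i, j) \in [:: (rho, al2); (r3, be2)] -> act2 ->
    (i, j) \notin opt act1 [:: (al, d); (q1, c2); (be, c2); (q1, d)].
  move=> hij h2; case ha : act1 => //=.
  move: hij; rewrite !inE !xpair_eqE => /orP[]/andP[/eqP-> /eqP->].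
    rewrite (nR _ _ nrho R0al).1 (nq1 _ ha F2rho).2 (negbTE (nrb ha)) //.
  by rewrite (negbTE (nb2d h2)) (nq1 _ ha (F2R _ R0r3)).2 (nR _ _ (nbe ha) R0r3).2 !andbF.
have F3R w : aFR A2 w -> aFR A3 w by move=> h0; rewrite (ext_FR e3) h0 orbT.
have F3C w : aFC A2 w -> aFC A3 w by move=> h0; rewrite (ext_FC e3) h0 orbT.
pose R3 := opt act1 [:: q1] ++ R2.
have sp3 : size pr3 <= 4.
  by apply: leq_trans (ext_size e3) _; case: act1.
have R3P w : aFR A3 w -> w \in R3.
  by rewrite (ext_FR e3) mem_cat => /orP[->//|/R2P->]; rewrite orbT.
have C3P w : aFC A3 w -> w \in C2.
  rewrite (ext_FC e3) => /orP[|/C2P//]; rewrite /opt; case: act1 => //.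
  by rewrite !inE => /orP[]/eqP->; rewrite eqxx ?orbT.
have sz3 : size (aLog A3) <= 33 by move: (ext_log e3) sz2; clear; lia.
apply: awp_seq; apply: (@awp_EQopt act2 35 37 33 31 42 43 44 rho be2 al2 r3 R3 C2 x y _ A3 pr3
   [:: (41, z12), (40, z11), (39, q1) & sD]) => //.
  by apply: leq_ltn_trans sz3 _.
  move=> h2; have [n1 n2 n3 n4] := hc2 h2; have [_ _ D1] := nat1 _ _ n3.
  have [_ cbe2 D2] := nat1 _ _ n4.
  have i1 : (rho, al2) \in lv.
    by rewrite /lv h2; case: act1; rewrite !inE eqxx !orbT.
  have i2 : (r3, be2) \in lv.
    by rewrite /lv h2; case: act1; rewrite !inE eqxx !orbT.
  have nn1 := nb1 _ _ (mem_head _ _) h2.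
  have nn2 : (r3, be2) \notin opt act1 [:: (al, d); (q1, c2); (be, c2); (q1, d)].
    by apply: nb1 => //; rewrite !inE eqxx orbT.
  split=> //.
  - by rewrite (nR _ _ nrho R0r3).1 (nC _ _ (nbe2 h2) C0al2).1.
  - by split; [exact: F3R|by apply: F3R; exact: F2R|by apply: F3C; exact: F2be2|by apply: F3C; exact: F2C].
  - rewrite (ext_frame e3) ?(B2 _ i1) // (eqL A2) // D1; split=> //.
      by apply/negP => /(ext_bases e3); rewrite cats0 (negbTE nn1).
    by apply: (okc_ext e3); apply: okB2 => //; exact: st2.
  - rewrite (ext_frame e3) ?(B2 _ i2) // (eqL A2) // D2; split=> //.
      by apply/negP => /(ext_bases e3); rewrite cats0 (negbTE nn2).
    by apply: (okc_ext e3); apply: okB2 => //; exact: st2.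
  - by split=> //; rewrite /R3; case: act1.
  - by apply: leq_trans sp3 _.
  - by rewrite yE /x /e_load D1; clear; lia.
  - by rewrite yE /x /e_load D2; clear; lia.
move=> A4 pr4 q2 z21 z22 e4 h4.
have m4 := ext_mid e4; have e34 := ext_trans e3 e4.
have nq2 w : act2 -> aFR A3 w -> (q2 == w) = false /\ (w == q2) = false.
  move=> h1 fw; have [nf _ _] := h4 h1; rewrite eq_sym; split; by apply: contraNF nf => /eqP <-.
set bs4 := _ ++ _ in e34.
have nb4 i j : (i, j) \in [:: (h, d); (rho, g)] -> (i, j) \notin bs4.
  move=> hij; rewrite /bs4 mem_cat negb_or; apply/andP; split.
    case ha : act1 => //=; move: hij; rewrite !inE !xpair_eqE => /orP[]/andP[/eqP-> /eqP->].
      rewrite eq_sym (negbTE (nalh ha)) (nq1 _ ha (F2R _ R0h)).2 (nR _ _ (nbe ha) R0h).2 //.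
    by rewrite (nR _ _ nrho R0al).1 (nq1 _ ha F2rho).2 (negbTE (nrb ha)).
  case ha : act2 => //=; move: hij; rewrite !inE !xpair_eqE => /orP[]/andP[/eqP-> /eqP->].
    rewrite (nR _ _ nrho R0h).2 (nq2 _ ha (F3R _ (F2R _ R0h))).2.
    by rewrite [d == be2]eq_sym (negbTE (nb2d ha)) !andbF.
  by rewrite [g == al2]eq_sym (negbTE (nal2g ha)) (nq2 _ ha (F3R _ F2rho)).2 (nR _ _ nrho R0r3).1 !andbF.
have F4R w : aFR A2 w -> aFR A4 w by move=> h0; rewrite (ext_FR e4) F3R ?orbT.
have F4C w : aFC A2 w -> aFC A4 w by move=> h0; rewrite (ext_FC e4) F3C ?orbT.
pose R4 := opt act2 [:: q2] ++ R3.
have sp4 : size pr4 <= 8.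
  by apply: leq_trans (ext_size e34) _; rewrite /bs4; case: act1; case: act2.
have R4P w : aFR A4 w -> w \in R4.
  by rewrite (ext_FR e4) mem_cat => /orP[->//|/R3P->]; rewrite orbT.
have C4P w : aFC A4 w -> w \in C2.
  rewrite (ext_FC e4) => /orP[|/C3P//]; rewrite /opt; case: act2 => //.
  by rewrite !inE => /orP[]/eqP->; rewrite eqxx ?orbT.
have sz4 : size (aLog A4) <= 47 by move: (ext_log e4) sz3; clear; lia.
have i1 : (h, d) \in lv by rewrite /lv !inE eqxx !orbT.
have i2 : (rho, g) \in lv by rewrite /lv !inE eqxx !orbT.
have nn1 : (h, d) \notin bs4 by apply: nb4; rewrite mem_head.
have nn2 : (rho, g) \notin bs4 by apply: nb4; rewrite !inE eqxx orbT.
apply: (@awp_EQopt true 28 29 34 35 45 46 47 h g d rho R4 C2 x y _ A4 pr4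
   [:: (44, z22), (43, z21), (42, q2), (41, z12), (40, z11), (39, q1) & sD]) => //.
  by apply: leq_ltn_trans sz4 _.
  move=> _; split=> //.
  - by rewrite (nR _ _ nrho R0h).2 (nC _ _ nd C0g).2.
  - by split; [by apply: F4R; exact: F2R|exact: F4R|by apply: F4C; exact: F2C|exact: F4C].
  - rewrite (ext_frame e34) ?(B2 _ i1) // (eqL A2) // Dhd; split=> //.
      by apply/negP => /(ext_bases e34); rewrite cats0 (negbTE nn1).
    by apply: (okc_ext e34); apply: okB2 => //; exact: st2.
  - rewrite (ext_frame e34) ?(B2 _ i2) // (eqL A2) // Drg; split=> //.
      by apply/negP => /(ext_bases e34); rewrite cats0 (negbTE nn2).
    by apply: (okc_ext e34); apply: okB2 => //; exact: st2.
  - by split=> //; rewrite /R4 /R3; case: act1; case: act2.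
  - by rewrite yE /x /e_load Dhd; clear; lia.
  - by rewrite yE /x /e_load Drg; clear; lia.
move=> A5 pr5 q3 z31 z32 e5 h5'; have {h5'}[nf3 oks3 [eq31 eq32 eq33 eq34]] := h5' isT.
have nq3 w : aFR A4 w -> (q3 == w) = false /\ (w == q3) = false.
  move=> fw; rewrite eq_sym; split; by apply: contraNF nf3 => /eqP <-.
have e25 := ext_trans e34 e5; have e15 := ext_trans e2 e25.
have e45 := ext_trans e4 e5.
have K1 : act1 -> [/\ be \notin R0, rho != be & q1 \notin [:: rho, be & R0]].
  move=> h1; split; [exact: nbe|exact: nrb|].
  rewrite !in_cons (nq1 _ h1 F2rho).1 (nq1 _ h1 (F2be h1)).1 /=.
  by have [nf _ _] := h3 h1; apply: contra nf => /F2R.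
have K2 : act2 -> [/\ be2 \notin C0, be2 != d & q2 \notin rho :: R0].
  move=> h1; split; [exact: nbe2|exact: nb2d|].
  rewrite in_cons (nq2 _ h1 (F3R _ F2rho)).1 /=.
  by have [nf _ _] := h4 h1; apply: contra nf => /F2R/F3R.
have K12 : act1 -> act2 -> (q2 != be) && (q2 != q1).
  move=> h1 h2; rewrite (nq2 _ h2 (F3R _ (F2be h1))).1 (nq2 _ h2 _).1 //.
  by rewrite (ext_FR e3) h1 mem_head.
have K3 : q3 \notin rho :: R0.
  rewrite in_cons (nq3 _ (F4R _ F2rho)).1 /=.
  by apply: contra nf3 => /F2R/F4R.
have K13 : act1 -> (q3 != be) && (q3 != q1).
  move=> h1; rewrite (nq3 _ (F4R _ (F2be h1))).1 (nq3 _ _).1 //.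
  by rewrite (ext_FR e4) (ext_FR e3) h1 mem_head orbT.
have K23 : act2 -> q3 != q2.
  by move=> h1; rewrite (nq3 _ _).1 // (ext_FR e4) h1 mem_head.
have B2A i j : (i, j) \in lv -> aB A2 i j by move/B2.
have keep i j : (i, j) \in lv -> (i, j) \notin bs4 ++ opt true [:: (h, d); (q3, g); (rho, g); (q3, d)] ->
    L A5 i j = L A1 i j.
  by move=> /B2A h0 h0'; rewrite (ext_frame e25) // eqL.
have ok5 i j : (i, j) \in lv -> P i j != Some (L A0 i j) -> okc A5 (i, j).
  by move=> h0 h0'; apply: (okc_ext e25); exact: okB2.
move: nrho nd K3; rewrite {1}/R0 {1}/C0 ![_ \in _ :: R0]in_cons /R0 !inE !negb_or => nrho nd K3.
apply: hQ; split.
- exact: ext_mid e15.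
- by move: (ext_log e5) sz4; clear; lia.
- exact: ext_B e15.
- move=> i j bij iR jC; rewrite (ext_frame e15) // ?L1 //.
  (* Every base cell switched during this stage lies in a new row or in a new column, so none of
     them is among the cells reserved at first. *)
  pose T w := (w.1 \notin R0) || (w.2 \notin C0).
  suff /allP hT : all T ([::] ++ bs4 ++ opt true [:: (h, d); (q3, g); (rho, g); (q3, d)]).
    by apply/negP => /hT; rewrite /T /= iR jC.
  rewrite /bs4 /T; case: (act1) K1; case: (act2) K2 => K2 K1; rewrite /= ?andbT.
  + have [? ? ?] := K1 isT; have [? ? ?] := K2 isT; brks; neqs.
  + have [? ? ?] := K1 isT; brks; neqs.
  + have [? ? ?] := K2 isT; brks; neqs.
  + brks; neqs.
- case: (act1) K1 K12 K13; case: (act2) K2 K23 => K2 K23 K1 K12 K13; rewrite /= ?andbT.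
  + have [? ? ?] := K1 isT; have [? ? ?] := K2 isT; have := K12 isT isT; have := K13 isT; have := K23 isT.
    move=> ? ? ?; brks; neqs.
  + have [? ? ?] := K1 isT; have := K13 isT => ?; brks; neqs.
  + have [? ? ?] := K2 isT; have := K23 isT => ?; brks; neqs.
  + brks; neqs.
- case: (act1) K1 K12 K13; case: (act2) K2 K23 => K2 K23 K1 K12 K13; rewrite /= ?andbT.
  + have [? ? ?] := K1 isT; have [? ? ?] := K2 isT; brks; neqs.
  + have [? ? ?] := K1 isT; brks; neqs.
  + have [? ? ?] := K2 isT; brks; neqs.
  + brks; neqs.
- by case: (act2) K2 => // K2; have [_ h0 _] := K2 isT; rewrite /= inE eq_sym h0.
- case: (act2) K2 => // K2; rewrite /= ?andbT; last by brks; neqs.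
  by have [? ? ?] := K2 isT; brks; neqs.
- have /andP[k1 k2] := oks3.
  rewrite !all_cat; apply/and3P; split.
  + rewrite /= k1 k2 !ok5 //; try exact: st2; try exact: st1;
      by rewrite /lv !inE !eqxx ?orbT.
  + case h1 : act1 => //; have [n1 n2 n3 n4] := hc1 h1; have [_ /andP[k3 k4] _] := h3 h1.
    rewrite /= (okc_ext e45 k3) (okc_ext e45 k4) !ok5 //; try exact: st2; try exact: st1;
      by rewrite /lv h1 !inE !eqxx ?orbT.
  + case h1 : act2 => //; have [n1 n2 n3 n4] := hc2 h1; have [_ /andP[k3 k4] _] := h4 h1.
    rewrite /= (okc_ext e5 k3) (okc_ext e5 k4) !ok5 //; try exact: st2; try exact: st1;
      by rewrite /lv h1; case: (act1); rewrite !inE !eqxx ?orbT.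
- split=> //; rewrite keep //; first by rewrite /lv !inE eqxx.
  rewrite /bs4; case: (act1) K1; case: (act2) K2 => K2 K1; rewrite /= ?inE ?xpair_eqE.
  + have [? ? ?] := K1 isT; have [? ? ?] := K2 isT; brks; neqs.
  + have [? ? ?] := K1 isT; brks; neqs.
  + have [? ? ?] := K2 isT; brks; neqs.
  + brks; neqs.
- move=> h1; have [n1 n2 n3 n4] := hc1 h1; have [nf3' /andP[/andP[k3 _] /andP[k4 _]] [g1 g2 g3 g4]] := h3 h1.
  have [? ? ?] := K1 h1; have /andP[? ?] := K13 h1; have ? := nalh h1.
  have b1 : aB A3 al d by apply: (ext_B e3); apply: B2A; rewrite /lv h1 !inE !eqxx ?orbT.
  have b2 : aB A3 be c2 by apply: (ext_B e3); apply: B2A; rewrite /lv h1 !inE !eqxx ?orbT.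
  rewrite keep; last 2 first.
  + by rewrite /lv h1 !inE !eqxx ?orbT.
  + rewrite /bs4 h1; case h2 : (act2); rewrite /= ?inE ?xpair_eqE.
    * have [? ? ?] := K2 h2; have /andP[? ?] := K12 h1 h2; brks; neqs.
    * brks; neqs.
  rewrite Lbe; rewrite !(ext_frame e45) //; case h2 : (act2);
    rewrite /= ?inE ?xpair_eqE;
    first [have [? ? ?] := K2 h2; have /andP[? ?] := K12 h1 h2; brks; neqs | brks; neqs].
- move=> h2; have [n1 n2 n3 n4] := hc2 h2; have [nf3' /andP[/andP[k3 _] /andP[k4 _]] [g1 g2 g3 g4]] := h4 h2.
  have [? ? ?] := K2 h2; have ? := K23 h2; have ? := nal2g h2.
  have b1 : aB A4 rho al2.
    apply: (ext_B e34); apply: B2A; rewrite /lv h2; case: (act1); by rewrite !inE !eqxx ?orbT.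
  have b2 : aB A4 r3 be2.
    apply: (ext_B e34); apply: B2A; rewrite /lv h2; case: (act1); by rewrite !inE !eqxx ?orbT.
  rewrite keep; last 2 first.
  + by rewrite /lv h2; case: (act1); rewrite !inE !eqxx ?orbT.
  + rewrite /bs4 h2; case h1 : (act1); rewrite /= ?inE ?xpair_eqE.
    * have [? ? ?] := K1 h1; have /andP[? ?] := K12 h1 h2; brks; neqs.
    * brks; neqs.
  rewrite Lbe2; rewrite !(ext_frame e5) // /= ?inE ?xpair_eqE; brks; neqs.
Qed.

End DStage.

(** * The final rewriting of a trade, case by case *)

Section Final.

Variables (n : nat) (P : 'I_n -> 'I_n -> option 'I_n) (A0 : ast n).
Notation I := 'I_n.
Implicit Type A : ast n.
Local Notation L A := (sqL (aS A)).
Local Notation mid := (mid P).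
Local Notation okc := (okc P A0).

Definition finW A (W : seq (I * I * I)) : Prop :=
  [/\ uniq (map (@wcell n) W),
      all (fun w => (w.1.1, L A w.1.1 w.1.2) \in [seq (v.1.1, v.2) | v <- W]) W,
      all (fun w => (w.1.2, L A w.1.1 w.1.2) \in [seq (v.1.2, v.2) | v <- W]) W
    & all (fun w => okc A (w.1.1, w.1.2)) W].

Lemma mid_wrs A pr W : mid A0 A pr -> finW A W -> mid A0 (wrs A W) pr.
Proof.
move=> m [u /allP hr /allP hc /allP ok]; split; try by case: m.
- exact: latin_wr (mid_lat m) u hr hc.
- move=> i j b; have [h1 h2] := mid_free m b; split=> //.
  rewrite /= wr_out //; apply/negP => /mapP[w wW [ei ej]].
  by have /andP[/= b' _] := ok w wW; rewrite -ei -ej (negbTE b) in b'.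
- move=> i j hP; rewrite /= wr_out; first exact: mid_prot m _ _ hP.
  apply/negP => /mapP[w wW [ei ej]].
  by have /andP[_ /=] := ok w wW; rewrite -ei -ej hP eqxx.
Qed.

(* The situation of the cells reserved at the beginning of a trade. *)
Record efacts A (r c b a c1 r1 e c2 h g f r3 al al2 : I) : Prop := {
  ef_L1 : [/\ L A r c = a, L A r c1 = b, L A r1 c = b, L A r c2 = e & L A h c1 = e];
  ef_L2 : [/\ L A h g = b, L A r1 g = f, L A r3 c = f, L A al c2 = a & L A r3 al2 = a];
  ef_sym : [/\ a != b, e != a, e != b, f != a & f != b];
  ef_rows : [/\ [&& r != r1, r != h, r != r3 & r != al], r1 != h, r1 != r3 & r1 != al];
  ef_cols : [/\ [&& c != c1, c != c2, c != g & c != al2], c1 != c2, c1 != g & c1 != al2];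
  ef_ok : all (okc A) [:: (r, c); (r, c1); (r, c2); (h, c1); (h, g); (r1, c); (r1, g);
     (r3, c); (al, c2); (r3, al2)]
}.

(** These writes balance rows r, r1 and columns c, c1. Four defects remain: column c2 has a twice
    and lacks e, row r3 has a twice and lacks f, row h has b twice and lacks e, column g has b twice
    and lacks f. The surplus symbols to remove are at (al, c2), at (r3, al2) and, for both of the
    last two defects, at (h, g). *)
Definition W0 (r c b a c1 r1 e c2 h g f r3 : I) :=
  [:: (r, c, b); (r, c1, e); (r, c2, a); (h, c1, b); (r1, c, f); (r3, c, a); (r1, g, b)].

(** In columns the new symbols change places: the old symbol of (al, u) is replaced by [s2] in
    column u, that of (be, v) by [s1] in column v. A cell can thus be given one symbol in its row
    and another in its column, at the price of the opposite exchange at (be, v). *)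
Definition WE (al u v be q z1 z2 s1 s2 : I) :=
  [:: (al, u, z1); (al, v, s1); (q, u, z2); (q, v, z1); (be, u, s2); (be, v, z2)].

End Final.

Ltac splitall := repeat match goal with
  | H : [/\ _, _ & _] |- _ => case: H => *
  | H : [/\ _, _, _ & _] |- _ => case: H => *
  | H : [/\ _, _, _, _ & _] |- _ => case: H => *
  | H : is_true (all _ (_ :: _)) |- _ => case/andP: H => *
  | H : is_true (all _ [::]) |- _ => clear H
  | H : is_true (_ && _) |- _ => case/andP: H => *
  end.

Ltac rwL := match goal with
  | H : sqL (aS ?A) ?x ?y = _ |- context[sqL (aS ?A) ?x ?y] => rewrite H
  end.

Ltac memt := first [exact: mem_head | (rewrite in_cons; apply/orP; right; memt)].

Ltac nec := first [assumption | rewrite eq_sym; assumption |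
  rewrite xpair_eqE negb_and; apply/orP; first [ left; assumption | right; assumption
        | left; rewrite eq_sym; assumption | right; rewrite eq_sym; assumption]].

Ltac notint := first [ exact: in_nil |
   (rewrite in_cons negb_or; apply/andP; split; [nec | notint]) | by [] ].

Ltac conj := first [assumption | exact: isT | (apply/andP; split; conj) | idtac].

Ltac fint := rewrite /W0 /WE; split; rewrite /wcell /=; conj; first [notint | rwL; memt].

Section Modes.

Variables (n : nat) (P : 'I_n -> 'I_n -> option 'I_n) (A0 : ast n).
Notation I := 'I_n.

(** Here [al = r3], so one cell (r3, c2) carries the surplus a of its row and of its column. It
    should become f in the row and e in the column, and (h, g) conversely; if e = f, or if both
    cells share a row, two writes suffice. *)
Lemma fin_mode0 (A : ast n) (r c b a c1 r1 e c2 h g f r3 al2 : I) :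
  efacts P A0 A r c b a c1 r1 e c2 h g f r3 r3 al2 -> h = r3 \/ e = f ->
  finW P A0 A (W0 r c b a c1 r1 e c2 h g f r3 ++ [:: (r3, c2, e); (h, g, f)]).
Proof.
case=> l1 l2 ns nr nc ok he.
have nd : (g != c2) || (h != r3).
  have [_ _ _ l3 _] := l2; have [l4 _ _ _ _] := l2; have [nab _ _ _ _] := ns.
  rewrite -negb_and; apply: contra nab => /andP[/eqP eg /eqP eh].
  by rewrite -l3 -l4 eg eh.
have nd' : (r3, c2) != (h, g).
  by rewrite xpair_eqE negb_and ![_ == h]eq_sym ![_ == g]eq_sym orbC.
move: l1 l2 ns nr nc ok nd nd'.
by case: he => eh; [case: r3 / eh|case: f / eh] => *; splitall; fint.
Qed.

Lemma efacts_keep (A1 A : ast n) (r c b a c1 r1 e c2 h g f r3 al al2 : I) :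
  efacts P A0 A1 r c b a c1 r1 e c2 h g f r3 al al2 -> aS A1 = aS A0 ->
  (forall i j, aB A1 i j -> aB A i j) ->
  (forall i j, aB A1 i j -> i \in R0 r r1 h r3 al -> j \in C0 c c1 c2 g al2 ->
    sqL (aS A) i j = sqL (aS A0) i j) ->
  efacts P A0 A r c b a c1 r1 e c2 h g f r3 al al2.
Proof.
case=> l1 l2 ns nr nc ok e1 hB keep.
have kp i j x : okc P A0 A1 (i, j) -> i \in R0 r r1 h r3 al -> j \in C0 c c1 c2 g al2 ->
    sqL (aS A1) i j = x -> sqL (aS A) i j = x.
  by move=> /andP[b' _] hi hj <-; rewrite keep // e1.
have ko x : okc P A0 A1 x -> okc P A0 A x.
  by case/andP => b' u; rewrite /okc (hB _ _ b') u.
split=> //; last by apply: sub_all ok.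
- by splitall; split; apply: kp => //; rewrite !inE eqxx ?orbT.
- by splitall; split; apply: kp => //; rewrite !inE eqxx ?orbT.
Qed.

Local Notation dpost := (dpost P A0).

Lemma efacts_dpost (A1 A3 : ast n) (r c b a c1 r1 e c2 h g f r3 al al2 : I) act1 act2 vk pr3
    d rho be be2 q1 z11 z12 q2 z21 z22 q3 z31 z32 :
  efacts P A0 A1 r c b a c1 r1 e c2 h g f r3 al al2 -> aS A1 = aS A0 ->
  dpost A1 r c c1 r1 e c2 h g f r3 al al2 act1 act2 vk A3 pr3
    d rho be be2 q1 z11 z12 q2 z21 z22 q3 z31 z32 ->
  efacts P A0 A3 r c b a c1 r1 e c2 h g f r3 al al2.
Proof.
move=> ef e1 dp; apply: efacts_keep ef e1 (dp_B dp) _ => i j b' hi hj.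
exact: (dp_keep dp).
Qed.

(** Two exchanges through column d: the first one replaces e by f in that column, the second one f
    by e. This is why [rho] is chosen with f at (rho, d). *)
Lemma fin_mode3 (A1 A3 : ast n) (r c b a c1 r1 e c2 h g f r3 al2 : I) pr3
    d rho be be2 q1 z11 z12 q2 z21 z22 q3 z31 z32 :
  efacts P A0 A3 r c b a c1 r1 e c2 h g f r3 r3 al2 ->
  dpost A1 r c c1 r1 e c2 h g f r3 r3 al2 true false f A3 pr3
    d rho be be2 q1 z11 z12 q2 z21 z22 q3 z31 z32 ->
  h != r3 ->
  finW P A0 A3 (W0 r c b a c1 r1 e c2 h g f r3 ++
    WE r3 c2 d be q1 z11 z12 f e ++ WE h g d rho q3 z31 z32 e f).
Proof.
case=> l1 l2 ns nr nc ok dp nhr; have := dp_new1 dp isT; have := dp_new dp.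
have := dp_ok dp; have := dp_cols0 dp; have := dp_rows0 dp; have := dp_rows dp.
rewrite /= /R0 /C0 !inE !negb_or ?andbT => *; splitall; fint.
Qed.

(** The first exchange moves the defect of column c2 to column d, the second one that of row r3 to
    row [rho]. As (rho, d) carries a, the third exchange cancels both of these together with the
    defects of row h and column g. *)
Lemma fin_modeg (A1 A3 : ast n) (r c b a c1 r1 e c2 h g f r3 al al2 : I) pr3
    d rho be be2 q1 z11 z12 q2 z21 z22 q3 z31 z32 :
  efacts P A0 A3 r c b a c1 r1 e c2 h g f r3 al al2 ->
  dpost A1 r c c1 r1 e c2 h g f r3 al al2 true true a A3 pr3
    d rho be be2 q1 z11 z12 q2 z21 z22 q3 z31 z32 ->
  al != r3 -> al != h -> al2 != c2 -> al2 != g ->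
  finW P A0 A3 (W0 r c b a c1 r1 e c2 h g f r3 ++
    WE al c2 d be q1 z11 z12 a e ++ WE rho be2 al2 r3 q2 z21 z22 a f ++ WE h g d rho q3 z31 z32 e f).
Proof.
case=> l1 l2 ns nr nc ok dp ? ? ? ?; have := dp_new dp.
have := dp_new1 dp isT.
have := dp_new2 dp isT.
have := dp_cols dp; have := dp_ok dp; have := dp_cols0 dp; have := dp_rows0 dp; have := dp_rows dp.
rewrite /= /R0 /C0 !inE !negb_or ?andbT => *; splitall; fint.
Qed.

(** Here [al = h]: writing e in (h, c2) repairs column c2 and leaves row h short of a instead of e,
    so the exchange at (h, g) brings a to row h. *)
Lemma fin_modei (A1 A3 : ast n) (r c b a c1 r1 e c2 h g f r3 al2 : I) pr3
    d rho be be2 q1 z11 z12 q2 z21 z22 q3 z31 z32 :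
  efacts P A0 A3 r c b a c1 r1 e c2 h g f r3 h al2 ->
  dpost A1 r c c1 r1 e c2 h g f r3 h al2 false true a A3 pr3
    d rho be be2 q1 z11 z12 q2 z21 z22 q3 z31 z32 ->
  h != r3 -> al2 != c2 -> al2 != g -> c2 != g ->
  finW P A0 A3 (W0 r c b a c1 r1 e c2 h g f r3 ++
    WE rho be2 al2 r3 q2 z21 z22 a f ++ WE h g d rho q3 z31 z32 a f ++ [:: (h, c2, e)]).
Proof.
case=> l1 l2 ns nr nc ok dp ? ? ? ?; have := dp_new dp.
have := dp_new2 dp isT.
have := dp_cols dp; have := dp_ok dp; have := dp_cols0 dp; have := dp_rows0 dp; have := dp_rows dp.
rewrite /= /R0 /C0 !inE !negb_or ?andbT => *; splitall; fint.
Qed.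

(** Symmetrically, [al2 = g]: writing f in (r3, g) repairs row r3 and leaves column g short of a
    instead of f. *)
Lemma fin_modej (A1 A3 : ast n) (r c b a c1 r1 e c2 h g f r3 al : I) pr3
    d rho be be2 q1 z11 z12 q2 z21 z22 q3 z31 z32 :
  efacts P A0 A3 r c b a c1 r1 e c2 h g f r3 al g ->
  dpost A1 r c c1 r1 e c2 h g f r3 al g true false a A3 pr3
    d rho be be2 q1 z11 z12 q2 z21 z22 q3 z31 z32 ->
  al != r3 -> al != h -> h != r3 ->
  finW P A0 A3 (W0 r c b a c1 r1 e c2 h g f r3 ++
    WE al c2 d be q1 z11 z12 a e ++ WE h g d rho q3 z31 z32 e a ++ [:: (r3, g, f)]).
Proof.
case=> l1 l2 ns nr nc ok dp ? ? ?; have := dp_new dp.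
have := dp_new1 dp isT.
have := dp_cols dp; have := dp_ok dp; have := dp_cols0 dp; have := dp_rows0 dp; have := dp_rows dp.
rewrite /= /R0 /C0 !inE !negb_or ?andbT => *; splitall; fint.
Qed.

Lemma fin_modeij (A1 A3 : ast n) (r c b a c1 r1 e c2 h g f r3 : I) pr3
    d rho be be2 q1 z11 z12 q2 z21 z22 q3 z31 z32 :
  efacts P A0 A3 r c b a c1 r1 e c2 h g f r3 h g ->
  dpost A1 r c c1 r1 e c2 h g f r3 h g false false a A3 pr3
    d rho be be2 q1 z11 z12 q2 z21 z22 q3 z31 z32 ->
  h != r3 -> c2 != g ->
  finW P A0 A3 (W0 r c b a c1 r1 e c2 h g f r3 ++
    WE h g d rho q3 z31 z32 a a ++ [:: (h, c2, e); (r3, g, f)]).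
Proof.
case=> l1 l2 ns nr nc ok dp ? ?; have := dp_new dp.
have := dp_cols dp; have := dp_ok dp; have := dp_cols0 dp; have := dp_rows0 dp; have := dp_rows dp.
rewrite /= /R0 /C0 !inE !negb_or ?andbT => *; splitall; fint.
Qed.

End Modes.

Definition WRS (l : seq (nat * nat * nat)) : cprog :=
  foldr (fun w p => CSeq (WR w.1.1 w.1.2 w.2) p) CSkip l.

Definition bAll (l : seq bexp) := foldr BAnd (BEq (IV 20) (IV 20)) l.

(* To put b (variable 22) in cell (r,c) (variables 20, 21) instead of a, the trade
   also rewrites the cells listed in [vW0], where row r now reads b, e, a in columns
   c, c1, c2, row h gets b, row r1 gets f and b, and row r3 gets a.  What remains to
   exchange in rows al, h, r3 is handled by [DST], unless it happens to cancel.
   Variables 23-33 hold a, c1, r1, e, c2, h, g, f, r3, al, al2. *)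
Definition bCondE :=
  let r := IV 20 in let c := IV 21 in let b := IV 22 in let a := IV 23 in
  let c1 := IV 24 in let r1 := IV 25 in let e := IV 26 in
  let c2 := IC r e in let h := IR c1 e in let g := IC h b in
  let f := IL r1 g in let r3 := IR c f in
  let al := IR c2 a in let al2 := IC r3 a in
  bAll [:: BNot (BEq e a); BNot (BEq e b); BNot (BEq h r1); BNot (BEq f a);
    BNot (BEq al r1); BNot (BEq al2 c1);
    BUnp r c2; BUnp h c1; BUnp h g; BUnp r1 g; BUnp r3 c; BUnp al c2;
    BUnp r3 al2; BCore h; BCore r3; BCore al; BCore c2; BCore g; BCore al2;
    BThr 14 (NAdd (NAdd (NAdd (NAdd (NAdd (NRL h) (NRL r3)) (NRL al)) (NCL c2)) (NCL g))
      (NAdd (NCL al2) (NCL al2)))].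

Definition vW0 : seq (nat * nat * nat) :=
  [:: (20, 21, 22); (20, 24, 26); (20, 27, 23); (28, 24, 22); (25, 21, 30);
      (31, 21, 23); (25, 29, 22)].

Definition vWE (al u v be q z1 z2 s1 s2 : nat) : seq (nat * nat * nat) :=
  [:: (al, u, z1); (al, v, s1); (q, u, z2); (q, v, z1); (be, u, s2); (be, v, z2)].

Definition vW1 := vWE 32 27 34 36 39 40 41.
Definition vW2 := vWE 35 37 33 31 42 43 44.
Definition vW3 := vWE 28 29 34 35 45 46 47.

Definition FINISH :=
  IF (BEq (IL (IV 31) (IV 27)) (IV 23))
    (IF (BOr (BEq (IV 28) (IV 31)) (BEq (IV 26) (IV 30)))
       (WRS (vW0 ++ [:: (31, 27, 26); (28, 29, 30)]))
       (CSeq (DST true false 30) (WRS (vW0 ++ vW1 30 26 ++ vW3 26 30))))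
    (IF (BEq (IL (IV 28) (IV 27)) (IV 23))
       (IF (BEq (IL (IV 31) (IV 29)) (IV 23))
          (CSeq (DST false false 23) (WRS (vW0 ++ vW3 23 23 ++ [:: (28, 27, 26); (31, 29, 30)])))
          (CSeq (DST false true 23) (WRS (vW0 ++ vW2 23 30 ++ vW3 23 30 ++ [:: (28, 27, 26)]))))
       (IF (BEq (IL (IV 31) (IV 29)) (IV 23))
          (CSeq (DST true false 23) (WRS (vW0 ++ vW1 23 26 ++ vW3 26 23 ++ [:: (31, 29, 30)])))
          (CSeq (DST true true 23) (WRS (vW0 ++ vW1 23 26 ++ vW2 23 30 ++ vW3 26 30))))).

Definition TRADE :=
  CSeq (LET 23 (IL (IV 20) (IV 21))) (CSeq (LET 24 (IC (IV 20) (IV 22)))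
  (CSeq (LET 25 (IR (IV 21) (IV 22))) (CSeq (FIND 26 bCondE)
  (CSeq (LET 27 (IC (IV 20) (IV 26))) (CSeq (LET 28 (IR (IV 24) (IV 26)))
  (CSeq (LET 29 (IC (IV 28) (IV 22))) (CSeq (LET 30 (IL (IV 25) (IV 29)))
  (CSeq (LET 31 (IR (IV 21) (IV 30))) (CSeq (LET 32 (IR (IV 27) (IV 23)))
  (CSeq (LET 33 (IC (IV 31) (IV 23)))
  (CSeq (RESS [:: (20, 21); (20, 24); (20, 27); (28, 24); (28, 29); (25, 21); (25, 29);
                  (31, 21); (32, 27); (31, 33)]) FINISH))))))))))).

(** * Correctness of a whole trade *)

Section Trade.

Variables (R : realType) (eps delta : R).
Variables (n k : nat) (i0 : 'I_n).
Notation I := 'I_n.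
Variables (D : I -> I -> I) (csym sp : pred I).
Hypothesis dih : dihedral k D csym sp.
Variables (P : I -> I -> option I) (p : nat).
Hypothesis P_row : forall i, #|[pred j | P i j != None]| <= p.
Hypothesis P_col : forall j, #|[pred i | P i j != None]| <= p.
Hypothesis P_sym : forall s, #|[pred c : I * I | P c.1 c.2 == Some s]| <= p.
Hypothesis P_r : forall i j j' s, P i j = Some s -> P i j' = Some s -> j = j'.
Hypothesis P_c : forall i i' j s, P i j = Some s -> P i' j = Some s -> i = i'.
Variables (st0 : state) (M idx N : nat).
Hypothesis nN : n <= N.

Implicit Type A : ast n.
Local Notation core := (core k).
Local Notation par := (par k).
Local Notation L A := (sqL (aS A)).
Local Notation C A := (sqC (aS A)).
Local Notation Rw A := (sqR (aS A)).
Local Notation unp := (unprot P).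
Local Notation good := (pristine P).
Local Notation inter := (switchable P).
Local Notation mid := (mid P).
Local Notation thr := (light eps n M).
Local Notation awp := (awp eps delta k i0 D P st0 M idx N).
Local Notation db := (db eps k i0 P M).
Local Notation getd := (getd i0).

Lemma awp_WRS l (Q : ast n -> seq (nat * I) -> Prop) A s :
  all (fun x => [&& x.1.1 \in keys s, x.1.2 \in keys s & x.2 \in keys s]) l ->
  Q (wrs A [seq (getd s x.1.1, getd s x.1.2, getd s x.2) | x <- l]) s -> awp (WRS l) Q A s.
Proof.
elim: l A => [|[[i j] x] l IH] A /=; first by move=> _ q; apply: awp_skip; case: A q.
case/andP=> /and3P[hi hj hx] hl q; apply: awp_seq; apply: awp_WR => //.
exact: IH.
Qed.

Variables (mLe mLd mLq : nat).
Hypothesis hmark_e : forall f : I -> nat, \sum_q f q <= 7 * M ->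
  #|[pred q | ~~ thr 14 (f q)]| <= mLe.
Hypothesis hmark_d : forall f : I -> nat, \sum_q f q <= 12 * M ->
  #|[pred q | ~~ thr 24 (f q)]| <= mLd.
Hypothesis hmark_q : forall f : I -> nat, \sum_q f q <= 3 * M ->
  #|[pred q | ~~ thr 24 (f q)]| <= mLq.
Hypothesis hne : 7 * p + 12 + mLe < n.
Hypothesis hnd : forall x, thr 14 x -> 9 * p + 32 + x + mLd < n.
Hypothesis hnq : forall x y, thr 14 x -> thr 24 y -> 5 * p + 48 + x + y + mLq < k.
Hypothesis hnz : forall x y q, thr 14 x -> thr 24 y -> thr 24 q ->
  6 * p + 60 + x + y + q < k.

Variable A0 : ast n.
Hypothesis V : inv k D A0 M.

Lemma finish_step (A : ast n) W pr (Q : ast n -> Prop) r c b :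
  mid A0 A pr -> size (aLog A) <= 61 -> finW P A0 A W -> (r, c, b) \in W ->
  (forall A' pr', mid A0 A' pr' -> size (aLog A') <= 61 -> L A' r c = b -> Q A') ->
  Q (wrs A W).
Proof.
move=> m sz f inW h; apply: (h _ pr) => //; first exact: mid_wrs f.
by case: f => u _ _ _; exact: (wr_in (aS A) u inW).
Qed.

Lemma awp_FINISH (A1 : ast n) (r c b a c1 r1 e c2 h g f r3 al al2 : I)
    (Q : ast n -> Prop) :
  efacts P A0 A1 r c b a c1 r1 e c2 h g f r3 al al2 ->
  ext P A0 A0 [::] A1 [::] [::] (R0 r r1 h r3 al) (C0 c c1 c2 g al2) 10 ->
  aS A1 = aS A0 ->
  core h -> core r3 -> core al -> core c2 -> core g -> core al2 ->
  thr 14 (e_load A0 h r3 al c2 g al2) ->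
  (forall A' pr', mid A0 A' pr' -> size (aLog A') <= 61 -> L A' r c = b -> Q A') ->
  awp FINISH (fun A' _ => Q A') A1 (sE r c b a c1 r1 e c2 h g f r3 al al2).
Proof.
move=> ef E1 L1 ch cr3 cal cc2 cg cal2 hl hQ.
have m1 := ext_mid E1; have [l1 l2 l3 l4] := mid_lat m1.
have sz1 : size (aLog A1) <= 61.
  by apply: leq_trans (ext_log E1) _; rewrite (inv_log V).
have [_ _ _ Le Lhc1] := ef_L1 ef; have [Lhg Lr1g Lr3c Lal Lal2] := ef_L2 ef.
have [nab nea neb nfa nfb] := ef_sym ef.
have dst := awp_DST delta i0 dih P_row P_col P_sym st0 idx nN hmark_d hmark_q hnd hnq hnz
  (b := b) (a := a) (e := e) (f := f) V E1 L1 ch cr3 cal cc2 cg cal2 hl.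
have alE : al = Rw A1 c2 a by rewrite -Lal l4.
have al2E : al2 = C A1 r3 a by rewrite -Lal2 l2.
apply: awp_if => //.
  move=> /eqP e1; have {}e1 : L A1 r3 c2 = a := e1.
  have {alE e1} e1 : al = r3 by rewrite alE -e1 l4.
  subst al; apply: awp_if => //.
    move=> he; apply: awp_WRS => //.
    apply: (finish_step m1 sz1 (fin_mode0 ef _) (mem_head _ _) hQ).
    by case/orP: he => /eqP he; [left|right].
  rewrite [db _ _ _]/= negb_or => /andP[nhr nef].
  apply: awp_seq; apply: (dst true false 30 f) => //; try by [right|rewrite eq_sym].
  move=> A3 pr3 d rho be be2 q1 z11 z12 q2 z21 z22 q3 z31 z32 dp.
  apply: awp_WRS => //.
  exact: (finish_step (dp_mid dp) (dp_log dp) (fin_mode3 (efacts_dpost ef L1 dp) dp nhr) (mem_head _ _) hQ).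
move=> /eqP e0; have {}e0 : L A1 r3 c2 <> a := e0.
have nalr3 : al != r3 by apply: contra_notN e0 => /eqP <-.
have nal2c2 : al2 != c2 by apply: contra_notN e0 => /eqP <-.
have nhr_ : L A1 r3 g = a -> h != r3.
  by move=> e2; apply: contraNN nab => /eqP e3; rewrite -e2 -Lhg e3.
have nhr_' : L A1 h c2 = a -> h != r3.
  by move=> e1; apply: contra_notN e0 => /eqP <-.
have ncg : L A1 h c2 = a -> c2 != g.
  by move=> e1; apply: contraNN nab => /eqP e3; rewrite -e1 -Lhg e3.
apply: awp_if => //.
  move=> /eqP e1; have {}e1 : L A1 h c2 = a := e1.
  have {nalr3 alE} alE : al = h by rewrite alE -e1 l4.
  subst al; have nhr := nhr_' e1; have nc2g := ncg e1; apply: awp_if => //.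
    move=> /eqP e2; have {}e2 : L A1 r3 g = a := e2.
    have {al2E} al2E : al2 = g by rewrite al2E -e2 l2.
    subst al2.
    apply: awp_seq; apply: (dst false false 23 a) => //; try by [left|rewrite eq_sym].
    move=> A3 pr3 d rho be be2 q1 z11 z12 q2 z21 z22 q3 z31 z32 dp.
    apply: awp_WRS => //.
    exact: (finish_step (dp_mid dp) (dp_log dp)
      (fin_modeij (efacts_dpost ef L1 dp) dp nhr nc2g) (mem_head _ _) hQ).
  move=> /eqP e2; have {}e2 : L A1 r3 g <> a := e2.
  have nal2g : al2 != g by apply: contra_notN e2 => /eqP <-.
  apply: awp_seq; apply: (dst false true 23 a) => //; try by [left|rewrite eq_sym].
  move=> A3 pr3 d rho be be2 q1 z11 z12 q2 z21 z22 q3 z31 z32 dp.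
  apply: awp_WRS => //.
  exact: (finish_step (dp_mid dp) (dp_log dp)
    (fin_modei (efacts_dpost ef L1 dp) dp nhr nal2c2 nal2g nc2g) (mem_head _ _) hQ).
move=> /eqP e1; have {}e1 : L A1 h c2 <> a := e1.
have nalh : al != h by apply: contra_notN e1 => /eqP <-.
apply: awp_if => //.
  move=> /eqP e2; have {}e2 : L A1 r3 g = a := e2.
  have {al2E} al2E : al2 = g by rewrite al2E -e2 l2.
  subst al2; have nhr := nhr_ e2.
  apply: awp_seq; apply: (dst true false 23 a) => //; try by [left|rewrite eq_sym].
  move=> A3 pr3 d rho be be2 q1 z11 z12 q2 z21 z22 q3 z31 z32 dp.
  apply: awp_WRS => //.
  exact: (finish_step (dp_mid dp) (dp_log dp)
    (fin_modej (efacts_dpost ef L1 dp) dp nalr3 nalh nhr) (mem_head _ _) hQ).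
move=> /eqP e2; have {}e2 : L A1 r3 g <> a := e2.
have nal2g : al2 != g by apply: contra_notN e2 => /eqP <-.
apply: awp_seq; apply: (dst true true 23 a) => //; try by [left|rewrite eq_sym].
move=> A3 pr3 d rho be be2 q1 z11 z12 q2 z21 z22 q3 z31 z32 dp.
apply: awp_WRS => //.
exact: (finish_step (dp_mid dp) (dp_log dp)
  (fin_modeg (efacts_dpost ef L1 dp) dp nalr3 nalh nal2c2 nal2g) (mem_head _ _) hQ).
Qed.

Lemma dbCondEE (r c b a c1 r1 e : I) :
  db A0 [:: (26, e); (25, r1); (24, c1); (23, a); (22, b); (21, c); (20, r)] bCondE =
  condE k P thr A0 a b r c c1 r1 e.
Proof.
by rewrite /condE /e_load !mulSn !mul0n !addn0 /bCondE /bAll ![db _ _ _]/= eqxx andbT.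
Qed.

Lemma sum7 (F1 F2 F3 G1 G2 G3 : I -> nat) :
  \sum_i F1 i <= M -> \sum_i F2 i <= M -> \sum_i F3 i <= M ->
  \sum_i G1 i <= M -> \sum_i G2 i <= M -> \sum_i G3 i <= M ->
  \sum_i (F1 i + F2 i + F3 i + G1 i + G2 i + 2 * G3 i) <= 7 * M.
Proof. by rewrite !big_split /= !big1_eq; clear; lia. Qed.

Lemma awp_TRADE (r c b : I) (Q : ast n -> Prop) :
  P r c = Some b -> L A0 r c != b ->
  (forall A' pr', mid A0 A' pr' -> size (aLog A') <= 61 -> L A' r c = b -> Q A') ->
  awp TRADE (fun A' _ => Q A') A0 [:: (22, b); (21, c); (20, r)].
Proof.
move=> Prc nab hQ; have m0 := start_mid P V; have [l1 l2 l3 l4] := mid_lat m0.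
set a := L A0 r c in nab; set c1 := C A0 r b; set r1 := Rw A0 c b.
do 3! (apply: awp_seq; apply: awp_let => //; rewrite [di _ _ _ _]/=).
rewrite -/a -/c1 -/r1.
apply: awp_seq; apply: awp_search => //.
  have hL : #|[pred e | ~~ thrE thr A0 a b r c c1 r1 e]| <= mLe.
    apply: hmark_e; rewrite /e_load.
    have ih : injective (fun e => Rw A0 c1 e) by exact: (R_inj m0).
    have ig : injective (fun e => C A0 (Rw A0 c1 e) b) by exact: (inj_comp (C_injs m0 (s := b)) ih).
    have if_ : injective (fun e => L A0 r1 (C A0 (Rw A0 c1 e) b)).
      by exact: (inj_comp (row_inj m0 (i := r1)) ig).
    have ir3 : injective (fun e => Rw A0 c (L A0 r1 (C A0 (Rw A0 c1 e) b))).
      by exact: (inj_comp (R_inj m0 (j := c)) if_).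
    have ic2 : injective (fun e => C A0 r e) by exact: (C_inj m0).
    have rs (F : I -> I) : injective F -> \sum_i aRL A0 (F i) <= M.
      by move=> iF; rewrite (sum_inj_le (aRL A0) iF); exact: inv_rs V.
    have cs (F : I -> I) : injective F -> \sum_i aCL A0 (F i) <= M.
      by move=> iF; rewrite (sum_inj_le (aCL A0) iF); exact: inv_cs V.
    apply: sum7.
    - exact: rs ih.
    - exact: rs ir3.
    - exact: rs (inj_comp (R_injs m0 (s := a)) ic2).
    - exact: cs ic2.
    - exact: cs ig.
    - exact: cs (inj_comp (C_injs m0 (s := a)) ir3).
  have [e he] := exists_e dih P_row P_col P_sym m0 hL hne.
  by exists e; rewrite dbCondEE.
move=> e; rewrite dbCondEE /condE.
set c2 := C A0 r e; set h := Rw A0 c1 e; set g := C A0 h b; set f := L A0 r1 g.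
set r3 := Rw A0 c f; set al := Rw A0 c2 a; set al2 := C A0 r3 a.
case/and5P=> nea neb nhr1 nfa /and5P[nalr1 nal2c1 u1 u2 /and5P[u3 u4 u5 u6 /and5P[u7 ch cr3 cal /and4P[cc2 cg cal2 hl]]]].
do 7! (apply: awp_seq; apply: awp_let => //; rewrite [di _ _ _ _]/=).
rewrite -/c2 -/h -/g -/f -/r3 -/al -/al2.
have Lrc : L A0 r c = a by [].
have Lrc1 : L A0 r c1 = b by exact: l1.
have Lr1c : L A0 r1 c = b by exact: l3.
have Le : L A0 r c2 = e by exact: l1.
have Lhc1 : L A0 h c1 = e by exact: l3.
have Lhg : L A0 h g = b by exact: l1.
have Lr1g : L A0 r1 g = f by [].
have Lr3c : L A0 r3 c = f by exact: l3.
have Lal : L A0 al c2 = a by exact: l3.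
have Lal2 : L A0 r3 al2 = a by exact: l1.
have ncg : c != g.
  apply: contraNneq nhr1 => e0; apply/eqP; apply: (lat_col (j := c) (mid_lat m0)).
  by rewrite Lr1c [in LHS]e0 Lhg.
have nfb : f != b.
  apply: contraNneq ncg => e0; apply/eqP; apply: (lat_row (i := r1) (mid_lat m0)).
  by rewrite Lr1c -e0.
have rowne i i' j x x' : L A0 i j = x -> L A0 i' j = x' -> x != x' -> i != i'.
  by move=> h1 h2; apply: contraNneq => e0; rewrite -h1 -h2 e0.
have colne i j j' x x' : L A0 i j = x -> L A0 i j' = x' -> x != x' -> j != j'.
  by move=> h1 h2; apply: contraNneq => e0; rewrite -h1 -h2 e0.
have nae : a != e by rewrite eq_sym.
have nbe : b != e by rewrite eq_sym.
have naf : a != f by rewrite eq_sym.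
have nbf : b != f by rewrite eq_sym.
pose lv := [:: (r, c); (r, c1); (r, c2); (h, c1); (h, g); (r1, c); (r1, g); (r3, c); (al, c2); (r3, al2)].
pose A1 := ress A0 lv.
have e1 := ext_ress lv m0; rewrite -/A1 in e1.
have B1 x : x \in lv -> aB A1 x.1 x.2 by exact: ress_B m0.
have ncc1 : c != c1 by apply: (colne _ _ _ _ _ Lrc Lrc1).
have nrr1 : r != r1 by apply: (rowne _ _ _ _ _ Lrc Lr1c).
apply: awp_seq; apply: awp_RESS => //; first by rewrite (inv_log V).
rewrite -[map _ _]/lv -/A1.
apply: (@awp_FINISH A1 r c b a c1 r1 e c2 h g f r3 al al2) => //.
- have okl i j : (i, j) \in lv -> P i j != Some (L A0 i j) -> okc P A0 A1 (i, j).
    by move=> /B1 b' u; rewrite /okc b' u.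
  have LA x y : L A1 x y = L A0 x y by rewrite /A1 ress_S.
  split.
  + by rewrite !LA.
  + by rewrite !LA.
  + by split.
  + split.
    * apply/and4P; split=> //.
      - by apply: (rowne _ _ _ _ _ Lrc1 Lhc1).
      - by apply: (rowne _ _ _ _ _ Lrc Lr3c).
      - by apply: (rowne _ _ _ _ _ Le Lal); rewrite eq_sym.
    * by rewrite eq_sym.
    * by apply: (rowne _ _ _ _ _ Lr1c Lr3c).
    * by rewrite eq_sym.
  + split.
    * apply/and4P; split=> //.
      - by apply: (colne _ _ _ _ _ Lrc Le).
      - by apply: (colne _ _ _ _ _ Lr3c Lal2).
    * by apply: (colne _ _ _ _ _ Lrc1 Le).
    * by apply: (colne _ _ _ _ _ Lhc1 Lhg).
    * by rewrite eq_sym.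
  (* For the cells not covered by the search condition, P itself helps: it prescribes b at (r, c),
     hence at no other cell of row r or of column c. *)
  + have nr : P r c != Some (L A0 r c) by rewrite Prc; apply: contraNneq nab => -[->].
    have n1 : P r c1 != Some (L A0 r c1).
      by rewrite Lrc1; apply: contraNneq ncc1 => /(P_r Prc) ->.
    have n2 : P r1 c != Some (L A0 r1 c).
      by rewrite Lr1c; apply: contraNneq nrr1 => /(P_c Prc) ->.
    rewrite /= !okl //; by rewrite !inE eqxx ?orbT.
- apply: ext_weak e1 _ _ _ _ _ => // x; rewrite /R0 /C0 !inE.
    by repeat case: eqP => //= _.
  by repeat case: eqP => //= _.
Qed.

End Trade.

(** * Charging the cells of a finished trade to the loads *)

Definition INCR a e := CPut a e (Bin Add (Get a e) (Num 1)).

Definition COMMIT :=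
  CSeq (for_ 6 (Var 4)
   (CSeq (CAssign 60 (Get 15 (Var 6))) (CSeq (CAssign 61 (Get 16 (Var 6)))
   (CSeq (INCR 8 (Var 60)) (CSeq (INCR 9 (Var 61))
   (CSeq (INCR 10 (Get 14 (eIx (Var 60) (Var 61))))
   (CSeq (CPut 11 (Var 60) (Num 0)) (CSeq (CPut 12 (Var 61) (Num 0))
         (CPut 13 (Var 60) (Num 0))))))))))
  (CSeq (CAssign 3 (Bin Add (Var 3) (Var 4))) (CAssign 4 (Num 0))).

Section Commit.

Variables (R : realType) (eps delta : R).
Variables (n k : nat) (i0 : 'I_n).
Notation I := 'I_n.
Variables (D : I -> I -> I) (P : I -> I -> option I).
Variables (st0 : state) (idx N : nat).
Hypothesis nN : n <= N.

Implicit Type A : ast n.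
Local Notation core := (core k).
Local Notation L A := (sqL (aS A)).
Local Notation rep M := (rep k i0 D P st0 M idx).
Local Notation wp := (wp eps delta N).
Local Notation eval := (eval eps delta).

Definition cntR (l : seq (I * I)) i := count (fun c => c.1 == i) l.
Definition cntC (l : seq (I * I)) j := count (fun c => c.2 == j) l.
Definition cntS (l : seq (I * I)) x := count (fun c => D c.1 c.2 == x) l.

(** The state when the part [l] of the log has been processed, for use as a loop invariant. Scanning
    the log suffices to clear the flags, since every flagged line contains a logged cell; a full
    scan of n lines is avoided. *)
Definition pcommit A (l : seq (I * I)) (log : seq (I * I)) : ast n :=
  Ast (aS A) (aB A) (fun i => aFR A i && (i \notin map fst l))
      (fun j => aFC A j && (j \notin map snd l)) (fun i => aTR A i && (i \notin map fst l))
      (fun i => aRL A i + cntR l i) (fun j => aCL A j + cntC l j)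
      (fun x => aSL A x + cntS l x) log.

Definition commit A := pcommit A (aLog A) [::].

Lemma pcommit0 A : pcommit A [::] (aLog A) = A.
Proof.
rewrite /pcommit /cntR /cntC /cntS; case: A => /= S B FR FC TR RL CL SL lg.
by congr Ast; apply: functional_extensionality => i; rewrite /= ?andbT ?addn0.
Qed.

Lemma rep_loop M st A s x v : rep M st A s -> 5 < x < 20 -> rep M (set_var st x v) A s.
Proof.
move=> r /andP[x5 x20]; have ne y : y < 6 -> (y == x) = false by move=> h; apply/eqP; lia.
case: (r) => *; split=> //=; rewrite /upd ?ne // => y hy.
have [h1 h2] := rep_env r hy; split=> //.
by case: eqP => // e; move: h1 x20; rewrite e; clear; lia.
Qed.

Lemma wp_incr a e (i v : nat) (Q : state -> Prop) s :
  eval s e = i -> arrs s a i = v -> v < capv (vars s 0) -> Q (set_arr s a i v.+1) ->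
  wp (INCR a e) Q s.
Proof. by move=> ei ev lv q; apply: (wp_put i v.+1) => //=; rewrite ei ev addn1. Qed.

Lemma wp_COMMIT M st A (Q : state -> Prop) :
  rep M st A [::] -> size (aLog A) <= N -> M + size (aLog A) <= capv n ->
  (forall i, aRL A i <= M) -> (forall i, aCL A i <= M) -> (forall i, aSL A i <= M) ->
  (forall st', rep (M + size (aLog A)) st' (commit A) [::] ->
     (forall x, 5 < x < 20 -> x != 6 -> vars st' x = vars st x) -> Q st') ->
  wp COMMIT Q st.
Proof.
move=> r szN cap hR hC hS hQ; set lg := aLog A in szN cap *.
have cap2 x l : x <= M -> l < size lg -> (x + l).+1 <= capv n.
  by move=> h1 h2; move: cap; clear -h1 h2; lia.
pose fr (s : state) := forall x, 5 < x < 20 -> x != 6 -> vars s x = vars st x.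
apply: wp_seq; apply: (@wp_for _ _ _ _ 6 (Var 4) _ 
  (fun l s => [/\ vars s 6 = l, fr s & rep M s (pcommit A (take l lg) lg) [::]]) _ (size lg)) => //.
- by rewrite (rep0 r); move: cap; clear; lia.
- split=> //; last by rewrite take0 pcommit0; apply: rep_loop.
  by move=> x h1 h2; rewrite /= /upd (negbTE h2).
- move=> l s _ [v6 _ rs]; split=> //=; first by rewrite (rep4 rs).
  by rewrite (rep0 rs) (rep0 r).
- move=> l s lm [v6 frs rs]; have c100 : 100 <= capv n := capv100 i0 nN.
  set c := nth (i0, i0) lg l.
  have szt : size (take l lg) <= l by rewrite size_take; case: ifP => // /negbT; rewrite -leqNgt.
  have tk : take l.+1 lg = rcons (take l lg) c by rewrite (take_nth (i0, i0)).
  apply: wp_seq; apply: (wp_assign c.1); rewrite /= ?v6 ?(rep0 rs) ?(ord_cap i0 nN) //.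
    by rewrite (rep_lr rs).
  have r1 := rep_var nN c.1 rs (isT : 20 <= 60).
  apply: wp_seq; apply: (wp_assign c.2).
  + by rewrite /= /upd /= v6 -(rep_lc rs).
  + by rewrite (rep0 r1) (ord_cap i0 nN).
  have r2 := rep_var nN c.2 r1 (isT : 20 <= 61).
  set s2 := set_var _ 61 _ in r2 *.
  have v60 : vars s2 60 = c.1 by [].
  have v61 : vars s2 61 = c.2 by [].
  have v6' : vars s2 6 = l by [].
  have v0 := rep0 r2.
  have bnd (F : I -> nat) (q : pred (I * I)) i : (forall i, F i <= M) ->
      (F i + count q (take l lg)).+1 <= capv n.
    move=> hF; apply: leq_trans (cap2 _ _ (hF i) lm); rewrite ltnS leq_add2l.
    exact: leq_trans (count_size _ _) szt.
  apply: wp_seq; apply: (wp_incr (i := c.1) (v := aRL A c.1 + cntR (take l lg) c.1)).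
  + exact: v60.
  + by rewrite (repRL r2).
  + by rewrite v0 bnd.
  apply: wp_seq; apply: (wp_incr (i := c.2) (v := aCL A c.2 + cntC (take l lg) c.2)).
  + exact: v61.
  + by rewrite -[LHS]/(arrs s2 9 c.2) (repCL r2).
  + by rewrite [vars _ 0]v0 bnd.
  apply: wp_seq; apply: (wp_incr (i := D c.1 c.2) (v := aSL A (D c.1 c.2) + cntS (take l lg) (D c.1 c.2))).
  + by rewrite -[LHS]/(arrs s2 14 (vars s2 60 * vars s2 0 + vars s2 61)) v60 v61 v0 -/(ix _ _) (repD r2).
  + by rewrite -[LHS]/(arrs s2 10 (D c.1 c.2)) (repSL r2).
  + by rewrite [vars _ 0]v0 bnd.
  apply: wp_seq; apply: (wp_put c.1 0) => //.
  apply: wp_seq; apply: (wp_put c.2 0) => //.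
  apply: (wp_put c.1 0) => //.
  split; first by rewrite -v6.
  split; first by rewrite v0 (rep0 r).
  split.
  + by [].
  + by move=> x h1 h2; rewrite /= /upd (negbTE h2) -(frs x h1 h2); case/andP: h1 => h3 h4;
       do 2! (case: eqP => [e|_]; first by rewrite e in h4).
  + apply: rep_loop => //; rewrite tk.
    have ev (i j : I) : (val i == val j) = (j == i) by rewrite eq_sym.
    have flag (F : I -> bool) (i d : I) (t : seq I) :
        (if val i == val d then 0 else (F i && (i \notin t) : nat)) =
        F i && (i \notin rcons t d).
      by rewrite mem_rcons inE ev eq_sym; case: eqP => //=; rewrite andbF.
    case: (r2) => *; split=> //.
    * by move=> x x3; rewrite -(rep_in r2 x3) /= /upd; do 6! (case: eqP => [ex|_]; first by move: x3; rewrite ex).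
    * move=> i; rewrite /= ?map_rcons -[LHS]/(if val i == val c.1 then (aRL A c.1 + cntR (take l lg) c.1).+1 else arrs s2 8 i).
      rewrite /cntR -cats1 count_cat /= addn0 ev; case: eqP => [->|_]; last by rewrite addn0; exact: (repRL r2 i).
      by rewrite addn1 addnS.
    * move=> i; rewrite /= ?map_rcons -[LHS]/(if val i == val c.2 then (aCL A c.2 + cntC (take l lg) c.2).+1 else arrs s2 9 i).
      rewrite /cntC -cats1 count_cat /= addn0 ev; case: eqP => [->|_]; last by rewrite addn0; exact: (repCL r2 i).
      by rewrite addn1 addnS.
    * move=> i; rewrite /= ?map_rcons -[LHS]/(if val i == val (D c.1 c.2) then (aSL A (D c.1 c.2) + cntS (take l lg) (D c.1 c.2)).+1 else arrs s2 10 i).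
      rewrite /cntS -cats1 count_cat /= addn0 ev; case: eqP => [->|_]; last by rewrite addn0; exact: (repSL r2 i).
      by rewrite addn1 addnS.
    * move=> i; rewrite /= ?map_rcons -flag -[LHS]/(if val i == val c.1 then 0 else arrs s2 11 i); case: ifP => // _; exact: (repFR r2 i).
    * move=> i; rewrite /= ?map_rcons -flag -[LHS]/(if val i == val c.2 then 0 else arrs s2 12 i); case: ifP => // _; exact: (repFC r2 i).
    * move=> i; rewrite /= ?map_rcons -flag -[LHS]/(if val i == val c.1 then 0 else arrs s2 13 i); case: ifP => // _; exact: (repTR r2 i).
- move=> s [v6 frs rs]; rewrite take_size in rs.
  apply: wp_seq; apply: (wp_assign (M + size lg)); rewrite /= ?(rep3 rs) ?(rep4 rs) ?(rep0 rs) //.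
  apply: (wp_assign 0) => //; apply: hQ.
    case: rs => *; split=> //.
  by move=> x h1 h2; rewrite /= /upd -(frs x h1 h2); case/andP: h1 => h3 h4;
       do 2! (case: eqP => [e|_]; first by rewrite e in h3).
Qed.

Lemma sum_count (T : Type) (f : T -> I) (l : seq T) :
  \sum_i count (fun c => f c == i) l = size l.
Proof.
elim: l => [|c l IH] /=; first by rewrite big1.
rewrite big_split /= IH (bigD1 (f c)) //= eqxx big1 // => i ne.
by rewrite eq_sym (negbTE ne).
Qed.

Lemma inv_commit M A : latin (aS A) ->
  (forall i j, ~~ aB A i j -> [/\ core i, core j & L A i j = D i j]) ->
  (forall i, core i -> #|[pred j | core j && aB A i j]| <= aRL A i + cntR (aLog A) i + 1) ->
  (forall j, core j -> #|[pred i | core i && aB A i j]| <= aCL A j + cntC (aLog A) j + 1) ->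
  (forall x, #|[pred c : I * I | [&& core c.1, core c.2, D c.1 c.2 == x & aB A c.1 c.2]]|
     <= aSL A x + cntS (aLog A) x + 1) ->
  \sum_i aRL A i <= M -> \sum_i aCL A i <= M -> \sum_i aSL A i <= M ->
  (forall i, aFR A i || aTR A i -> i \in map fst (aLog A)) ->
  (forall j, aFC A j -> j \in map snd (aLog A)) ->
  inv k D (commit A) (M + size (aLog A)).
Proof.
move=> hlat hnat hr hc hs sr sc ss fr fc; split=> //=.
- by rewrite big_split leq_add //= sum_count.
- by rewrite big_split leq_add //= sum_count.
- by rewrite big_split leq_add //= sum_count.
- apply: functional_extensionality => i; apply/negP => /andP[f nf].
  by rewrite fr ?f in nf.
- apply: functional_extensionality => i; apply/negP => /andP[f nf].
  by rewrite fc ?f in nf.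
- apply: functional_extensionality => i; apply/negP => /andP[f nf].
  by rewrite fr ?f ?orbT in nf.
Qed.

Lemma card_image_le (T : finType) (q : pred T) (s : seq T) :
  (forall x, q x -> x \in s) -> #|q| <= size s.
Proof.
move=> h; apply: leq_trans (card_size s); apply: subset_leq_card.
by apply/subsetP => x; apply: h.
Qed.

(** Each blocked cell was blocked before the trade or occurs in its log, and a log entry adds one to
    the loads of its row, its column and its original symbol. *)
Lemma mid_commit M A0 A pr : inv k D A0 M -> mid P A0 A pr ->
  inv k D (commit A) (M + size (aLog A)).
Proof.
move=> V m; apply: inv_commit.
- exact: mid_lat m.
- by move=> i j b; have [b0 ->] := mid_free m b; exact: (inv_nat V b0).
- move=> i ci; rewrite (mid_rl m) addnAC.
  apply: (@leq_trans #|[pred j | (core j && aB A0 i j) || ((i, j) \in aLog A)]|).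
    by apply: card_sub_le => j /= /andP[-> /(mid_logB m)[->|->]]; rewrite ?orbT.
  apply: leq_trans (card_predU_le _ _) (leq_add (inv_rl V ci) _).
  rewrite /cntR -size_filter -(size_map snd); apply: card_image_le => j h.
  by apply/mapP; exists (i, j) => //; rewrite mem_filter eqxx.
- move=> j cj; rewrite (mid_cl m) addnAC.
  apply: (@leq_trans #|[pred i | (core i && aB A0 i j) || ((i, j) \in aLog A)]|).
    by apply: card_sub_le => i /= /andP[-> /(mid_logB m)[->|->]]; rewrite ?orbT.
  apply: leq_trans (card_predU_le _ _) (leq_add (inv_cl V cj) _).
  rewrite /cntC -size_filter -(size_map fst); apply: card_image_le => i h.
  by apply/mapP; exists (i, j) => //; rewrite mem_filter eqxx.
- move=> x; rewrite (mid_sl m) addnAC.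
  apply: (@leq_trans #|[pred c : I * I | [&& core c.1, core c.2, D c.1 c.2 == x & aB A0 c.1 c.2]
      || ((D c.1 c.2 == x) && (c \in aLog A))]|).
    apply: card_sub_le => -[i j] /= /and4P[-> -> -> /(mid_logB m)[->|->]];
      by rewrite ?orbT.
  apply: leq_trans (card_predU_le _ _) (leq_add (inv_sl V x) _).
  rewrite /cntS -size_filter; apply: card_image_le => c /= h.
  by rewrite mem_filter.
- by rewrite (mid_rl m); exact: inv_rs V.
- by rewrite (mid_cl m); exact: inv_cs V.
- by rewrite (mid_sl m); exact: inv_ss V.
- exact: mid_logR m.
- exact: mid_logC m.
Qed.

End Commit.

(** * Loops over the listed triples *)

Fixpoint avars (p : cprog) : seq nat :=
  match p with
  | CSkip | CPut _ _ _ => [::]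
  | CAssign x _ => [:: x]
  | CSeq p q | CIf _ p q => avars p ++ avars q
  | CWhile _ p => avars p
  end.

Definition STEP p :=
  CIf (eLt (Var 5) (Var 1)) (CSeq p (CAssign 5 (Bin Add (Var 5) (Num 1)))) CSkip.

(* Runs [p] with variable 5 ranging over the listed triples; the two nested
   loops keep every loop bound below n. *)
Definition FORSQ p := for_ 7 (Var 0) (for_ 8 (Var 0) (STEP p)).

Section Loops.

Variables (R : realType) (eps delta : R) (n N : nat).
Hypothesis nN : n <= N.
Local Notation wp := (wp eps delta N).

Lemma run_frame p st st' t x : run eps delta p st st' t -> x \notin avars p ->
  vars st' x = vars st x.
Proof.
move=> H; elim: H => {p st st' t} //=.
- by move=> y e st; rewrite inE /upd => /negbTE->.
- by move=> p q st st1 st2 t1 t2 _ IH1 _ IH2; rewrite mem_cat negb_or => /andP[/IH1 <- /IH2].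
- by move=> e p q st st' t _ _ IH; rewrite mem_cat negb_or => /andP[/IH].
- by move=> e p q st st' t _ _ IH; rewrite mem_cat negb_or => /andP[_ /IH].
- by move=> e p st st1 st2 t1 t2 _ _ IH1 _ IH2 h; rewrite IH2 // IH1.
Qed.

Lemma wp_frame p (Q : state -> Prop) st : wp p Q st ->
  wp p (fun s' => Q s' /\ forall x, x \notin avars p -> vars s' x = vars st x) st.
Proof.
case=> st' [t [r ht q]]; exists st', t; split=> //; split=> // x hx.
exact: run_frame r hx.
Qed.

Lemma wp_FORSQ p (J : nat -> state -> Prop) (Q : state -> Prop) F st :
  0 < n -> vars st 0 = n -> vars st 1 = F -> vars st 5 = 0 -> F <= n * n ->
  ~~ has (mem (avars p)) [:: 0; 1; 5; 7; 8] ->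
  (forall l s x v, (x == 7) || (x == 8) -> J l s -> J l (set_var s x v)) ->
  (forall l s, l < F -> vars s 5 = l -> J l s -> wp p (fun s' => J l.+1 (set_var s' 5 l.+1)) s) ->
  J 0 st ->
  (forall s, vars s 0 = n -> vars s 1 = F -> vars s 5 = F -> J F s -> Q s) ->
  wp (FORSQ p) Q st.
Proof.
move=> n0 v0 v1 v5 Fn; rewrite /= !negb_or => /and5P[a0 a1 a5 a7 /andP[a8 _]] J78 step J0 fin.
have capn : n <= capv n by rewrite /capv; clear -n0; nia.
have F1 : F < capv n by rewrite /capv; clear -n0 Fn; nia.
pose V (s : state) := vars s 0 = n /\ vars s 1 = F.
(* The loops run n^2 times, while the index in variable 5 stops at F; hence the minimum. *)
apply: (@wp_for _ _ _ _ 7 (Var 0) _ (fun i s => [/\ V s, vars s 7 = i,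
   vars s 5 = minn (i * n) F & J (minn (i * n) F) s]) _ n) => //.
- by rewrite v0.
- by rewrite mul0n min0n; split=> //; apply: J78.
- by move=> i s _ [[h0 h1] h7 h5 _]; split=> //=; rewrite h0.
- move=> i s ii [[h0 h1] h7 h5 hJ].
  apply: (@wp_for _ _ _ _ 8 (Var 0) _ (fun j s => [/\ V s, vars s 7 = i, vars s 8 = j,
     vars s 5 = minn (i * n + j) F & J (minn (i * n + j) F) s]) _ n) => //.
  + by rewrite h0.
  + by rewrite addn0; split=> //; apply: J78.
  + by move=> j s' _ [[k0 k1] k7 k8 k5 _]; split=> //=; rewrite k0 ?h0.
  + move=> j s' jj [[k0 k1] k7 k8 k5 kJ]; have js : i * n + j.+1 = (i * n + j).+1 by rewrite addnS.
    apply: (wp_if (b := i * n + j < F)).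
    * by rewrite /= k5 k1 addn1 gtn_min ltnn orbF; case: (_ < F).
    * move=> lt; have e1 : minn (i * n + j) F = i * n + j by rewrite /minn lt.
      have e2 : minn (i * n + j.+1) F = (i * n + j).+1.
        by rewrite js; apply/minn_idPl.
      rewrite e1 in k5 kJ.
      apply: wp_seq; apply: wp_mono (wp_frame (step _ _ lt k5 kJ)) _ => s1 [J1 fr].
      apply: (wp_assign (i * n + j).+1).
      - by rewrite /= (fr _ a5) k5 addn1.
      - by rewrite (fr _ a0) k0; apply: leq_trans lt (ltnW F1).
      have w0 : vars s1 0 = n by rewrite fr.
      have w7 : vars s1 7 = i by rewrite fr.
      have w8 : vars s1 8 = j by rewrite fr.
      have w1 : vars s1 1 = F by rewrite fr.
      rewrite h0; split; first by rewrite -w8.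
      split; first by rewrite -w0.
      by rewrite e2; split=> //; apply: J78.
    * rewrite -leqNgt => le; have e1 : minn (i * n + j) F = F by apply/minn_idPr.
      have e2 : minn (i * n + j.+1) F = F by apply/minn_idPr; rewrite js; apply: leqW.
      apply: wp_skip; split=> //; split; first by rewrite k0.
      by rewrite e2; rewrite e1 in k5 kJ; split=> //; apply: J78.
  move=> s' [[k0 k1] k7 k8 k5 kJ]; rewrite v0; split=> //; split=> //.
  have e3 : i * n + n = i.+1 * n by rewrite mulSn addnC.
  by rewrite e3 in k5 kJ; split=> //; apply: J78.
- move=> s [[h0 h1] h7 h5 hJ]; have e : minn (n * n) F = F by apply/minn_idPr.
  by rewrite e in h5 hJ; apply: fin.
Qed.

End Loops.

(** * Loading the triples and installing them one by one *)

Definition LOAD :=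
  CSeq (CAssign 20 (Get 0 (Var 5))) (CSeq (CAssign 21 (Get 1 (Var 5)))
    (CPut 6 (eIx (Var 20) (Var 21)) (Bin Add (Get 2 (Var 5)) (Num 1)))).

Definition BODY :=
  CSeq (CAssign 20 (Get 0 (Var 5))) (CSeq (CAssign 21 (Get 1 (Var 5)))
  (CSeq (CAssign 22 (Get 2 (Var 5)))
    (IF (BEq (IL (IV 20) (IV 21)) (IV 22)) CSkip (CSeq TRADE COMMIT)))).

Section MainLoop.

Variables (R : realType) (eps delta : R).
Variables (n k : nat) (i0 : 'I_n).
Notation I := 'I_n.
Variables (D : I -> I -> I) (csym sp : pred I).
Hypothesis dih : dihedral k D csym sp.
Variables (P : I -> I -> option I) (p : nat).
Hypothesis P_row : forall i, #|[pred j | P i j != None]| <= p.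
Hypothesis P_col : forall j, #|[pred i | P i j != None]| <= p.
Hypothesis P_sym : forall s, #|[pred c : I * I | P c.1 c.2 == Some s]| <= p.
Hypothesis P_r : forall i j j' s, P i j = Some s -> P i j' = Some s -> j = j'.
Hypothesis P_c : forall i i' j s, P i j = Some s -> P i' j = Some s -> i = i'.
Variables (S : seq (I * I * I)) (st0 : state).
Hypothesis S_P : forall i j s, ((i, j, s) \in S) = (P i j == Some s).
Hypothesis st0_1 : vars st0 1 = size S.
Hypothesis st0_in : forall l, l < size S ->
  let c := nth (i0, i0, i0) S l in
  [/\ arrs st0 0 l = c.1.1, arrs st0 1 l = c.1.2 & arrs st0 2 l = c.2].
Variable N : nat.
Hypothesis nN : n <= N.
Hypothesis Sn : size S <= n * n.

Implicit Type A : ast n.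
Local Notation L A := (sqL (aS A)).
Local Notation rep Pl := (rep k i0 D Pl st0).
Local Notation wp := (wp eps delta N).
Local Notation thr := (light eps n).

Record counts (M : nat) : Prop := {
  cn_mL : exists mLe mLd mLq : nat,
    [/\ forall f : I -> nat, \sum_q f q <= 7 * M -> #|[pred q | ~~ thr M 14 (f q)]| <= mLe,
        forall f : I -> nat, \sum_q f q <= 12 * M -> #|[pred q | ~~ thr M 24 (f q)]| <= mLd,
        forall f : I -> nat, \sum_q f q <= 3 * M -> #|[pred q | ~~ thr M 24 (f q)]| <= mLq,
        7 * p + 12 + mLe < n &
        (forall x, thr M 14 x -> 9 * p + 32 + x + mLd < n) /\
        (forall x y, thr M 14 x -> thr M 24 y -> 5 * p + 48 + x + y + mLq < k)];
  cn_z : forall x y q, thr M 14 x -> thr M 24 y -> thr M 24 q -> 6 * p + 60 + x + y + q < k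
}.

Hypothesis hcounts : forall l M, 0 < l -> l < size S -> M <= 61 * (l - 1) + 4 ->
  [/\ counts M, M + 61 <= capv n & 61 <= N].

Lemma rep_idx Pl M idx idx' st A s : rep Pl M idx st A s -> rep Pl M idx' (set_var st 5 idx') A s.
Proof.
move=> r; case: (r) => *; split=> // x hx; have [h1 h2] := rep_env r hx; split=> //.
by rewrite -h2 /= /upd; case: eqP => // e; rewrite e in h1.
Qed.

Lemma rep_nil Pl M idx st A s : rep Pl M idx st A s -> rep Pl M idx st A [::].
Proof. by move=> r; apply: rep_sub r _. Qed.

Lemma S_cell l : l < size S ->
  let c := nth (i0, i0, i0) S l in P c.1.1 c.1.2 = Some c.2.
Proof.
move=> h c; apply/eqP; rewrite -S_P.
by rewrite -[(_, _, _)]/(c.1.1, c.1.2, c.2) -!surjective_pairing mem_nth.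
Qed.

Definition sat A (c : I * I * I) : bool := L A c.1.1 c.1.2 == c.2.

(** The 4 is for the intercalate switched in the initial square, and each triple but the first costs
    at most 61. The first one holds from the start thanks to the relabelling, which [take 1 S]
    records even at l = 0, where the truncated difference leaves the bound 4. *)
Definition Jmain (l : nat) (st : state) : Prop :=
  exists A M, [/\ rep P M l st A [::], inv k D A M, M <= 61 * (l - 1) + 4
    & all (sat A) (take 1 S ++ take l S)].

Lemma body_step l st : l < size S -> Jmain l st ->
  wp BODY (fun st' => Jmain l.+1 (set_var st' 5 l.+1)) st.
Proof.
move=> lS [A [M [r V hM hsat]]]; have [e0 e1 e2] := st0_in lS.
have hP := S_cell lS; set c := nth (i0, i0, i0) S l in e0 e1 e2 hP.
have tk : take l.+1 S = rcons (take l S) c by rewrite (take_nth (i0, i0, i0)).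
have r5 := rep5 r.
apply: wp_seq; apply: (wp_assign c.1.1).
- by rewrite /= r5 (rep_in r).
- by rewrite (rep0 r) (ord_cap _ nN).
have r1 := rep_var nN c.1.1 r (isT : 20 <= 20).
apply: wp_seq; apply: (wp_assign c.1.2).
- by rewrite -[LHS]/(arrs st 1 (vars st 5)) r5 (rep_in r).
- by rewrite (rep0 r1) (ord_cap _ nN).
have r2 := rep_var nN c.1.2 r1 (isT : 20 <= 21).
apply: wp_seq; apply: (wp_assign c.2).
- by rewrite -[LHS]/(arrs st 2 (vars st 5)) r5 (rep_in r).
- by rewrite (rep0 r2) (ord_cap _ nN).
have r3 := rep_var nN c.2 r2 (isT : 20 <= 22).
set st3 := set_var _ 22 _ in r3 *.
apply: (wp_if (b := sat A c)).
- by rewrite (cbE eps delta r3) //= /sat; case: (sqL _ _ _ == _).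
- move=> hc; apply: wp_skip; exists A, M; split=> //.
  + exact: rep_idx (rep_nil r3).
  + by apply: leq_trans hM _; rewrite leq_add2r leq_mul2l leq_sub2r.
  + by rewrite tk -cats1 catA all_cat hsat /= hc.
(* At l = 0 the current triple is the one already satisfied, so no trade takes place. *)
move=> hc; have l0 : 0 < l.
  case: (posnP l) hc => // e; rewrite e take0 cats0 in hsat.
  move: hsat; rewrite (take_nth (i0, i0, i0)) ?take0 /=; last by rewrite -e.
  by rewrite andbT /c e => ->.
have [[[mLe [mLd [mLq [h1 h2 h3 h4 [h5 h6]]]]] h7] cap61 N61] := hcounts l0 lS hM.
apply: wp_seq.
have T := awp_TRADE delta i0 dih P_row P_col P_sym P_r P_c st0 l nN h1 h2 h3 h4 h5 h6 h7 V hP hc.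
have := T (fun A' => exists pr', [/\ mid P A A' pr', size (aLog A') <= 61 & L A' c.1.1 c.1.2 = c.2]).
case=> [A' pr' m sz e|hwp]; first by exists pr'.
apply: wp_mono (hwp st3 r3) _ => st4 [A4 [s4 [r4 [pr4 [m4 sz4 sat4]]]]].
have bnd (F : I -> nat) : \sum_i F i <= M -> forall i, F i <= M.
  by move=> h i; apply: leq_trans h; rewrite (bigD1 i) //= leq_addr.
apply: (@wp_COMMIT _ _ _ _ _ _ _ _ _ _ _ nN _ _ _ _ (rep_nil r4)).
- exact: leq_trans sz4 N61.
- by apply: leq_trans cap61; rewrite leq_add2l.
- by rewrite (mid_rl m4); apply: bnd; exact: inv_rs V.
- by rewrite (mid_cl m4); apply: bnd; exact: inv_cs V.
- by rewrite (mid_sl m4); apply: bnd; exact: inv_ss V.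
move=> st5 r5' _; exists (commit D A4), (M + size (aLog A4)); split.
- exact: rep_idx r5'.
- exact: mid_commit V m4.
- by move: hM sz4 l0; clear; lia.
- rewrite tk -cats1 catA all_cat /=; apply/andP; split; last by rewrite /sat /= sat4 eqxx.
  apply/allP => x hx; have hs := allP hsat x hx.
  have xS : x \in S.
    by move: hx; rewrite mem_cat => /orP[]; apply: mem_take.
  move: hs; rewrite /sat => /eqP hs; apply/eqP => /=; rewrite (mid_prot m4) // hs.
  by apply/eqP; rewrite -S_P -!surjective_pairing.
Qed.

Lemma wp_main (Q : state -> Prop) st : Jmain 0 st -> vars st 5 = 0 ->
  (forall st' A, all (sat A) S -> latin (aS A) ->
     (forall i j : I, arrs st' 3 (i * n + j) = L A i j) -> Q st') ->
  wp (FORSQ BODY) Q st.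
Proof.
move=> J0 v5 hQ; have [A [M [r _ _ _]]] := J0.
apply: (@wp_FORSQ R eps delta n N nN _ Jmain _ (size S)) => //.
- exact: leq_ltn_trans (ltn_ord i0).
- exact: rep0 r.
- by rewrite (rep1 r).
- move=> l s x v hx [A' [M' [r' V' hM' hs']]]; exists A', M'; split=> //.
  by apply: (rep_loop nN) => //; case/orP: hx => /eqP->.
- by move=> l s lS _; exact: body_step.
- move=> s _ _ _ [A' [M' [r' V' _ hs']]]; apply: (hQ _ A').
  + by move: hs'; rewrite all_cat take_size => /andP[].
  + exact: inv_lat V'.
  + by move=> i j; rewrite -(repL r').
Qed.

(** The partial square after l triples have been loaded: it interpolates between the blank square
    and P. *)
Definition Pl (l : nat) (i j : I) : option I :=
  if P i j is Some s then if (i, j, s) \in take l S then Some s else None else None.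

Lemma wp_load A M (Q : state -> Prop) st : uniq S -> rep (fun _ _ => None) M 0 st A [::] ->
  (forall st', rep P M (size S) st' A [::] -> Q st') -> wp (FORSQ LOAD) Q st.
Proof.
move=> uS r hQ.
have capI (i : I) : i.+1 <= capv n.
  by apply: leq_trans (ltn_ord i) _; rewrite /capv; move: (ltn_ord i); clear; nia.
have Pl0 : Pl 0 = fun _ _ => None.
  apply: functional_extensionality => i; apply: functional_extensionality => j.
  by rewrite /Pl take0; case: (P i j).
have PlS : Pl (size S) = P.
  apply: functional_extensionality => i; apply: functional_extensionality => j.
  by rewrite /Pl take_size; case e : (P i j) => [s|] //; rewrite S_P e eqxx.
apply: (@wp_FORSQ R eps delta n N nN _ (fun l s => rep (Pl l) M l s A [::]) _ (size S)) => //.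
- exact: leq_ltn_trans (ltn_ord i0).
- exact: rep0 r.
- by rewrite (rep1 r).
- exact: rep5 r.
- move=> l s x v hx r'; apply: (rep_loop nN v (r' : rep (Pl l) M l s A [::])).
  by case/orP: hx => /eqP->.
- move=> l s lS v5 r'; have [e0 e1 e2] := st0_in lS.
  have hP := S_cell lS; set c := nth (i0, i0, i0) S l in e0 e1 e2 hP.
  have tk : take l.+1 S = rcons (take l S) c by rewrite (take_nth (i0, i0, i0)).
  apply: wp_seq; apply: (wp_assign c.1.1).
  + by rewrite /= v5 (rep_in r').
  + by rewrite (rep0 r') (ord_cap _ nN).
  have r1 := rep_var nN c.1.1 r' (isT : 20 <= 20).
  apply: wp_seq; apply: (wp_assign c.1.2).
  + by rewrite -[LHS]/(arrs s 1 (vars s 5)) v5 (rep_in r').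
  + by rewrite (rep0 r1) (ord_cap _ nN).
  have r2 := rep_var nN c.1.2 r1 (isT : 20 <= 21).
  set s2 := set_var _ 21 _ in r2 *.
  apply: (wp_put (ix c.1.1 c.1.2) c.2.+1).
  + by rewrite -[LHS]/(c.1.1 * vars s 0 + c.1.2) (rep0 r').
  + by rewrite -[LHS]/(arrs s 2 (vars s 5) + 1) v5 (rep_in r') // e2 addn1.
  + by rewrite (rep0 r2).
  apply: rep_idx; apply: (@rep_nil _ _ _ _ _ [:: (21, c.1.2); (20, c.1.1)]).
  case: (r2) => *; split=> //.
  + by move=> a a3; rewrite -(rep_in r2 a3) /= /upd; case: eqP => [ea|_] //; move: a3; rewrite ea.
  + move=> i j; rewrite -[LHS]/(if ix i j == ix c.1.1 c.1.2 then c.2.+1 else arrs s2 6 (ix i j)).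
    rewrite ix_eq /psym /Pl tk; case: andP => [[/eqP-> /eqP->]|ne].
      by rewrite hP mem_rcons -!surjective_pairing mem_head.
    rewrite (repP r2) /psym /Pl; case: (P i j) => // x; rewrite mem_rcons inE.
    by case: eqP => // e; case: ne; rewrite -e !eqxx.
- by rewrite Pl0.
- move=> s _ _ _ r'; apply: hQ.
  by move: (r' : rep (Pl (size S)) M (size S) s A [::]); rewrite PlS.
Qed.

End MainLoop.

Lemma card_range n a b : b <= n -> #|[pred j : 'I_n | a <= j < b]| = b - a.
Proof.
have card_lt c : c <= n -> #|[pred j : 'I_n | j < c]| = c.
  move=> cn; rewrite -sum1_card; have := big_ord_widen n (fun=> 1) cn.
  by move=> /(_ 0 addn) <-; rewrite sum1_card card_ord.
move=> bn; case: (leqP a b) => ab; last first.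
  rewrite eq_card0; first by move: ab; clear; lia.
  move=> j; apply/negP; rewrite inE => /andP[h1 h2].
  by have := leq_trans ab h1; rewrite ltnNge ltnW.
have := cardID [pred j : 'I_n | j < a] [pred j : 'I_n | j < b]; rewrite (card_lt b bn).
have -> : #|[predI [pred j : 'I_n | j < b] & [pred j : 'I_n | j < a]]| = a.
  rewrite -[RHS](card_lt a (leq_trans ab bn)); apply: eq_card => j; rewrite !inE.
  by apply/andP/idP => [[]//|h]; split=> //; lia.
have -> : #|[predD [pred j : 'I_n | j < b] & [pred j : 'I_n | j < a]]| = #|[pred j : 'I_n | a <= j < b]|.
  by apply: eq_card => j; rewrite !inE -leqNgt.
by set X := #|_| in |- * => h; rewrite -h addKn.
Qed.

(** * The initial square and its invariant *)

Section Initial.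

Variables (n : nat).
Hypothesis n40 : 40 <= n.
Variables (i0 : 'I_n).
Notation I := 'I_n.

Definition k0 := n %/ 2.
Definition t0 := k0 %/ 2.
Definition o0 := (2 * k0 < n) && (k0 == 2 * t0 + 1).
Local Notation k := k0.
Local Notation t := t0.
Local Notation o := o0.

Lemma n_half : n = 2 * k \/ n = 2 * k + 1.
Proof. by rewrite /k0; lia. Qed.

Lemma t8 : 8 <= t.
Proof. by rewrite /t0 /k0; lia. Qed.

Lemma kt : 2 * k < n -> k = (if o then 2 * t + 1 else 2 * t).
Proof. by rewrite /o0 /t0 => -> /=; case: eqP => /=; lia. Qed.

Definition Tin j := find (fun i => Tn k t o i == j) (iota 0 (2 * k)).

(* For n odd, the symbols of the transversal are moved to an additional row and an
   additional column, and 2k takes their place. *)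
Definition L0n i j :=
  if 2 * k < n then
    if i < 2 * k then
      if j < 2 * k then (if j == Tn k t o i then 2 * k else En k t o i j)
      else Sn k t o i
    else if j < 2 * k then En k t o (Tin j) j else 2 * k
  else Dn k i j.

Definition B0n i j := (2 * k < n) && ~~ [&& i < 2 * k, j < 2 * k & j != Tn k t o i].

Lemma TinP j : 2 * k < n -> j < 2 * k -> Tin j < 2 * k /\ Tn k t o (Tin j) = j.
Proof.
move=> hn hj; have K := kt hn; have T8 := t8.
pose f (i : 'I_(2 * k)) : 'I_(2 * k) := Ordinal (Tn_lt T8 K (ltn_ord i)).
have fi : injective f.
  by move=> i i' /(congr1 val) /= e; apply: val_inj; apply: (Tn_inj T8 K) e.
have hs : has (fun i => Tn k t o i == j) (iota 0 (2 * k)).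
  apply/hasP; exists (invF fi (Ordinal hj) : nat); first by rewrite mem_iota /= ltn_ord.
  by have := f_invF fi (Ordinal hj) => /(congr1 val) /= ->.
have lt : Tin j < 2 * k by rewrite /Tin -{2}(size_iota 0 (2 * k)) -has_find.
by split=> //; have /eqP := nth_find 0 hs; rewrite nth_iota.
Qed.

Lemma L0n_lt i j : i < n -> j < n -> L0n i j < n.
Proof.
move=> hi hj; rewrite /L0n; case: ifP => hn; last first.
  have e : n = 2 * k by have := n_half; move: hn; clear; lia.
  by rewrite [X in _ < X]e; apply: (Dn_lt t8); rewrite -e.
have K := kt hn; have T8 := t8.
case: ifP => h1; case: ifP => h2 //.
- by case: ifP => // _; apply: ltn_trans (En_lt T8 K h1 h2) hn.
- exact: ltn_trans (Sn_lt T8 K h1) hn.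
- by have [h3 _] := TinP hn h2; apply: ltn_trans (En_lt T8 K h3 h2) hn.
Qed.

Lemma L0n_row i j j' : i < n -> j < n -> j' < n -> L0n i j = L0n i j' -> j = j'.
Proof.
move=> hi hj hj'; rewrite /L0n; case: ifP => hn; last first.
  have e : n = 2 * k by have := n_half; move: hn; clear; lia.
  by apply: (Dn_row t8); rewrite -e.
have K := kt hn; have T8 := t8.
have last x : x < n -> ~~ (x < 2 * k) -> x = 2 * k by have := n_half; move: hn; clear; lia.
have En' a b : a < 2 * k -> b < 2 * k -> En k t o a b != 2 * k.
  by move=> ha hb; rewrite neq_ltn (En_lt T8 K ha hb).
case: ifP => h1.
  have Sn' : Sn k t o i != 2 * k by rewrite neq_ltn (Sn_lt T8 K h1).
  case: (boolP (j < 2 * k)) => h2; case: (boolP (j' < 2 * k)) => h3; last by rewrite (last _ hj h2) (last _ hj' h3).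
  - case: eqP => [->|n1]; case: eqP => [->|n2] //.
    + by move/esym/eqP; rewrite (negbTE (En' _ _ h1 h3)).
    + by move/eqP; rewrite (negbTE (En' _ _ h1 h2)).
    + exact: (En_row T8 K).
  - case: eqP => [->|n1]; first by move/esym/eqP; rewrite (negbTE Sn').
    by move=> e; case: n1; apply: (En_row T8 K h1 h2 (Tn_lt T8 K h1) e).
  - case: eqP => [->|n1]; first by move/eqP; rewrite (negbTE Sn').
    by move=> /esym e; case: n1; apply: (En_row T8 K h1 h3 (Tn_lt T8 K h1) e).
case: (boolP (j < 2 * k)) => h2; case: (boolP (j' < 2 * k)) => h3; last by rewrite (last _ hj h2) (last _ hj' h3).
- have [a1 a2] := TinP hn h2; have [b1 b2] := TinP hn h3.
  rewrite -{2}a2 -{2}b2 => /(Sn_inj T8 K a1 b1) e.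
  by rewrite -a2 e.
- by have [a1 a2] := TinP hn h2; move/eqP; rewrite (negbTE (En' _ _ a1 h2)).
- by have [a1 a2] := TinP hn h3; move/esym/eqP; rewrite (negbTE (En' _ _ a1 h3)).
Qed.

Lemma L0n_col i i' j : i < n -> i' < n -> j < n -> L0n i j = L0n i' j -> i = i'.
Proof.
move=> hi hi' hj; rewrite /L0n; case: ifP => hn; last first.
  have e : n = 2 * k by have := n_half; move: hn; clear; lia.
  by apply: (Dn_col t8); rewrite -e.
have K := kt hn; have T8 := t8.
have last x : x < n -> ~~ (x < 2 * k) -> x = 2 * k by have := n_half; move: hn; clear; lia.
have En' a b : a < 2 * k -> b < 2 * k -> En k t o a b != 2 * k.
  by move=> ha hb; rewrite neq_ltn (En_lt T8 K ha hb).
case: (boolP (j < 2 * k)) => h1; last first.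
  case: (boolP (i < 2 * k)) => h2; case: (boolP (i' < 2 * k)) => h3; last by rewrite (last _ hi h2) (last _ hi' h3).
  - exact: (Sn_inj T8 K).
  - by move/eqP; rewrite (_ : _ == _ = false) //; apply/negbTE; rewrite neq_ltn (Sn_lt T8 K h2).
  - by move/esym/eqP; rewrite (_ : _ == _ = false) //; apply/negbTE; rewrite neq_ltn (Sn_lt T8 K h3).
have [a1 a2] := TinP hn h1.
case: (boolP (i < 2 * k)) => h2; case: (boolP (i' < 2 * k)) => h3; last by rewrite (last _ hi h2) (last _ hi' h3).
- case: eqP => [e1|n1]; case: eqP => [e2|n2].
  + by move=> _; apply: (Tn_inj T8 K) => //; rewrite -e1.
  + by move/esym/eqP; rewrite (negbTE (En' _ _ h3 h1)).
  + by move/eqP; rewrite (negbTE (En' _ _ h2 h1)).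
  + exact: (En_col T8 K).
- case: eqP => [_|n1]; first by move/esym/eqP; rewrite (negbTE (En' _ _ a1 h1)).
  by move/(En_col T8 K h2 a1 h1) => e; case: n1; rewrite e a2.
- case: eqP => [_|n1]; first by move/eqP; rewrite (negbTE (En' _ _ a1 h1)).
  by move/(En_col T8 K a1 h3 h1) => e; case: n1; rewrite -e a2.
Qed.

Lemma Dn_ltn i j : i < n -> j < n -> Dn k i j < n.
Proof.
have := n_half; rewrite /Dn /addk /subk; clear.
by repeat case: ifP => ?; lia.
Qed.

Variables (c0 : I * I * I).

Definition L00 (i j : I) : I := Ordinal (L0n_lt (ltn_ord i) (ltn_ord j)).
Definition D00 (i j : I) : I := Ordinal (Dn_ltn (ltn_ord i) (ltn_ord j)).

(* Relabels the symbols so that the first listed triple is satisfied. *)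
Definition sig : {perm I} := tperm (L00 c0.1.1 c0.1.2) c0.2.

Definition Ls i j := sig (L00 i j).
Definition Ds i j := sig (D00 i j).
Definition csym0 : pred I := fun z => sig z < 2 * k.
Definition sp0 : pred I := fun z => k <= sig z.

Lemma sigK : involutive sig.
Proof. exact: tpermK. Qed.

Lemma dihedral0 : dihedral k Ds csym0 sp0.
Proof.
have T8 := t8; split.
- by have := n_half; clear; lia.
- by have := n_half; clear; lia.
- by move=> i j ci cj; rewrite /csym0 /Ds sigK; apply: (Dn_lt T8).
- move=> i j j' ci cj cj' /perm_inj /(congr1 val) /= e; apply: val_inj.
  exact: (Dn_row T8 ci cj cj' e).
- move=> i i' j ci ci' cj /perm_inj /(congr1 val) /= e; apply: val_inj.
  exact: (Dn_col T8 ci ci' cj e).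
- move=> i j ci cj; rewrite /sp0 /Ds sigK /par; exact: (Dn_par T8 ci cj).
- move=> i i' j j' ci ci' cj cj' np /perm_inj /(congr1 val) /= e.
  congr (sig _); apply: val_inj; exact: (Dn_inter T8 ci ci' cj cj' np e).
- move=> b; have -> : k = (if b then 2 * k else k) - (if b then k else 0).
    by case: b; lia.
  rewrite -(@card_range n); last by have := n_half; clear; case: b; lia.
  rewrite -(card_imset _ (@perm_inj _ sig)); apply: eq_card => z.
  rewrite inE; apply/imsetP/idP => [[y]|h].
    rewrite inE /csym0 /sp0 => /andP[h1 /eqP <-] ->; move: h1; clear.
    by case: (leqP k (sig y)) => h1 h2; rewrite ?h1 ?h2.
  exists (sig z); last by rewrite sigK.
  rewrite inE /csym0 /sp0 sigK; case: b h => /andP[h1 h2]; first by rewrite h1 h2.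
  by rewrite eqbF_neg -ltnNge h2 andbT; apply: leq_trans h2 _; clear; lia.
Qed.

Lemma Ls_row i : injective (Ls i).
Proof.
move=> j j' /perm_inj /(congr1 val) /= e; apply: val_inj.
exact: L0n_row (ltn_ord i) (ltn_ord j) (ltn_ord j') e.
Qed.

Lemma Ls_col j : injective (Ls ^~ j).
Proof.
move=> i i' /perm_inj /(congr1 val) /= e; apply: val_inj.
exact: L0n_col (ltn_ord i) (ltn_ord i') (ltn_ord j) e.
Qed.

Definition sq0 : sq n := Sq Ls (fun i => invF (@Ls_row i)) (fun j => invF (@Ls_col j)).

Lemma latin0 : latin sq0.
Proof.
by apply: latin_intro => [i s|j s] /=; [exact: (f_invF (@Ls_row i))|exact: (f_invF (@Ls_col j))].
Qed.

Definition A00 : ast n :=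
  Ast sq0 (fun i j => B0n i j) (fun=> false) (fun=> false) (fun=> false)
      (fun=> 0) (fun=> 0) (fun=> 0) [::].

Definition toI x : I := insubd i0 x.

Lemma toIE x : x < n -> toI x = x :> nat.
Proof. by move=> h; rewrite /toI val_insubd h. Qed.

Definition marks : seq (I * I) :=
  if o then [:: (toI (sr1 t), toI (sc1 t)); (toI (sr1 t), toI (sc2 k));
                (toI (sr2 k), toI (sc1 t)); (toI (sr2 k), toI (sc2 k))] else [::].

Definition A01 := foldl (fun A c => touch' A c.1 c.2) A00 marks.

Lemma touches A l (B := foldl (fun A c => @touch' n A c.1 c.2) A l) :
  [/\ aS B = aS A, aLog B = aLog A ++ l, aRL B = aRL A, aCL B = aCL A & aSL B = aSL A] /\
  [/\ aFR B = aFR A, aFC B = aFC A, aTR B = aTR A &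
    forall i j, aB B i j = aB A i j || ((i, j) \in l)].
Proof.
rewrite {}/B; elim: l A => [|[x y] l IH] A /=; first by rewrite cats0; split=> //; split=> // i j; rewrite orbF.
have [[-> -> -> -> ->] [-> -> -> hB]] := IH (touch' A x y); split=> /=.
  by rewrite cat_rcons.
split=> // i j; rewrite hB /= /upd2 inE xpair_eqE.
by case: andP => //= _; rewrite ?orbT.
Qed.

Lemma marks_mem (i j : I) : o -> (i == sr1 t :> nat) || (i == sr2 k :> nat) ->
  (j == sc1 t :> nat) || (j == sc2 k :> nat) -> (i, j) \in marks.
Proof.
move=> ho hi hj; rewrite /marks ho !inE !xpair_eqE.
have e (x : I) y : val x == y -> x == toI y.
  by move=> /eqP <-; apply/eqP/val_inj; rewrite /= toIE.
by case/orP: hi => /e ->; case/orP: hj => /e ->; rewrite ?orbT.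
Qed.

Lemma marks_size : size marks = if o then 4 else 0.
Proof. by rewrite /marks; case: ifP. Qed.

Lemma inv0 : inv k Ds (commit Ds A01) (0 + size (aLog A01)).
Proof.
have [[eS eL eR eC eSL] [eF1 eF2 eF3 eB]] := touches A00 marks; rewrite -/A01 in eS eL eR eC eSL eF1 eF2 eF3 eB.
have T8 := t8; have hk := n_half.
have nt (i j : I) : ~~ B0n i j -> (i, j) \notin marks ->
    [/\ core k i, core k j & L00 i j = D00 i j].
  rewrite /B0n negb_and negbK /core => /orP[h|/and3P[h1 h2 h3]] nm.
    have e : n = 2 * k by move: hk h; clear; lia.
    have c (x : I) : x < 2 * k by rewrite -e.
    by split=> //; apply: val_inj; rewrite /= /L0n (negbTE h).
  split=> //; apply: val_inj; rewrite /= /L0n h1 h2 (negbTE h3) /=; case: ifP => // hn.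
  rewrite (En_swap T8 (kt hn)) //; case: ifP => // /andP[ho hj].
  rewrite /swp; case: eqP => [e|n1]; first by case/negP: nm; apply: marks_mem => //; rewrite e eqxx ?orbT.
  by case: eqP => [e|n2] //; case/negP: nm; apply: marks_mem => //; rewrite e eqxx ?orbT.
have bl (i j : I) : core k i -> core k j -> B0n i j -> 2 * k < n /\ val j = Tn k t o i.
  by rewrite /core /B0n => -> -> /= /andP[-> /negbNE/eqP].
have nbl (i j : I) : 2 * k < n -> core k i -> (i, j) \notin marks -> val j = Tn k t o i ->
    D00 i j = Sn k t o i :> nat.
  move=> hn ci nm ej; rewrite /Sn /= -ej.
  rewrite (En_swap T8 (kt hn)) // ?ej ?(Tn_lt T8 (kt hn)) //; case: ifP => // /andP[ho hj].
  rewrite -ej in hj *.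
  rewrite /swp; case: eqP => [e|n1]; first by case/negP: nm; apply: marks_mem => //; rewrite e eqxx ?orbT.
  by case: eqP => [e|n2] //; case/negP: nm; apply: marks_mem => //; rewrite e eqxx ?orbT.
apply: inv_commit.
- by rewrite eS; exact: latin0.
- move=> i j; rewrite eB negb_or => /andP[h1 h2]; have [c1 c2 e] := nt i j h1 h2.
  by split=> //; rewrite eS /= /Ls e.
- move=> i ci; rewrite eR /= add0n addnC.
  apply: (@leq_trans #|[pred j | (core k j && B0n i j) || ((i, j) \in marks)]|).
    by apply: card_sub_le => j /=; rewrite eB /= => /andP[-> /orP[->|->]]; rewrite ?orbT.
  apply: leq_trans (card_predU_le _ _) (leq_add _ _).
    rewrite -(card1 i); apply: (card_inj_le (f := fun=> i)) => [j _|j j' /= /andP[cj b] /andP[cj' b'] _]; first exact: eqxx.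
    by apply: val_inj; have [_ ->] := bl _ _ ci cj b; have [_ ->] := bl _ _ ci cj' b'.
  rewrite eL /cntR -size_filter -(size_map snd); apply: card_image_le => j h.
  by apply/mapP; exists (i, j) => //; rewrite mem_filter eqxx.
- move=> j cj; rewrite eC /= add0n addnC.
  apply: (@leq_trans #|[pred i | (core k i && B0n i j) || ((i, j) \in marks)]|).
    by apply: card_sub_le => i /=; rewrite eB /= => /andP[-> /orP[->|->]]; rewrite ?orbT.
  apply: leq_trans (card_predU_le _ _) (leq_add _ _).
    rewrite -(card1 j); apply: (card_inj_le (f := fun=> j)) => [i _|i i' /= /andP[ci b] /andP[ci' b'] _]; first exact: eqxx.
    apply: val_inj; have [hn e] := bl _ _ ci cj b; have [_ e'] := bl _ _ ci' cj b'.
    by apply: (Tn_inj T8 (kt hn) ci ci'); rewrite -e.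
  rewrite eL /cntC -size_filter -(size_map fst); apply: card_image_le => i h.
  by apply/mapP; exists (i, j) => //; rewrite mem_filter eqxx.
- move=> x; rewrite eSL /= add0n addnC.
  pose q1 (c : I * I) := [&& core k c.1, core k c.2, Ds c.1 c.2 == x, B0n c.1 c.2 & c \notin marks].
  apply: (@leq_trans #|[pred c | q1 c || ((Ds c.1 c.2 == x) && (c \in marks))]|).
    apply: card_sub_le => -[i j] /=; rewrite eB /= /q1 /= => /and4P[-> -> -> h].
    by case: ((i, j) \in marks) h; case: (B0n i j).
  apply: leq_trans (card_predU_le _ _) (leq_add _ _).
    rewrite -(card1 x); apply: (card_inj_le (f := fun=> x)) => [c _|[i j] [i' j'] /=]; first exact: eqxx.
    rewrite /q1 /= => /and5P[ci cj /eqP e b nm] /and5P[ci' cj' /eqP e' b' nm'] _.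
    have [hn ej] := bl _ _ ci cj b; have [_ ej'] := bl _ _ ci' cj' b'.
    have ed : D00 i j = D00 i' j' by apply: (@perm_inj _ sig); rewrite -/(Ds i j) e -e'.
    have ei : i = i'.
      apply: val_inj; apply: (Sn_inj T8 (kt hn) ci ci').
      by rewrite -(nbl i j hn ci nm ej) ed (nbl i' j' hn ci' nm' ej').
    by congr (_, _) => //; apply: val_inj; rewrite ej ej' ei.
  rewrite eL /cntS -size_filter; apply: card_image_le => c /= h.
  by rewrite mem_filter.
- by rewrite eR /= big1.
- by rewrite eC /= big1.
- by rewrite eSL /= big1.
- by move=> i; rewrite eF1 eF3.
- by move=> j; rewrite eF2.
Qed.

Lemma first_sat : Ls c0.1.1 c0.1.2 = c0.2.
Proof. by rewrite /Ls /sig tpermL. Qed.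

End Initial.

(** * The program *)

Definition eIf c a b := Bin Add (Bin Mul (eNz c) a) (Bin Mul (eNot c) b).
Definition eAdd := Bin Add.
Definition eSub := Bin Sub.
Definition eTwo a := Bin Mul (Num 2) a.
Definition eLe := Bin Le.
Definition eEq := Bin Eq.
Definition eOr := Bin Add.
Definition eAnd := Bin Mul.

(* Variables 2, 12 and 13 hold the parameters k, t and o of the initial square. *)
Definition vK := Var 2.
Definition vT := Var 12.
Definition vO := Var 13.

Definition eAddk x := eIf (eLt x vK) x (eSub x vK).
Definition eSubk x y := eIf (eLe y x) (eSub x y) (eSub (eAdd x vK) y).

Definition eDn i j :=
  eIf (eLt i vK)
    (eIf (eLt j vK) (eAddk (eAdd i j)) (eAdd vK (eAddk (eAdd i (eSub j vK)))))
    (eIf (eLt j vK) (eAdd vK (eSubk (eSub i vK) j)) (eSubk (eSub i vK) (eSub j vK))).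

Definition eSr2 := eSub (eTwo vK) (Num 3).
Definition eSc2 := eSub (eTwo vK) (Num 2).
Definition eSwp a b x := eIf (eEq x a) b (eIf (eEq x b) a x).

Definition eEn i j :=
  eIf (eAnd vO (eOr (eEq i vT) (eEq i eSr2))) (eDn i (eSwp vT eSc2 j)) (eDn i j).

Definition eTn_even i :=
  eIf (eLt i vT) i (eIf (eLt i vK) (eAdd vK (eSub i vT))
  (eIf (eLt i (eAdd vK vT)) (eAdd vK (eSub (eSub vK (Num 1)) (eSub i vK)))
    (eSub (eSub vK (Num 1)) (eSub (eSub i vK) vT)))).

Definition eTn_odd i :=
  eIf (eLe i vT) i (eIf (eLt i (eSub (eTwo vT) (Num 1))) (eSub (eAdd (eAdd vK (Num 2)) i) vT)
  (eIf (eLt i (eTwo vT)) (eAdd (eAdd vK vT) (Num 2))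
  (eIf (eLt i vK) (eAdd (eAdd vK vT) (Num 3))
  (eIf (eLe i (eAdd vK (Num 1))) (eSub (eAdd vK (Num 1)) (eSub i vK))
  (eIf (eLt i (eSub (eAdd vK vT) (Num 1))) (eAdd vK (eSub (eAdd vK (Num 1)) (eSub i vK)))
  (eIf (eLt i (eAdd vK vT)) (eAdd (eAdd vK vT) (Num 1))
  (eIf (eLt i (eSub (eAdd vK (eTwo vT)) (Num 1))) (eSub (Bin Mul (Num 3) vT) (eSub i vK))
  (eIf (eLt i (eAdd vK (eTwo vT))) (eAdd vK (Num 2)) (eAdd vT (Num 1)))))))))).

Definition eTn i := eIf vO (eTn_odd i) (eTn_even i).

Definition eSig e := eIf (eEq e (Var 10)) (Var 11) (eIf (eEq e (Var 11)) (Var 10) e).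

(* Stores in variable 62 the initial symbol of the cell (var 7, var 8). *)
Definition CELL :=
  CIf (eLt (eTwo vK) (Var 0))
    (CIf (eLt (Var 7) (eTwo vK))
      (CSeq (CAssign 60 (eTn (Var 7)))
        (CIf (eLt (Var 8) (eTwo vK))
          (CAssign 62 (eIf (eEq (Var 8) (Var 60)) (eTwo vK) (eEn (Var 7) (Var 8))))
          (CAssign 62 (eEn (Var 7) (Var 60)))))
      (CIf (eLt (Var 8) (eTwo vK))
        (CSeq (search 61 (eAnd (eLt (Var 61) (eTwo vK)) (eEq (eTn (Var 61)) (Var 8))))
              (CAssign 62 (eEn (Var 61) (Var 8))))
        (CAssign 62 (eTwo vK))))
    (CAssign 62 (eDn (Var 7) (Var 8))).

Definition FILL :=
  CSeq CELL (CSeq (CAssign 63 (eSig (Var 62)))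
  (CSeq (CAssign 64 (eDn (Var 7) (Var 8))) (CSeq (CAssign 64 (eSig (Var 64)))
  (CSeq (CAssign 65 (eIf (eAnd (eLt (eTwo vK) (Var 0)) (eNot (eAnd (eLt (Var 7) (eTwo vK))
      (eAnd (eLt (Var 8) (eTwo vK)) (eNot (eEq (Var 8) (eTn (Var 7)))))))) (Num 1) (Num 0)))
  (CSeq (CPut 3 (eIx (Var 7) (Var 8)) (Var 63)) (CSeq (CPut 4 (eIx (Var 7) (Var 63)) (Var 8))
  (CSeq (CPut 5 (eIx (Var 8) (Var 63)) (Var 7)) (CSeq (CPut 7 (eIx (Var 7) (Var 8)) (Var 65))
        (CPut 14 (eIx (Var 7) (Var 8)) (Var 64)))))))))).

Definition PREMARK :=
  CIf vO (CSeq (CAssign 20 vT) (CSeq (CAssign 21 vT) (CSeq (CAssign 22 eSr2)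
    (CSeq (CAssign 23 eSc2) (CSeq (LOG 20 21) (CSeq (LOG 20 23) (CSeq (LOG 22 21) (LOG 22 23))))))))
  CSkip.

Definition INIT :=
  CSeq (CAssign 2 (Bin Div (Var 0) (Num 2))) (CSeq (CAssign 12 (Bin Div vK (Num 2)))
  (CSeq (CAssign 13 (eAnd (eLt (eTwo vK) (Var 0)) (eEq vK (eAdd (eTwo vT) (Num 1)))))
  (CSeq (CAssign 7 (Get 0 (Num 0))) (CSeq (CAssign 8 (Get 1 (Num 0))) (CSeq CELL
  (CSeq (CAssign 10 (Var 62)) (CSeq (CAssign 11 (Get 2 (Num 0)))
  (CSeq (for_ 7 (Var 0) (for_ 8 (Var 0) FILL)) (CSeq PREMARK COMMIT))))))))).

Section Exprs.

Variables (R : realType) (eps delta : R) (st : state).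
Local Notation eval := (eval eps delta).
Definition tr e := eval st e != 0.

Lemma tr_bool e (b : bool) : eval st e = b -> tr e = b.
Proof. by rewrite /tr => ->; case: b. Qed.

Lemma eval_if c a b : eval st (eIf c a b) = if tr c then eval st a else eval st b.
Proof.
rewrite -[LHS]/(((eval st c == 0) == 0 :> nat) * eval st a + (eval st c == 0) * eval st b) /tr.
by case: (eval st c == 0); rewrite ?mul1n ?mul0n ?addn0.
Qed.

Lemma tr_lt a b : tr (eLt a b) = (eval st a < eval st b).
Proof. by apply: tr_bool; rewrite /= addn1. Qed.

Lemma tr_le a b : tr (eLe a b) = (eval st a <= eval st b).
Proof. exact: tr_bool. Qed.

Lemma tr_eq a b : tr (eEq a b) = (eval st a == eval st b).
Proof. exact: tr_bool. Qed.

Lemma tr_and a b : tr (eAnd a b) = tr a && tr b.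
Proof. by rewrite /tr /= muln_eq0 negb_or. Qed.

Lemma tr_or a b : tr (eOr a b) = tr a || tr b.
Proof. by rewrite /tr /= addn_eq0 negb_and. Qed.

Lemma tr_not a : tr (eNot a) = ~~ tr a.
Proof. by apply: tr_bool; rewrite /tr negbK. Qed.

Lemma eval_add a b : eval st (eAdd a b) = eval st a + eval st b.
Proof. by []. Qed.

Lemma eval_sub a b : eval st (eSub a b) = eval st a - eval st b.
Proof. by []. Qed.

Lemma eval_mul a b : eval st (Bin Mul a b) = eval st a * eval st b.
Proof. by []. Qed.

Lemma eval_two a : eval st (eTwo a) = 2 * eval st a.
Proof. by []. Qed.

Lemma eval_var x : eval st (Var x) = vars st x.
Proof. by []. Qed.

Lemma eval_num x : eval st (Num x) = x.
Proof. by []. Qed.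

Definition evE := (eval_if, tr_lt, tr_le, tr_eq, tr_and, tr_or, eval_add, eval_sub,
  eval_mul, eval_two, eval_num).

Variables (k t : nat) (o : bool).
Hypotheses (hk : vars st 2 = k) (ht : vars st 12 = t) (ho : vars st 13 = o).

Let evk : eval st vK = k. Proof. exact: hk. Qed.
Let evt : eval st vT = t. Proof. exact: ht. Qed.
Let tro : tr vO = o. Proof. exact: tr_bool. Qed.

Lemma eval_Dn a b : eval st (eDn a b) = Dn k (eval st a) (eval st b).
Proof. by rewrite /eDn /eAddk /eSubk !evE !evk. Qed.

Lemma eval_Swp a b x : eval st (eSwp a b x) = swp (eval st a) (eval st b) (eval st x).
Proof. by rewrite /eSwp !evE. Qed.

Lemma eval_En a b : eval st (eEn a b) = En k t o (eval st a) (eval st b).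
Proof. by rewrite /eEn eval_if !eval_Dn eval_Swp /eSr2 /eSc2 !evE tro evk evt. Qed.

Lemma eval_Tn a : eval st (eTn a) = Tn k t o (eval st a).
Proof. by rewrite /eTn /eTn_odd /eTn_even !evE tro !evk !evt. Qed.

Lemma eval_Sig e : eval st (eSig e) =
  if eval st e == vars st 10 then vars st 11
  else if eval st e == vars st 11 then vars st 10 else eval st e.
Proof. by rewrite /eSig !evE !eval_var. Qed.

End Exprs.

Section Init.

Variables (R : realType) (eps delta : R) (n N : nat).
Hypothesis n40 : 40 <= n.
Hypothesis nN : n <= N.
Local Notation wp := (wp eps delta N).
Local Notation k := (k0 n).
Local Notation t := (t0 n).
Local Notation o := (o0 n).

Definition params st := [/\ vars st 0 = n, vars st 2 = k, vars st 12 = t & vars st 13 = o].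

Lemma lt_capv x : x <= n -> x <= capv n.
Proof. by move: n40; rewrite /capv; clear; nia. Qed.

Lemma wp_CELL (Q : state -> Prop) st : params st -> vars st 7 < n -> vars st 8 < n ->
  (forall st', arrs st' = arrs st -> (forall x, x < 60 -> vars st' x = vars st x) ->
     vars st' 62 = L0n n (vars st 7) (vars st 8) -> Q st') -> wp CELL Q st.
Proof.
case=> v0 v2 v12 v13; set i := vars st 7; set j := vars st 8 => hi hj hQ.
have k2n : 2 * k <= n by have := n_half n40; clear; lia.
have T8 := t8 n40.
have fin s : arrs s = arrs st -> (forall x, x < 60 -> vars s x = vars st x) ->
    Q (set_var s 62 (L0n n i j)).
  by move=> ha hv; apply: hQ => // x h; rewrite /= /upd; case: eqP => [e|_]; [rewrite e in h|exact: hv].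
have cL : L0n n i j <= capv n by apply: lt_capv; apply: ltnW; exact: L0n_lt.
apply: (wp_if (b := 2 * k < n)).
- by rewrite -/(tr eps delta _ _) !evE !eval_var v2 v0.
- move=> hn; have K := kt n40 hn; apply: (wp_if (b := i < 2 * k)).
  + by rewrite -/(tr eps delta _ _) !evE !eval_var v2.
  + move=> hi2; apply: wp_seq; apply: (wp_assign (Tn k t o i)).
    * exact: (eval_Tn eps delta v2 v12 v13).
    * by rewrite v0; apply: lt_capv; apply: leq_trans k2n; apply: ltnW; apply: Tn_lt.
    set s1 := set_var _ _ _.
    apply: (wp_if (b := j < 2 * k)).
    * by rewrite -/(tr eps delta _ _) !evE !eval_var -[vars s1 2]/(vars st 2) v2.
    * move=> hj2; apply: (wp_assign (L0n n i j)).
      - rewrite eval_if (eval_En eps delta (k := k) (t := t) (o := o)) // tr_eq eval_two !eval_var.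
        by rewrite -[vars s1 2]/(vars st 2) v2 /L0n hn hi2 hj2.
      - by rewrite -[vars s1 0]/(vars st 0) v0.
      - by apply: fin => // x h; rewrite /= /upd; case: eqP => [e|_] //; rewrite e in h.
    * move=> hj2; apply: (wp_assign (L0n n i j)).
      - rewrite (eval_En eps delta (k := k) (t := t) (o := o)) // !eval_var.
        by rewrite /L0n hn hi2 (negbTE hj2).
      - by rewrite -[vars s1 0]/(vars st 0) v0.
      - by apply: fin => // x h; rewrite /= /upd; case: eqP => [e|_] //; rewrite e in h.
  + move=> hi2; apply: (wp_if (b := j < 2 * k)).
    * by rewrite -/(tr eps delta _ _) !evE !eval_var v2.
    * move=> hj2; apply: wp_seq; have [a1 a2] := TinP n40 hn hj2.
      have hc x : (eval eps delta (set_var st 61 x)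
          (eAnd (eLt (Var 61) (eTwo vK)) (eEq (eTn (Var 61)) (Var 8))) != 0) =
          (x < 2 * k) && (Tn k t o x == j).
        rewrite -/(tr eps delta _ _) tr_and tr_lt tr_eq eval_two (eval_Tn eps delta (k := k) (t := t) (o := o)) //.
        by rewrite !eval_var -[vars _ 2]/(vars st 2) v2.
      apply: (@wp_search _ _ _ _ _ _ _ _ n) => //.
      - by exists (Tin n j); [apply: leq_trans k2n|rewrite hc a1 a2 eqxx].
      - move=> x hx; rewrite hc => /andP[x1 /eqP x2].
        have ex : x = Tin n j by apply: (Tn_inj T8 K x1 a1); rewrite x2 a2.
        apply: (wp_assign (L0n n i j)).
        * rewrite (eval_En eps delta (k := k) (t := t) (o := o)) // !eval_var.
          by rewrite /L0n hn (negbTE hi2) hj2 -ex.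
        * by rewrite -[vars _ 0]/(vars st 0) v0.
        * by apply: fin => // y h; rewrite /= /upd; case: eqP => [e|_] //; rewrite e in h.
    * move=> hj2; apply: (wp_assign (L0n n i j)).
      - by rewrite /L0n hn (negbTE hi2) (negbTE hj2) -v2.
      - by rewrite v0.
      - exact: fin.
- move=> hn; apply: (wp_assign (L0n n i j)).
  + by rewrite (eval_Dn eps delta v2) /L0n (negbTE hn).
  + by rewrite v0.
  + exact: fin.
Qed.

Variables (i0 : 'I_n) (c0 : 'I_n * 'I_n * 'I_n).
Notation I := 'I_n.
Local Notation Ls := (Ls n40 c0).
Local Notation Ds := (Ds n40 c0).

Definition wrF (i j : I) st :=
  set_arr (set_arr (set_arr (set_arr (set_arr st 3 (ix i j) (Ls i j)) 4 (ix i (Ls i j)) j)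
    5 (ix j (Ls i j)) i) 7 (ix i j) (B0n n i j)) 14 (ix i j) (Ds i j).

Definition relab st := vars st 10 = L00 n40 c0.1.1 c0.1.2 /\ vars st 11 = c0.2.

Lemma sigE st x : relab st -> sig n40 c0 x =
  (if val x == vars st 10 then vars st 11 else if val x == vars st 11 then vars st 10 else x) :> nat.
Proof.
case=> -> ->; rewrite /sig; case: tpermP => [->|->|n1 n2]; rewrite ?eqxx //.
  by case: eqP => // <-.
by case: eqP => [/ord_inj|_] //; case: eqP => [/ord_inj|_].
Qed.

Lemma wp_FILL (Q : state -> Prop) st (i j : I) : params st -> relab st ->
  vars st 7 = i -> vars st 8 = j ->
  (forall st', arrs st' = arrs (wrF i j st) -> (forall x, x < 60 -> vars st' x = vars st x) -> Q st') ->
  wp FILL Q st.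
Proof.
move=> pst rst v7 v8 hQ; apply: wp_seq; apply: wp_CELL => //; rewrite ?v7 ?v8 //.
move=> s ha hv h62; have [v0 v2 v12 v13] : params s by case: pst => *; split; rewrite hv.
have rs : relab s by case: rst => *; split; rewrite hv.
have w7 : vars s 7 = i by rewrite hv.
have w8 : vars s 8 = j by rewrite hv.
have cI (x : I) : x <= capv n by exact: ord_cap nN x.
apply: wp_seq; apply: (wp_assign (Ls i j)).
- by rewrite eval_Sig !eval_var h62 (sigE _ rs).
- by rewrite v0 cI.
apply: wp_seq; apply: (wp_assign (D00 n40 i j)).
- by rewrite (eval_Dn eps delta (k := k)) // !eval_var -[vars _ 7]/(vars s 7) -[vars _ 8]/(vars s 8) w7 w8.
- by rewrite -[vars _ 0]/(vars s 0) v0 cI.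
apply: wp_seq; apply: (wp_assign (Ds i j)).
- by rewrite eval_Sig; exact: esym (sigE _ rs).
- by rewrite -[vars _ 0]/(vars s 0) v0 cI.
apply: wp_seq; apply: (wp_assign (B0n n i j)).
- rewrite eval_if tr_and tr_not !tr_and !tr_lt tr_not tr_eq eval_two
    (eval_Tn eps delta (k := k) (t := t) (o := o)) // !eval_num !eval_var.
  rewrite -![vars _ 7]/(vars s 7) -![vars _ 8]/(vars s 8) -![vars _ 0]/(vars s 0) -[vars _ 2]/(vars s 2).
  by rewrite w7 w8 v0 v2 /B0n; case: (_ && _).
- by rewrite -[vars _ 0]/(vars s 0) v0; case: (B0n _ _ _); rewrite // lt_capv // (leq_trans _ n40).
set s' := set_var _ 65 _.
have u0 : vars s' 0 = n by [].
have u7 : vars s' 7 = i by [].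
have u8 : vars s' 8 = j by [].
have u63 : vars s' 63 = Ls i j by [].
have u64 : vars s' 64 = Ds i j by [].
have u65 : vars s' 65 = B0n n i j by [].
have ua : arrs s' = arrs st by [].
have uv x : x < 60 -> vars s' x = vars st x.
  move=> hx; rewrite -hv //= /s' /= /upd.
  by do 3! (case: eqP => [e|_]; first by rewrite e in hx).
move: (s') u0 u7 u8 u63 u64 u65 ua uv => s1 u0 u7 u8 u63 u64 u65 ua uv {s'}.
apply: wp_seq; apply: (wp_put (ix i j) (Ls i j)); rewrite /= ?u0 ?u7 ?u8 ?u63 ?cI //.
apply: wp_seq; apply: (wp_put (ix i (Ls i j)) j); rewrite /= ?u0 ?u7 ?u8 ?u63 ?cI //.
apply: wp_seq; apply: (wp_put (ix j (Ls i j)) i); rewrite /= ?u0 ?u7 ?u8 ?u63 ?cI //.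
apply: wp_seq; apply: (wp_put (ix i j) (B0n n i j)); rewrite /= ?u0 ?u7 ?u8 ?u65 //.
  by case: (B0n _ _ _); rewrite // lt_capv // (leq_trans _ n40).
apply: (wp_put (ix i j) (Ds i j)); rewrite /= ?u0 ?u7 ?u8 ?u64 ?cI //.
by apply: hQ => [|x hx]; [rewrite /= ua|exact: uv].
Qed.

Variables (st0 : state).
Hypothesis st0_0 : vars st0 0 = n.
Hypothesis st0_v : forall x, 1 < x -> vars st0 x = 0.
Hypothesis st0_a : forall a l, 2 < a -> arrs st0 a l = 0.
Hypothesis st0_c : [/\ arrs st0 0 0 = c0.1.1, arrs st0 1 0 = c0.1.2 & arrs st0 2 0 = c0.2].

Definition tabled m st :=
  (forall a, a \notin [:: 3; 4; 5; 7; 14] -> arrs st a = arrs st0 a) /\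
  forall i j : I, ix i j < m ->
    [/\ arrs st 3 (ix i j) = Ls i j, arrs st 4 (ix i (Ls i j)) = j,
        arrs st 5 (ix j (Ls i j)) = i, arrs st 7 (ix i j) = B0n n i j
      & arrs st 14 (ix i j) = Ds i j].

Lemma tabledS st st' (i j : I) : tabled (ix i j) st -> arrs st' = arrs (wrF i j st) ->
  tabled (ix i j).+1 st'.
Proof.
move=> [h1 h2] e; split=> [a|i' j'].
  rewrite e !inE !negb_or => ha; rewrite -h1 ?inE ?negb_or //; case/and5P: ha => a1 a2 a3 a4 a5.
  by rewrite /= /upd (negbTE a1) (negbTE a2) (negbTE a3) (negbTE a4) (negbTE a5).
rewrite ltnS leq_eqVlt e /= /upd /= => /orP[|lt].
  by rewrite ix_eq => /andP[/eqP-> /eqP->]; rewrite !eqxx.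
have ne : (ix i' j' == ix i j) = false by move: lt; rewrite ltn_neqAle => /andP[/negbTE].
have [g1 g2 g3 g4 g5] := h2 _ _ lt; rewrite ne !ix_eq; split=> //.
- by case: andP => // -[/eqP ei /eqP]; rewrite ei => /Ls_row ej; rewrite ei ej eqxx in ne.
- by case: andP => // -[/eqP ej /eqP]; rewrite ej => /(@Ls_col _ _ _ j) ei; rewrite ei ej eqxx in ne.
Qed.

Lemma ix_lt (i j : I) : ix i j < n * n.
Proof.
have := ltn_ord i; have := ltn_ord j; rewrite /ix; clear; nia.
Qed.

Lemma rep_tabled st : tabled (n * n) st -> vars st 2 = k ->
  (forall x, x < 6 -> x != 2 -> vars st x = vars st0 x) ->
  rep k i0 Ds (fun _ _ => None) st0 0 0 st (A00 n40 c0) [::].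
Proof.
move=> [h1 h2] v2 hv.
have h3 a l : 2 < a -> a \notin [:: 3; 4; 5; 7; 14] -> arrs st a l = 0.
  by move=> a3 /h1 ->; exact: st0_a.
split=> //=; try by move=> i; rewrite h3.
- by rewrite hv.
- by rewrite hv.
- by rewrite hv // st0_v.
- by rewrite hv // st0_v.
- by rewrite hv // st0_v.
- by move=> a a3; rewrite h1 // !inE; move: a3; clear; lia.
- by move=> i j; have [-> _ _ _ _] := h2 _ _ (ix_lt i j).
- move=> i s; set j := invF _ s; have [_ e _ _ _] := h2 _ _ (ix_lt i j).
  by rewrite (f_invF (@Ls_row n n40 c0 i)) in e.
- move=> j s; set i := invF _ s; have [_ _ e _ _] := h2 _ _ (ix_lt i j).
  by have ei : Ls i j = s := f_invF (@Ls_col n n40 c0 j) s; rewrite ei in e.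
- by move=> i j; rewrite h3.
- by move=> i j; have [_ _ _ -> _] := h2 _ _ (ix_lt i j).
- by move=> i j; have [_ _ _ _ ->] := h2 _ _ (ix_lt i j).
Qed.

Definition fr st :=
  [/\ params st, relab st & forall x, x < 6 -> x != 2 -> vars st x = vars st0 x].

Lemma fr_mono st st' : (forall x, x < 60 -> x != 7 -> x != 8 -> vars st' x = vars st x) ->
  fr st -> fr st'.
Proof.
move=> h [[v0 v2 v12 v13] [v10 v11] v]; split; first by split; rewrite h.
  by split; rewrite h.
by move=> x x6 x2; rewrite h ?v //; move: x6; clear; lia.
Qed.

Lemma fr_set st x v : (x == 7) || (x == 8) -> fr st -> fr (set_var st x v).
Proof.
move=> hx; apply: fr_mono => y _ y7 y8; rewrite /= /upd; case: eqP => // e.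
by move: hx; rewrite -e (negbTE y7) (negbTE y8).
Qed.

Lemma wp_fill (Q : state -> Prop) st : fr st -> tabled 0 st ->
  (forall st', fr st' -> tabled (n * n) st' -> Q st') ->
  wp (for_ 7 (Var 0) (for_ 8 (Var 0) FILL)) Q st.
Proof.
move=> frst fl hQ; have v0 (s : state) : fr s -> vars s 0 = n by case=> -[].
apply: (@wp_for _ _ _ _ 7 (Var 0) _ (fun i s => [/\ fr s, vars s 7 = i & tabled (i * n) s]) _ n) => //.
- by rewrite v0 // lt_capv.
- by split=> //; apply: fr_set.
- by move=> i s _ [f s7 _]; split=> //=; rewrite !v0.
- move=> i s hi [f s7 fl1].
  apply: (@wp_for _ _ _ _ 8 (Var 0) _
    (fun j s => [/\ fr s, vars s 7 = i, vars s 8 = j & tabled (i * n + j) s]) _ n) => //.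
  + by rewrite v0 // lt_capv.
  + by rewrite addn0; split=> //; apply: fr_set.
  + by move=> j s' _ [f' _ s8 _]; split=> //=; rewrite !v0.
  + move=> j s' hj [f' s7' s8' fl2].
    apply: (wp_FILL (i := Ordinal hi) (j := Ordinal hj)) => //; try by case: f'.
    move=> s2 ha hv; have f2 : fr s2 by apply: fr_mono f' => x hx _ _; exact: hv.
    rewrite hv // !v0 //; split=> //; split=> //; split=> //.
    * exact: fr_set.
    * by rewrite -s7' -hv.
    * by rewrite addnS; exact: (@tabledS s' (set_var s2 8 j.+1) (Ordinal hi) (Ordinal hj) fl2 ha).
  + move=> s' [f' s7' s8' fl2]; rewrite !v0 //; split=> //; split=> //; split=> //.
      exact: fr_set.
    by rewrite mulSn addnC.
- by move=> s [f _ fl1]; apply: hQ.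
Qed.

Local Notation repN := (rep k i0 Ds (fun _ _ => None) st0).

Lemma wp_PREMARK st : repN 0 0 st (A00 n40 c0) [::] -> vars st 12 = t -> vars st 13 = o ->
  wp PREMARK (fun st' => exists s, repN 0 0 st' (A01 n40 i0 c0) s) st.
Proof.
move=> r v12 v13; apply: (wp_if (b := o)).
- by rewrite /= v13; case: (o).
- move=> ho; have hk : 2 * k <= n by have := n_half n40; clear; lia.
  have T8 := t8 n40; have tk : t <= k by rewrite /t0; clear; lia.
  have e1 : toI i0 (sr1 t) = t :> nat by rewrite toIE // /sr1; move: hk tk T8; clear; lia.
  have e2 : toI i0 (sr2 k) = 2 * k - 3 :> nat by rewrite toIE // /sr2; move: hk tk T8; clear; lia.
  have e3 : toI i0 (sc2 k) = 2 * k - 2 :> nat by rewrite toIE // /sc2; move: hk tk T8; clear; lia.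
  have cI (x : I) : x <= capv n by exact: ord_cap nN x.
  apply: wp_seq; apply: (wp_assign (toI i0 (sr1 t))); rewrite ?(rep0 r) ?cI //.
    by rewrite e1.
  have r1 := rep_var nN (toI i0 (sr1 t)) r (isT : 20 <= 20).
  apply: wp_seq; apply: (wp_assign (toI i0 (sc1 t))); rewrite ?(rep0 r1) ?cI //.
    by rewrite e1.
  have r2 := rep_var nN (toI i0 (sc1 t)) r1 (isT : 20 <= 21).
  apply: wp_seq; apply: (wp_assign (toI i0 (sr2 k))); rewrite ?(rep0 r2) ?cI //.
    by rewrite e2 /eSr2 !evE !eval_var (rep2 r2).
  have r3 := rep_var nN (toI i0 (sr2 k)) r2 (isT : 20 <= 22).
  apply: wp_seq; apply: (wp_assign (toI i0 (sc2 k))); rewrite ?(rep0 r3) ?cI //.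
    by rewrite e3 /eSc2 !evE !eval_var (rep2 r3).
  have r4 := rep_var nN (toI i0 (sc2 k)) r3 (isT : 20 <= 23).
  set env := (23, _) :: _ in r4; set s4 := set_var _ 23 _ in r4 *.
  have h : awp eps delta k i0 Ds (fun _ _ => None) st0 0 0 N
      (CSeq (LOG 20 21) (CSeq (LOG 20 23) (CSeq (LOG 22 21) (LOG 22 23))))
      (fun A s => A = A01 n40 i0 c0) (A00 n40 c0) env.
    apply: awp_seq; apply: awp_LOG => //; apply: awp_seq; apply: awp_LOG => //.
    apply: awp_seq; apply: awp_LOG => //; apply: awp_LOG => //.
    by rewrite /A01 /marks ho.
  by apply: wp_mono (awpP h r4) _ => s' [A [s [r' e]]]; exists s; rewrite -e.
- by move=> ho; apply: wp_skip; exists [::]; rewrite /A01 /marks (negbTE ho).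
Qed.

Lemma wp_INIT (Q : state -> Prop) :
  (forall st', repN (size (marks i0)) 0 st' (commit Ds (A01 n40 i0 c0)) [::] -> Q st') ->
  wp INIT Q st0.
Proof.
move=> hQ; have [a0 a1 a2] := st0_c.
have cI (x : I) : x <= capv n by exact: ord_cap nN x.
have kle : k <= n by rewrite /k0; clear; lia.
have tle : t <= n by rewrite /t0; move: kle; clear; lia.
apply: wp_seq; apply: (wp_assign k); first by rewrite /= st0_0.
  by rewrite st0_0 lt_capv.
apply: wp_seq; apply: (wp_assign t) => //.
  by rewrite -[vars _ 0]/(vars st0 0) st0_0 lt_capv.
set s2 := set_var _ 12 _.
have u0 : vars s2 0 = n by [].
apply: wp_seq; apply: (wp_assign o).
- rewrite -[LHS]/((2 * k + 1 <= vars s2 0) * (k == 2 * t + 1)) u0 /o0 addn1.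
  by case: (_ < n); case: (_ == _).
- by rewrite u0; case: (o); rewrite // lt_capv // (leq_trans _ n40).
apply: wp_seq; apply: (wp_assign c0.1.1) => //; first by rewrite -[vars _ 0]/(vars s2 0) u0.
apply: wp_seq; apply: (wp_assign c0.1.2) => //; first by rewrite -[vars _ 0]/(vars s2 0) u0.
set s3 := set_var _ 8 _.
have p3 : params s3 by [].
have v3 x : x < 6 -> x != 2 -> vars s3 x = vars st0 x.
  move=> h1 h2; rewrite /= /upd (negbTE h2).
  by do 4! (case: eqP => [e|_]; first by rewrite e in h1).
have w7 : vars s3 7 = c0.1.1 by [].
have w8 : vars s3 8 = c0.1.2 by [].
have ar : arrs s3 = arrs st0 by [].
move: (s3) p3 v3 w7 w8 ar => s4 p4 v4 w7 w8 ar {s3 s2 u0}.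
apply: wp_seq; apply: wp_CELL => //; rewrite ?w7 ?w8 //.
move=> s5 ha hv h62; have p5 : params s5 by case: p4 => *; split; rewrite hv.
have z0 : vars s5 0 = n by case: p5.
apply: wp_seq; apply: (wp_assign (L00 n40 c0.1.1 c0.1.2)) => //; first by rewrite z0.
apply: wp_seq; apply: (wp_assign c0.2).
- by rewrite -[LHS]/(arrs s5 2 0) ha ar.
- by rewrite -[vars _ 0]/(vars s5 0) z0.
apply: wp_seq; apply: wp_fill.
- split=> // x h1 h2; rewrite -v4 // -hv; last by move: h1; clear; lia.
  by rewrite /= /upd; do 2! (case: eqP => [e|_]; first by rewrite e in h1).
- by split=> // a _; rewrite /= ha ar.
move=> s6 [[v0 v2 v12 v13] _ v6] fl; have r6 := rep_tabled fl v2 v6.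
apply: wp_seq; apply: wp_mono (wp_PREMARK r6 v12 v13) _ => s7 [env r7].
have [[eS eL eR eC eSL] _] := touches (A00 n40 c0) (marks i0).
rewrite -/(A01 n40 i0 c0) in eS eL eR eC eSL.
have sz : size (marks i0) <= 4 by rewrite marks_size; case: ifP.
apply: (@wp_COMMIT _ _ _ _ _ _ _ _ _ _ _ nN _ _ _ _ (rep_nil r7)); rewrite ?eL /=.
- by apply: leq_trans sz (leq_trans _ (leq_trans n40 nN)).
- by rewrite add0n; apply: lt_capv; apply: leq_trans sz (leq_trans _ n40).
- by move=> x; rewrite eR.
- by move=> x; rewrite eC.
- by move=> x; rewrite eSL.
by move=> s8 r8 _; apply: hQ.
Qed.

End Init.

Lemma quadratic_bound (R : realFieldType) (a b c s x m f : R) : (0 < s)%R -> (0 <= a)%R ->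
  (0 < c * 10409 - 61 * a)%R ->
  (b ^+ 2 * 10409 < 4 * (c * 10409 - 61 * a) * (118 * a))%R ->
  (x * s <= a * m)%R -> (m <= 61 * f - 118)%R -> (10409 * f < s ^+ 2)%R -> (x + b < c * s)%R.
Proof.
move=> s0 a0; set d := (c * 10409 - 61 * a)%R => d0 disc hx hm hf.
have ham := ler_wpM2l a0 hm; have haf := ler_wpM2l a0 (ltW hf).
have xs : (10409 * (x * s) <= 61 * (a * s ^+ 2) - 10409 * (118 * a))%R.
  by move: hx ham haf; clear; rewrite !(mulrCA a) => ? ? ?; lra.
have sqE : (4 * d * (d * s ^+ 2 - 10409 * b * s + 10409 * (118 * a)) =
    (2 * d * s - 10409 * b) ^+ 2 + 10409 * (4 * d * (118 * a) - b ^+ 2 * 10409))%R by ring.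
have pos : (0 < d * s ^+ 2 - 10409 * b * s + 10409 * (118 * a))%R.
  rewrite -(pmulr_rgt0 _ (mulr_gt0 (ltr0n R 4) d0)) sqE ltr_wpDl ?sqr_ge0 //.
  by rewrite mulr_gt0 // subr_gt0.
have dE : (d * s ^+ 2 = 10409 * (c * s * s) - 61 * (a * s ^+ 2))%R by rewrite /d; ring.
rewrite -(ltr_pM2r s0) mulrDl; rewrite dE -mulrA in pos.
by move: xs pos; clear; lra.
Qed.

Lemma room_e (R : realFieldType) (s n e p c : R) : (s = n - 12 * e -> p <= e -> c * 2 <= s ->
  103 <= n -> 0 <= s -> 7 * p + 12 + c < n)%R.
Proof. by move=> *; lra. Qed.

Lemma room_d (R : realFieldType) (s n e p c x : R) : (s = n - 12 * e -> p <= e -> c * 2 <= s ->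
  s <= n -> x + 32 < 1 / 2 * s -> 9 * p + 32 + x + c < n)%R.
Proof. by move=> *; lra. Qed.

Lemma room_q (R : realFieldType) (s n e p c x y k : R) : (s = n - 12 * e -> p <= e ->
  c * 8 <= s -> s <= n -> n <= 2 * k + 1 -> x + y + 97 / 2 < 3 / 8 * s ->
  5 * p + 48 + x + y + c < k)%R.
Proof. by move=> *; lra. Qed.

Lemma room_z (R : realFieldType) (s n e p x y q k : R) : (s = n - 12 * e -> p <= e ->
  s <= n -> n <= 2 * k + 1 -> x + y + q + 121 / 2 < 1 / 2 * s ->
  6 * p + 60 + x + y + q < k)%R.
Proof. by move=> *; lra. Qed.

Definition disc_neg (R : realFieldType) (a b c : R) : Prop :=
  [/\ 0 <= a, 0 < c * 10409 - 61 * a &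
      b ^+ 2 * 10409 < 4 * (c * 10409 - 61 * a) * (118 * a)]%R.

Lemma disc_d (R : realFieldType) : disc_neg (14 : R)%R 32%R (1 / 2)%R.
Proof. by split; lra. Qed.

Lemma disc_q (R : realFieldType) : disc_neg (38 : R)%R (97 / 2)%R (3 / 8)%R.
Proof. by split; lra. Qed.

Lemma disc_z (R : realFieldType) : disc_neg (62 : R)%R (121 / 2)%R (1 / 2)%R.
Proof. by split; lra. Qed.

Section Numbers.

Variables (R : realType) (eps : R) (n F : nat).
Hypotheses (e0 : (0 <= eps)%R) (e1 : (eps < 1 / 12)%R).
Local Notation S := (((1 - 12 * eps) * n%:R)%R : R).
Hypothesis FS : (10409 * F%:R < S ^+ 2)%R.
Hypothesis F0 : 0 < F.
Local Notation thr := (light eps n).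

Lemma S_bounds : (0 <= S)%R /\ (S <= n%:R)%R.
Proof.
by move: e0 e1 => h0 h1; split; [rewrite mulr_ge0 //; lra|rewrite ler_piMl //; lra].
Qed.

Lemma S_gt0 : (0 < S)%R.
Proof.
have [h _] := S_bounds; rewrite lt_def h andbT; apply: contraTneq FS => ->.
by rewrite -leNgt expr0n mulr_ge0.
Qed.

Lemma n_ge103 : 103 <= n.
Proof.
have [h1 h2] := S_bounds; have f1 : (1 <= F%:R :> R)%R by rewrite ler1n.
rewrite leqNgt; apply/negP; rewrite ltnS -(ler_nat R) => hn.
by move: FS h1 h2 f1 hn; set s := S; set f := (F%:R)%R; set m := (n%:R)%R; nra.
Qed.

Lemma F_lt_sqr : 100 * F < n * n.
Proof.
have [h1 h2] := S_bounds; rewrite -(ltr_nat R) !natrM.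
by move: FS h1 h2; set s := S; set f := (F%:R)%R; set m := (n%:R)%R; nra.
Qed.

Lemma thr_mul M w f : thr M w f = ((f%:R * S)%R <= (w * M)%:R)%R.
Proof.
have sE : (f%:R * S = (f * n)%:R - eps * (12 * (f * n))%:R :> R)%R.
  by rewrite !natrM; clear; ring.
rewrite /light sE; case: (leqP (w * M) (f * n)) => h.
  rewrite natrB //; move: ((f * n)%:R)%R ((w * M)%:R)%R (_ * _%:R)%R => a b c; apply/idP/idP; lra.
have -> : f * n - w * M = 0 by apply/eqP; rewrite subn_eq0 ltnW.
rewrite mulr_ge0 //; apply/esym.
have : ((f * n)%:R <= (w * M)%:R :> R)%R by rewrite ler_nat ltnW.
have : (0 <= eps * (12 * (f * n))%:R)%R by rewrite mulr_ge0.
by lra.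
Qed.

Lemma truncn_nat (x : R) m : (0 <= x)%R -> (m%:R <= x)%R -> m <= Num.truncn x.
Proof. by move=> x0 h; rewrite truncn_ge_nat. Qed.

Lemma markov_thr (T : finType) (f : T -> nat) q w M : 0 < q -> \sum_z f z <= w * M ->
  #|[pred z | ~~ thr M (w * q) (f z)]| <= Num.truncn (S / q%:R)%R.
Proof.
move=> q0 h; have := markov S_gt0 q0 h; set b := #|_|; set b' := #|_| => hb.
have -> : b' = b by apply: eq_card => z; rewrite !inE thr_mul -ltNge.
have q0' : (0 < q%:R :> R)%R by rewrite ltr0n.
by apply: truncn_nat; rewrite ?divr_ge0 ?(ltW S_gt0) // ler_pdivlMr.
Qed.

Variable k : nat.
Hypothesis kn : n <= 2 * k + 1.

Lemma counts_ok M : 1 < F -> M <= 61 * (F - 2) + 4 ->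
  counts eps n k (Num.truncn (eps * n%:R)%R) M.
Proof.
move=> F2 hM; have [s0 sn] := S_bounds; have sp := S_gt0; have n103 := n_ge103.
have hm : (M%:R <= 61 * F%:R - 118 :> R)%R.
  rewrite lerBrDr -natrM -natrD ler_nat; move: hM F2; clear; lia.
have n103' : (103 <= n%:R :> R)%R by rewrite ler_nat.
have en : (0 <= eps * n%:R)%R by rewrite mulr_ge0.
have hp : ((Num.truncn (eps * n%:R)%R)%:R <= eps * n%:R)%R by rewrite truncn_le.
have hk : (n%:R <= 2 * k%:R + 1 :> R)%R by rewrite -natrM natr1 -addn1 ler_nat.
have tq q : 0 < q -> ((Num.truncn (S / q%:R)%R)%:R * q%:R <= S)%R.
  move=> q0; rewrite -ler_pdivlMr ?ltr0n // truncn_le divr_ge0 // ltW //.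
have sE : (S = n%:R - 12 * (eps * n%:R))%R by ring.
have t2 := tq 2 isT; have t8 := tq 8 isT.
have bound a b c (X : nat) : disc_neg a b c -> (X%:R * S <= a * M%:R)%R -> (X%:R + b < c * S)%R.
  by case=> a0 d0 disc hX; exact: quadratic_bound sp a0 d0 disc hX hm FS.
split.
- exists (Num.truncn (S / 2)%R), (Num.truncn (S / 2)%R), (Num.truncn (S / 8)%R).
  split.
  + by move=> f /(@markov_thr _ f 2 7 M isT).
  + by move=> f /(@markov_thr _ f 2 12 M isT).
  + by move=> f /(@markov_thr _ f 8 3 M isT).
  + rewrite -(ltr_nat R) 2!natrD natrM.
    exact: room_e sE hp t2 n103' s0.
  split=> [x|x y]; rewrite !thr_mul !natrM.
    move=> hx; rewrite -(ltr_nat R) 3!natrD natrM; apply: room_d sE hp t2 sn _.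
    exact: bound (disc_d R) hx.
  move=> hx hy; rewrite -(ltr_nat R) 4!natrD natrM; apply: room_q sE hp t8 sn hk _.
  rewrite -natrD; apply: bound (disc_q R) _.
  by rewrite natrD mulrDl; apply: le_trans (lerD hx hy) _; rewrite -mulrDl -natrD.
- move=> x y q; rewrite !thr_mul !natrM => hx hy hq.
  rewrite -(ltr_nat R) 4!natrD natrM; apply: room_z sE hp sn hk _.
  rewrite -2!natrD; apply: bound (disc_z R) _.
  rewrite 2!natrD 2!mulrDl; apply: le_trans (lerD (lerD hx hy) hq) _.
  by rewrite -2!mulrDl -2!natrD.
Qed.

End Numbers.

Definition eCyc := eIf (eLt (eAdd (Var 7) (Var 8)) (Var 0)) (eAdd (Var 7) (Var 8))
  (eSub (eAdd (Var 7) (Var 8)) (Var 0)).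

Definition CYCLIC := for_ 7 (Var 0) (for_ 8 (Var 0) (CPut 3 (eIx (Var 7) (Var 8)) eCyc)).

Definition MAIN :=
  CIf (Var 1) (CSeq INIT (CSeq (FORSQ LOAD) (CSeq (CAssign 5 (Num 0)) (FORSQ BODY)))) CYCLIC.

Lemma MAIN_depth : depth MAIN = 3.
Proof. by vm_compute. Qed.

Lemma MAIN_ok : exists s, pok s MAIN.
Proof. by exists 4000; vm_compute. Qed.

Section Main.

Variables (R : realType) (eps delta : R) (n : nat).
Hypothesis n0 : 0 < n.
Variables (P : 'M[option 'I_n]_n) (s : seq ('I_n * 'I_n * 'I_n)).
Hypothesis Ps : lists_cells P s.
Notation I := 'I_n.
Local Notation wp := (wp eps delta n).

Lemma size_filled : size s <= filled P.
Proof.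
have [us ms] := Ps.
have uf : uniq (map fst s).
  rewrite map_inj_in_uniq // => -[[i j] x] [[i' j'] x'] h h' /= [ei ej].
  move: h h'; rewrite -ei -ej !ms => /eqP-> /eqP[->] //.
rewrite -(size_map fst) -(card_uniqP uf); apply: subset_leq_card; apply/subsetP => c.
by move=> /mapP[[[i j] x]]; rewrite ms inE => /eqP h -> /=; rewrite h.
Qed.

Lemma size_sqr : size s <= n * n.
Proof.
apply: leq_trans size_filled _; apply: leq_trans (max_card _) _.
by rewrite card_prod !card_ord.
Qed.

Lemma input_bounded : bounded (capv n) (input_state s).
Proof.
have ln x : x < n -> x <= capv n by rewrite /capv => h; move: n0 h; clear; nia.
have lnn : n <= capv n by rewrite /capv; move: n0; clear; nia.
have ls : size s <= capv n by apply: leq_trans size_sqr _; rewrite /capv leq_pmull.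
split=> [[|[|x]]|a i] //=; first by rewrite nth_nil.
have key (f : I * I * I -> I) : nth 0 [seq val (f c) | c <- s] i <= capv n.
  case: (ltnP i (size s)) => h; last by rewrite nth_default // size_map.
  case: s h => // c0 s' h; rewrite (nth_map c0) //; exact: ln (ltn_ord _).
case: a => [|[|[|a]]] //; [exact: (key (fun c => c.1.1))|exact: (key (fun c => c.1.2))|exact: (key (fun c => c.2))].
Qed.

Definition solved (st : state) : Prop := exists L : 'M[I]_n, completion P L /\ outputs L st.

Lemma wp_cyclic st : s = [::] -> vars st 0 = n -> wp CYCLIC solved st.
Proof.
move=> s0 v0; have cn : n <= capv n by rewrite /capv; move: n0; clear; nia.
pose f i j := if i + j < n then i + j else i + j - n.
have flt (i j : I) : f i j < n.
  by rewrite /f; case: (ltnP (i + j) n) => // h; move: (ltn_ord i) (ltn_ord j) h; clear; lia.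
pose L : 'M[I]_n := (\matrix_(i, j) Ordinal (flt i j))%R.
pose upto m (st : state) := forall i j : I, ix i j < m -> arrs st 3 (ix i j) = L i j.
apply: (@wp_for _ _ _ _ 7 (Var 0) _
  (fun i s => [/\ vars s 0 = n, vars s 7 = i & upto (i * n) s]) _ n) => //.
- by rewrite v0.
- by move=> i st1 _ [h0 h7 _]; split=> //; rewrite h0.
- move=> i st1 hi [h0 h7 hu].
  apply: (@wp_for _ _ _ _ 8 (Var 0) _
    (fun j s => [/\ vars s 0 = n, vars s 7 = i, vars s 8 = j & upto (i * n + j) s]) _ n) => //.
  + by rewrite h0.
  + by rewrite addn0.
  + by move=> j st2 _ [k0 _ k8 _]; split=> //; rewrite k0.
  + move=> j st2 hj [k0 k7 k8 ku]; apply: (wp_put (i * n + j) (f i j)).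
    * by rewrite /= k0 k7 k8.
    * by rewrite /eCyc !evE !eval_var k7 k8 k0 /f.
    * by rewrite k0; apply: leq_trans cn; apply: ltnW; exact: (flt (Ordinal hi) (Ordinal hj)).
    split=> //; split; first by rewrite h0.
    split=> // i' j'; rewrite addnS ltnS leq_eqVlt => h.
    rewrite -[LHS]/(if ix i' j' == i * n + j then f i j else arrs st2 3 (ix i' j')).
    case: (ix i' j' =P _) h => [e _|ne /=]; last by move/ku.
    move/eqP: e; rewrite -[i * n + j]/(ix (Ordinal hi) (Ordinal hj)) ix_eq.
    by move=> /andP[/eqP-> /eqP->]; rewrite mxE.
  + move=> st2 [k0 k7 _ ku]; rewrite v0; split=> //; split=> //; split=> //.
    by move: ku; rewrite mulSn addnC.
- move=> st1 [_ _ hu]; exists L; split; last first.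
    move=> i j; apply: hu; have := ltn_ord i; have := ltn_ord j; rewrite /ix; clear; nia.
  split; last first.
    by move=> i j x h; have [_ /(_ i j x)] := Ps; rewrite s0 h eqxx.
  have fi (i j j' : I) : f i j = f i j' -> j = j'.
    move: (ltn_ord i) (ltn_ord j) (ltn_ord j'); rewrite /f => hi hj hj' e; apply: val_inj.
    by move: e hi hj hj'; case: (ltnP (i + j) n); case: (ltnP (i + j') n); clear => /=; lia.
  split=> [i j j'|j i i']; rewrite !mxE => /(congr1 val) /= h; first exact: fi h.
  by apply: (fi j); rewrite /f ![j + _]addnC.
Qed.

Hypothesis Hc : constants_ok eps delta.
Hypothesis HP : eligible eps delta P.

Lemma few_filled : 0 < size s -> (10409 * (size s)%:R < ((1 - 12 * eps) * n%:R) ^+ 2)%R.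
Proof.
move=> _; have [_ _ hF] := HP; have [_ _ _ hd] := Hc.
have n1 : (0 < n%:R ^+ 2 :> R)%R by rewrite exprn_gt0 // ltr0n.
have h1 : ((size s)%:R <= delta * n%:R ^+ 2)%R.
  by apply: le_trans hF; rewrite ler_nat size_filled.
rewrite exprMn; apply: (@le_lt_trans _ _ (10409 * (delta * n%:R ^+ 2))%R); first by rewrite ler_pM2l.
rewrite mulrA ltr_pM2r // mulrC -ltr_pdivlMr //.
Qed.

Lemma wp_nonempty : 0 < size s ->
  wp (CSeq INIT (CSeq (FORSQ LOAD) (CSeq (CAssign 5 (Num 0)) (FORSQ BODY)))) solved (input_state s).
Proof.
move=> sz; have FS := few_filled sz; have [e0 _ e1 _] := Hc.
have n103 : 103 <= n := n_ge103 e0 e1 FS sz.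
have n40 : 40 <= n := leq_trans (isT : 40 <= 103) n103.
pose i0 : I := Ordinal n0; pose c0 := nth (i0, i0, i0) s 0.
have [us ms] := Ps; have [[Pr Pc] [Dr Dc Dsy] _] := HP.
have en : (0 <= eps * n%:R)%R by rewrite mulr_ge0.
have tp (m : nat) : (m%:R <= eps * n%:R)%R -> m <= Num.truncn (eps * n%:R)%R by exact: truncn_nat.
have sin l : l < size s -> let c := nth (i0, i0, i0) s l in
    [/\ arrs (input_state s) 0 l = c.1.1, arrs (input_state s) 1 l = c.1.2
      & arrs (input_state s) 2 l = c.2].
  by move=> h; split; rewrite /= (nth_map (i0, i0, i0)).
apply: wp_seq; apply: (@wp_INIT R eps delta n n n40 (leqnn n) i0 c0).
- by [].
- by case=> [|[|x]] // _; rewrite /= nth_nil.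
- by case=> [|[|[|a]]].
- exact: sin 0 sz.
move=> st1 r1; have v51 : vars st1 5 = 0 := rep5 r1.
have [[eS eL _ _ _] _] := touches (A00 n40 c0) (marks i0); rewrite -/(A01 n40 i0 c0) in eS eL.
apply: wp_seq.
apply: (@wp_load R eps delta n _ i0 _ P s (input_state s) ms erefl sin n (leqnn n) size_sqr _ _ _ _ us r1).
move=> st2 r2; apply: wp_seq; apply: (wp_assign 0) => //.
apply: (@wp_main R eps delta n (k0 n) i0 _ _ _ (dihedral0 n40 c0) P (Num.truncn (eps * n%:R)%R)
  _ _ _ Pr Pc s (input_state s) ms erefl sin n (leqnn n) size_sqr) => //.
- move=> i; apply: tp; apply: le_trans (Dr i); rewrite ler_nat; apply/eq_leq/eq_card => j.
  by rewrite !inE; case: (P i j).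
- move=> j; apply: tp; apply: le_trans (Dc j); rewrite ler_nat; apply/eq_leq/eq_card => i.
  by rewrite !inE; case: (P i j).
- move=> x; apply: tp; apply: le_trans (Dsy x); rewrite ler_nat; apply/eq_leq/eq_card => c.
  by rewrite !inE.
- move=> l M l0 lS hM; split.
  + apply: (counts_ok e0 e1 FS sz); first by have := n_half n40; clear; lia.
      by apply: leq_ltn_trans l0 lS.
    by apply: leq_trans hM _; rewrite leq_add2r leq_mul2l; move: lS; clear; lia.
  + have := F_lt_sqr e0 e1 FS; rewrite /capv; move: (n * n) (size s) hM l0 lS => q F; clear; lia.
  + exact: leq_trans n103.
- exists (commit (Ds n40 c0) (A01 n40 i0 c0)), (size (marks i0)); split.
  + exact: rep_idx r2.
  + have := inv0 n40 i0 c0; by rewrite eL.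
  + by rewrite marks_size; case: ifP.
  + rewrite take0 cats0 (take_nth (i0, i0, i0)) // take0 /= andbT /sat /= eS /=.
    by rewrite (first_sat n40 c0).
- move=> st3 A hs lat hL; exists (\matrix_(i, j) sqL (aS A) i j)%R; split; last first.
    by move=> i j; rewrite hL mxE.
  split; first by apply: (latin_sq lat) => i j; rewrite mxE.
  move=> i j x h; rewrite mxE; apply/eqP; apply: (allP hs (i, j, x)).
  by rewrite ms h.
Qed.

Lemma wp_MAIN : wp MAIN solved (input_state s).
Proof.
apply: (wp_if (b := 0 < size s)); first by rewrite /= lt0n.
  exact: wp_nonempty.
by rewrite -leqNgt leqn0 size_eq0 => /eqP s0; apply: wp_cyclic.
Qed.

Lemma exec_MAIN e : pok e MAIN ->
  exists (L : 'M['I_n]_n) (st : state) (t : nat),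
    [/\ exec eps delta (100 ^ e * n ^ (2 * e)) (comp MAIN) (input_state s) st t,
        t <= tbound 0 MAIN * 8 * n ^ 3, completion P L & outputs L st].
Proof.
move=> ok; have [st [t [r ht [L [hL hout]]]]] := wp_MAIN; exists L, st, t.
have hW : capv n ^ e <= 100 ^ e * n ^ (2 * e) by rewrite /capv expnMn mulnn -expnM.
have [ex _ _] := run_exec n0 hW ok (erefl : vars (input_state s) 0 = n) input_bounded r.
split=> //; apply: leq_trans ht (leq_trans (tbound_poly n MAIN) _).
rewrite MAIN_depth -mulnA leq_mul2l (_ : 8 = 2 ^ 3) // -expnMn leq_exp2r //.
by apply/orP; right; rewrite -addn1 mul2n -addnn leq_add2l.
Qed.

End Main.

Theorem theorem3p2p1 (R : realType) :
  (forall eps delta : R, constants_ok eps delta ->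
     forall (n : nat) (P : 'M[option 'I_n]_n),
       eligible eps delta P -> completable P) /\
  (exists p : prog, forall eps delta : R, constants_ok eps delta ->
     completes_in_cubic_time p eps delta).
Proof.
have [e ok] := MAIN_ok; split=> [eps delta Hc n P HP|]; last first.
  exists (comp MAIN) => eps delta Hc; exists (tbound 0 MAIN * 8), (100 ^ e), (2 * e).
  by move=> n P s n0 HP Ps; exact: exec_MAIN Hc HP _ ok.
case: n P HP => [|n] P HP.
  by exists (\matrix_(i, j) i)%R; split; [split=> -[]|case].
pose s := [seq c <- enum {: 'I_n.+1 * 'I_n.+1 * 'I_n.+1} | P c.1.1 c.1.2 == Some c.2].
have Ps : lists_cells P s.
  split; first by rewrite filter_uniq ?enum_uniq.
  by move=> i j x; rewrite mem_filter mem_enum andbT.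
by have [L [_ [_ [_ _ hL _]]]] := exec_MAIN (isT : 0 < n.+1) Ps Hc HP ok; exists L.
Qed.
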